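(* For every irrational $\alpha$ there exist special flows over the rotation of angle $\alpha$ having a cyclic group of eigenvalues and hence a mixed spectrum, with moreover: - if $\inf_{q>0}\ q/(-\ln\|q\alpha\|)=0$, a ceiling function that is analytic on $\mathbb T$; - if $\inf_{q>0}\ q^{k+1}\|q\alpha\|=0$ ($k\in\mathbb N$), a ceiling function in $C^k(\mathbb T)$.
   Context: $\mathbb T=\mathbb R/\mathbb Z$, $T$ is the translation by $\alpha$, $\|x\|$ is the distance to the nearest integer; infima are over integers $q$. For a strictly positive integrable function $\phi$ on $\mathbb T$, normalized so that $\int_{\mathbb T}\phi\,d\lambda=1$, the special flow $\tau_{\alpha,\phi}$ over $T$ with ceiling function $\phi$ is the flow $\tau^{t}_{\alpha,\phi}(x,y)=(x,y+t)$ on the quotient of $\mathbb T\times\mathbb R$ by the equivalence relation generated by $(x,y+\phi(x))\sim(Tx,y)$, identified with $\{(x,y):0\le y<\phi(x)\}$ equipped with Lebesgue measure. A real $t$ is an eigenvalue of the flow if there is a measurable $F$, not a.e. zero, with $F\circ\tau^{t'}_{\alpha,\phi}=e^{2i\pi tt'}F$ a.e. for all real $t'$. Mixed spectrum: the flow has non-zero eigenvalues but its spectrum is not purely discrete. *)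

(* Defs.v *)
From HB Require Import structures.
From Stdlib Require Import Relation_Operators.
From mathcomp Require Import all_boot all_order all_algebra.
From mathcomp Require Import generic_quotient.
From mathcomp Require Import all_classical all_reals all_analysis.
From mathcomp Require Import measurable_realfun complex.

Set Implicit Arguments.
Unset Strict Implicit.
Unset Printing Implicit Defensive.

Import Order.TTheory GRing.Theory Num.Theory.
Import numFieldNormedType.Exports.

Local Open Scope classical_set_scope.
Local Open Scope ring_scope.

Section arithmetic.
Context {R : realType}.

Definition dist_int (x : R) : R := inf [set `|x - n%:~R| | n in [set: int]].

End arithmetic.

Section regularity.
Context {R : realType}.
Implicit Type f : R -> R.

(* derive1n is total; its values are genuine derivatives because the lower
   ones are required to be differentiable. *)
Definition continuously_differentiable (k : nat) f : Prop :=
  (forall j, (j < k)%N -> forall x, derivable (derive1n j f) x 1) /\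
  continuous (derive1n k f).

Definition real_analytic f : Prop :=
  forall x : R, exists (a : nat -> R) (r : R), 0 < r /\
    forall h, `|h| < r ->
      ([series a n * h ^+ n]_n @ \oo --> f (x + h)).

End regularity.

(* Functions on R/Z are 1-periodic functions on R, and the integral over R/Z
   is the integral over the fundamental domain [0, 1[. *)
Record ceiling (R : realType) := Ceiling {
  ceiling_fun :> R -> R ;
  ceiling_periodic : forall x, ceiling_fun (x + 1) = ceiling_fun x ;
  ceiling_gt0 : forall x, 0 < ceiling_fun x ;
  ceiling_integrable :
    (@lebesgue_measure R).-integrable `[0, 1[ (EFin \o ceiling_fun) ;
  ceiling_integral1 :
    (\int[@lebesgue_measure R]_(x in `[0%R, 1%R[) (ceiling_fun x)%:E = 1)%E
}.

Section special_space.
Context {R : realType}.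
Variables (alpha : R) (phi : R -> R).

(* The quotient of (R/Z) x R is taken in one step, as a quotient of R x R. *)
Inductive special_step : R * R -> R * R -> Prop :=
| special_step_period x y : special_step (x + 1, y) (x, y)
| special_step_roof x y : special_step (x, y + phi x) (x + alpha, y).

Definition special_rel : rel (R * R) :=
  fun p q => `[< clos_refl_sym_trans _ special_step p q >].

Lemma special_rel_refl : reflexive special_rel.
Proof. by move=> p; apply/asboolP; exact: rst_refl. Qed.

Lemma special_rel_sym : symmetric special_rel.
Proof. by move=> p q; apply: asbool_equiv_eq; split; exact: rst_sym. Qed.

Lemma special_rel_trans : transitive special_rel.
Proof.
by move=> q p r /asboolP pq /asboolP qr; apply/asboolP; exact: rst_trans pq qr.
Qed.

Canonical special_equiv :=
  EquivRel special_rel special_rel_refl special_rel_sym special_rel_trans.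

Local Notation Q := {eq_quot special_rel}%qT.

Definition special_space : Type := Q.

HB.instance Definition _ := Choice.on special_space.

Definition special_pi (p : R * R) : special_space :=
  (\pi_Q p)%qT.

HB.instance Definition _ := isPointed.Build special_space (special_pi (0, 0)).

Definition special_measurable : set (set special_space) :=
  [set A | measurable
     (special_pi @^-1` A : set (measurableTypeR R * measurableTypeR R))].

Lemma special_measurable0 : special_measurable set0.
Proof. by rewrite /special_measurable /= preimage_set0. Qed.

Lemma special_measurableC A : special_measurable A -> special_measurable (~` A).
Proof. by rewrite /special_measurable /= -preimage_setC; exact: measurableC. Qed.

Lemma special_measurable_bigcup (F : (set special_space)^nat) :
  (forall i, special_measurable (F i)) -> special_measurable (\bigcup_i F i).
Proof.
move=> mF; rewrite /special_measurable /= preimage_bigcup.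
by apply: bigcup_measurable => i _; exact: mF.
Qed.

HB.instance Definition _ := isMeasurable.Build default_measure_display
  special_space special_measurable0 special_measurableC
  special_measurable_bigcup.

Lemma measurable_special_pi :
  measurable_fun [set: measurableTypeR R * measurableTypeR R] special_pi.
Proof. by move=> _ A mA; rewrite setTI. Qed.

Definition special_flow (s : R) (u : special_space) : special_space :=
  let p := repr (u : Q) in special_pi (p.1, p.2 + s).

Lemma special_flowE s x y :
  special_flow s (special_pi (x, y)) = special_pi (x, y + s).
Proof.
rewrite /special_flow; apply/eqP; rewrite /special_pi eqmodE.
have /eqP : (\pi_Q
    (repr (\pi_Q (x, y))) =
  \pi_Q (x, y))%qT by rewrite reprK.
rewrite eqmodE => /asboolP; set p := repr _ => pxy; apply/asboolP.
rewrite -[(x, y + s)]/((x, y).1, (x, y).2 + s).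
elim: pxy => {p} [p q [a b|a b]|p|p q _ ih|p q r _ ih1 _ ih2] /=.
- exact/rst_step/special_step_period.
- by rewrite addrAC; exact/rst_step/special_step_roof.
- exact: rst_refl.
- exact: rst_sym.
- exact: rst_trans ih1 ih2.
Qed.

Definition special_domain : set (R * R) :=
  [set p | 0 <= p.1 < 1 /\ 0 <= p.2 < phi p.1].

End special_space.

Section special_measure.
Context {R : realType}.
Variables (alpha : R) (phi : ceiling R).

Lemma measurable_special_domain :
  measurable (special_domain phi : set (measurableTypeR R * measurableTypeR R)).
Proof.
have /measurable_int/measurable_EFinP mphi := ceiling_integrable phi.
have mI : measurable (`[0, 1[ : set (measurableTypeR R)) by [].
have mg := (measurable_restrictT (phi : measurableTypeR R -> measurableTypeR R) mI).1 mphi.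
set g := (phi \_ `[0%R, 1%R[) in mg.
have mh : measurable_fun [set: measurableTypeR R * measurableTypeR R]
    (fun p => (g p.1 - p.2 : measurableTypeR R)).
  by apply: measurable_funB => //; exact: measurableT_comp.
rewrite (_ : special_domain phi =
   (`[0, 1[ `*` `[0, +oo[) `&` (setT `&` (fun p => g p.1 - p.2) @^-1` `]0, +oo[)).
  by apply: measurableI; [exact: measurableX | exact: mh].
apply/seteqP; split=> -[x y] /=; rewrite /special_domain /= !in_itv /= !andbT.
- move=> [x01 /andP[y0 yp]]; split=> //; split=> //.
  by rewrite /g patchE mem_set/= ?in_itv//= subr_gt0.
- move=> [[x01 y0] [_]]; rewrite /g patchE mem_set/= ?in_itv//= subr_gt0 => yp.
  by rewrite x01 y0.
Qed.

(* special_domain is a fundamental domain up to a null set, so special_space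
   carries the Lebesgue measure of special_domain. *)
Definition special_measure : set (special_space alpha phi) -> \bar R :=
  pushforward
    (mrestr (@lebesgue_measure R \x @lebesgue_measure R)%E
            measurable_special_domain)
    (special_pi alpha phi).

Let special_measure0 : special_measure set0 = 0%E.
Proof. by rewrite /special_measure /pushforward preimage_set0 measure0. Qed.

Let special_measure_ge0 A : (0 <= special_measure A)%E.
Proof. by rewrite /special_measure /pushforward; exact: measure_ge0. Qed.

Let special_measure_sigma_additive : semi_sigma_additive special_measure.
Proof.
move=> F mF tF mUF; rewrite /special_measure /pushforward preimage_bigcup.
apply: measure_semi_sigma_additive.
- exact: mF.
- apply/trivIsetP => /= i j _ _ ij; rewrite -preimage_setI.
  by move/trivIsetP : tF => /(_ _ _ _ _ ij) ->//; rewrite preimage_set0.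
- by rewrite -preimage_bigcup; exact: mUF.
Qed.

HB.instance Definition _ := isMeasure.Build _ _ _ special_measure
  special_measure0 special_measure_ge0 special_measure_sigma_additive.

End special_measure.

Arguments special_measure {R} alpha phi A.

Section spectrum.
Context {R : realType}.
Variables (alpha : R) (phi : ceiling R).

Local Notation X := (special_space alpha phi).
Local Notation mu := (special_measure alpha phi).

Definition cmeasurable (F : X -> R[i]) : Prop :=
  measurable_fun [set: X] (fun u => complex.Re (F u) : measurableTypeR R) /\
  measurable_fun [set: X] (fun u => complex.Im (F u) : measurableTypeR R).

Definition cis (a : R) : R[i] := (cos a +i* sin a)%C.

Definition eigenfunction (t : R) (F : X -> R[i]) : Prop :=
  [/\ cmeasurable F,
      ~ {ae mu, forall u, F u = 0} &
      forall s : R,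
        {ae mu, forall u, F (special_flow s u) = cis (2 * pi * t * s) * F u}].

Definition eigenvalue (t : R) : Prop := exists F, eigenfunction t F.

(* t0 = 0 is ruled out when combined with mixed_spectrum. *)
Definition cyclic_eigenvalues : Prop :=
  exists t0 : R, forall t, eigenvalue t <-> exists m : int, t = t0 *~ m.

Definition L2norm (F : X -> R[i]) : \bar R :=
  Lnorm mu 2%:E (fun u => (Normc.normc (F u))%:E).

Definition L2 (F : X -> R[i]) : Prop := cmeasurable F /\ (L2norm F < +oo)%E.

(* The linear span of the eigenfunctions is dense in L^2; eigenfunctions are
   only required to be measurable, hence the L2 side condition. *)
Definition purely_discrete_spectrum : Prop :=
  forall G, L2 G -> forall e : R, 0 < e ->
  exists (n : nat) (t : 'I_n -> R) (F : 'I_n -> X -> R[i]) (c : 'I_n -> R[i]),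
    (forall i, eigenfunction (t i) (F i) /\ L2 (F i)) /\
    (L2norm (fun u => (G u - \sum_(i < n) c i * F i u)%R) < e%:E)%E.

Definition mixed_spectrum : Prop :=
  (exists2 t, t != 0 & eigenvalue t) /\ ~ purely_discrete_spectrum.

End spectrum.

(* Main.v *)
Require Import Defs.
From mathcomp Require Import all_boot all_order all_algebra.
From mathcomp Require Import all_classical all_reals all_analysis.
From mathcomp Require Import measurable_realfun complex.
From mathcomp Require Import ring lra.
Set Implicit Arguments.
Unset Strict Implicit.
Unset Printing Implicit Defensive.
Import Order.TTheory GRing.Theory Num.Theory.
Import numFieldNormedType.Exports.
Local Open Scope classical_set_scope.
Local Open Scope ring_scope.

(** The ceiling is [phi = 1 + f] where [f] is a sum of coboundaries
    [x |-> g m (x + alpha) - g m x] with [g m x = G m (q m x)].  Here [G m] is a trigonometric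
    polynomial with values in [0, 1], close to [0] on the first half of its period and close to
    [1] on the second half ([trig_poly_step]).  When [q m * alpha] is very close to an integer the
    coboundary is very small, although [g m] is not: its amplitudes are at most those of [G m] multiplied
    by constants and by the distance from [q m * alpha] to the integers ([coboundary_modes_weight]).  How small it
    must be for the sum to be continuous, [C ^ k] or analytic is measured by a weight [w] on the
    frequencies: [1], [(1 + om) ^ (k + 1)] or [exp (2 om)]
    ([continuously_differentiable_mode_series], [real_analytic_mode_series]), and
    irrationality and the two hypotheses on [alpha] provide the frequencies [q m] for the three
    weights.

    The series of the transfer functions [g m] diverges.  But the values of [g m] are mostly close
    to [0] or [1], and the series converges after removal of the integer parts, on an invariant set
    of positive measure ([tower_transfer], [tower_good_positive]).  So [f] is the coboundary of a
    measurable function [theta] modulo the integers, and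
    [F (x, y) = exp (2 i pi n (theta x + y))], extended by zero outside the set, is an
    eigenfunction for every integer [n] ([tower_eigenvalue_int]).

    There are no other eigenvalues.  A time [N m] is chosen such that [N m * alpha] is, modulo the
    integers, almost [1 / (4 q m)].  The sum of [phi] along [N m] iterates then exceeds [N m] by
    about [G m (q m x + 1/4) - G m (q m x)]; it is close to [N m] on a quarter of the points and
    close to [N m + 1] on another quarter, and every point is within [1 / q m] of both
    ([split_returns_of_tower]).  Averages of an eigenfunction of eigenvalue [t] over short vertical
    windows are continuous in mean along the base, so both [exp (2 i pi t N m)] and
    [exp (2 i pi t (N m + 1))] tend to [1], and [t] is an integer ([eigenvalue_int]).

    Therefore the time-one map of the flow fixes every eigenfunction.  It does not fix the indicator
    of a small rectangle, which it moves off itself, and this indicator is at a positive distance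
    in [L ^ 2] from every function fixed by the time-one map
    ([int_eigenvalues_not_purely_discrete]): the spectrum is mixed. *)

(** * Diophantine approximation and periodic functions *)

Section diophantine.
Context {R : realType}.
Implicit Types (alpha : R).

Lemma irrational_natmul_neq alpha (q : nat) (p : int) :
  irrational alpha -> (0 < q)%N -> q%:R * alpha != p%:~R.
Proof.
move=> ia q0; apply/eqP => e; apply: ia.
exists (p%:~R / q%:R : rat) => //.
have q0' : (q%:R : R) != 0 by rewrite pnatr_eq0 -lt0n.
by rewrite fmorph_div/= ratr_int ratr_nat -e mulrAC divff// mul1r.
Qed.

(** Pigeonhole: two of the numbers [i * alpha], [i <= K + 1], have fractional parts in the same
    interval of length [1 / (K + 1)]. *)
Lemma dirichlet alpha (e : R) : 0 < e ->
  exists (q : nat) (p : int), (0 < q)%N /\ `|q%:R * alpha - p%:~R| < e.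
Proof.
move=> e0.
have [K Ke] : exists K : nat, e^-1 < K.+1%:R.
  by exists (Num.truncn e^-1); exact: truncnS_gt.
pose fr (x : R) := x - (Num.floor x)%:~R.
have fr0 x : 0 <= fr x by rewrite subr_ge0 floor_le.
have fr1 x : fr x < 1.
  by rewrite /fr; have := floorD1_gt x; rewrite intrD; lra.
have K0 : (0 : R) < K.+1%:R by rewrite ltr0n.
have bd (i : 'I_K.+2) : (Num.truncn (K.+1%:R * fr (i%:R * alpha))%R < K.+1)%N.
  have H0 : 0 <= K.+1%:R * fr (i%:R * alpha) by exact: mulr_ge0 (ltW K0) (fr0 _).
  by rewrite truncn_lt_nat// gtr_pMr.
pose b i : 'I_K.+1 := Ordinal (bd i).
have : ~~ injectiveb b.
  apply/negP => /injectiveP/leq_card; rewrite !card_ord.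
  by rewrite ltnn.
case/injectivePn => i [j ij bij].
wlog ltij : i j ij bij / (i < j)%N.
  move=> H; have [|ji|/val_inj eij] := ltngtP i j; first exact: H.
    by apply: (H j i) => //; rewrite eq_sym.
  by rewrite eij eqxx in ij.
exists (j - i)%N, (Num.floor (j%:R * alpha) - Num.floor (i%:R * alpha)).
split; first by rewrite subn_gt0.
rewrite natrB 1?ltnW// intrB.
have -> : (j%:R - i%:R) * alpha - ((Num.floor (j%:R * alpha))%:~R - (Num.floor (i%:R * alpha))%:~R) = fr (j%:R * alpha) - fr ((i : nat)%:R * alpha).
  by rewrite /fr; ring.
have /(congr1 val)/= tij := bij.
have := truncn_itv (mulr_ge0 (ltW K0) (fr0 (i%:R * alpha))).
have := truncn_itv (mulr_ge0 (ltW K0) (fr0 (j%:R * alpha))).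
rewrite -tij => /andP[j1 j2] /andP[i1 i2].
have H : K.+1%:R * `|fr (j%:R * alpha) - fr ((i : nat)%:R * alpha)| < 1.
  rewrite -[X in X * _]ger0_norm 1?ltW// -normrM mulrBr.
  rewrite ltr_norml; move: i1 i2 j1 j2; rewrite -[in X in _ < X]addn1 natrD.
  by lra.
have : 1 < K.+1%:R * e by rewrite -ltr_pdivrMr// mul1r.
move=> H1; have := lt_trans H H1.
by rewrite ltr_pM2l.
Qed.

(** The multiples of one small number [q * alpha - p] form a fine net of a half-line. *)
Lemma dense_orbit alpha (b e : R) : irrational alpha -> 0 < e ->
  exists (n : nat) (p : int), `|n%:R * alpha - p%:~R - b| < e.
Proof.
move=> ia e0; have [q [p [q0 de]]] := dirichlet alpha e0.
have := irrational_natmul_neq p ia q0; rewrite -subr_eq0.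
set d := _ - _ in de * => d0.
(* b is moved by an integer to the side of 0 on which d lies *)
pose c := b - (Num.floor (b / Num.sg d))%:~R * Num.sg d.
have sd : Num.sg d * Num.sg d = 1 by rewrite -expr2 sqr_sg d0.
have sg0 : Num.sg d != 0 by rewrite sgr_eq0.
have cd : 0 <= c / d.
  rewrite [X in X / _](_ : c = (b / Num.sg d - (Num.floor (b / Num.sg d))%:~R) * Num.sg d); last first.
    by rewrite mulrBl divfK.
  rewrite -mulrA mulr_ge0 ?subr_ge0 ?floor_le//.
  by rewrite [X in _ / X]numEsg invfM mulrA divff// mul1r invr_ge0.
have := truncn_itv cd; set k := Num.truncn _ => /andP[k1 k2].
have [s es] : exists s : int, Num.sg d = s%:~R.
  by case: sgrP d0 => // _ _; [exists 1|exists (-1)].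
exists (k * q)%N, (k%:Z * p - Num.floor (b / Num.sg d) * s).
rewrite (_ : _ - _ - _ = - (c / d - k%:R) * d); last first.
  rewrite mulNr mulrBl divfK// /c /d natrM intrB intrM intrM -es.
  by rewrite pmulrn; ring.
rewrite normrM normrN -[ltRHS]mul1r; apply: ltr_pM => //.
by rewrite ger0_norm ?subr_ge0// ltrBlDl natr1.
Qed.

Lemma dist_int_lt (x e : R) : dist_int x < e -> exists p : int, `|x - p%:~R| < e.
Proof.
move=> xe; have [||y [p _ <-] pe] := @inf_adherent R [set `|x - n%:~R| | n in [set: int]] (e - dist_int x).
- by rewrite subr_gt0.
- split; first by exists `|x - 0%:~R|; exists 0.
  by exists 0 => _ [n _ <-].
by exists p; move: pe; rewrite -/(dist_int x) addrCA subrr addr0.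
Qed.

Lemma dist_int_le (x : R) (p : int) : dist_int x <= `|x - p%:~R|.
Proof.
apply: ge_inf; last by exists p.
by exists 0 => _ [n _ <-].
Qed.

Lemma dist_int_gt0 (x : R) : (forall p : int, x != p%:~R) -> 0 < dist_int x.
Proof.
move=> xp; pose n := Num.floor x.
have xn : n%:~R < x by rewrite lt_neqAle floor_le eq_sym xp.
have xn1 : x < n%:~R + 1 by have := floorD1_gt x; rewrite intrD.
apply: (@lt_le_trans _ _ (Num.min (x - n%:~R) (n%:~R + 1 - x))).
  by rewrite lt_min !subr_gt0 xn xn1.
apply: lb_le_inf; first by exists `|x - 0%:~R|; exists 0.
move=> _ [p _ <-]; have [pn|np] := leP p n.
  apply: (@le_trans _ _ (x - p%:~R)); last exact: ler_norm.
  by rewrite ge_min lerD2l lerN2 ler_int pn.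
apply: (@le_trans _ _ (p%:~R - x)); last by rewrite distrC ler_norm.
rewrite ge_min lerD2r; apply/orP; right.
by rewrite -[1]/(1%:~R) -intrD ler_int -ltzD1 ltrD2r.
Qed.

Lemma dist_int_lt1 (x : R) : dist_int x < 1.
Proof.
apply: le_lt_trans (dist_int_le x (Num.floor x)) _.
rewrite ger0_norm ?subr_ge0 ?floor_le//.
by have := floorD1_gt x; rewrite intrD; lra.
Qed.

(** The finitely many terms of index below [Q] have a positive minimum, so that the terms close
    to the infimum have larger indices. *)
Lemma inf_eq0_infinitely_often (v : nat -> R) :
  (forall q, (0 < q)%N -> 0 < v q) ->
  inf [set v q | q in [set q : nat | (0 < q)%N]] = 0 ->
  forall (e : R) (Q : nat), 0 < e -> exists q : nat, [/\ (0 < q)%N, (Q <= q)%N & v q < e].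
Proof.
move=> v0 infv e Q e0.
have [e1 [e10 e1v]] : exists e1 : R, 0 < e1 /\ forall q, (0 < q)%N -> (q < Q)%N -> e1 <= v q.
  elim: Q => [|Q [e1 [e10 H]]]; first by exists 1.
  have [->|Q0] := posnP Q; first by exists 1; split=> // -[].
  exists (Num.min e1 (v Q)); split; first by rewrite lt_min e10 v0.
  move=> q q0; rewrite ltnS leq_eqVlt => /orP[/eqP->|qQ].
    by rewrite ge_min lexx orbT.
  by rewrite ge_min H.
have [||_ [q q0 <-]] := @inf_adherent R [set v q | q in [set q : nat | (0 < q)%N]] (Num.min e e1).
- by rewrite lt_min e0.
- split; first by exists (v 1%N); exists 1%N.
  by exists 0 => _ [n n0 <-]; rewrite ltW// v0.
rewrite infv add0r lt_min => /andP[qe qe1]; exists q; split => //.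
by rewrite leqNgt; apply/negP => qQ; have := e1v q q0 qQ; rewrite leNgt qe1.
Qed.

Lemma periodic_int (T : Type) (g : R -> T) : (forall x, g (x + 1) = g x) ->
  forall (p : int) x, g (x + p%:~R) = g x.
Proof.
move=> g1.
have gn (n : nat) x : g (x + n%:R) = g x.
  elim: n => [|n IH]; first by rewrite addr0.
  by rewrite -natr1 addrA g1 IH.
case=> n x; first exact: gn.
by rewrite -[LHS](gn n.+1) NegzE mulrNz -pmulrn subrK.
Qed.

End diophantine.

(** * Taylor remainders of the cosine *)

Section cosine_taylor.
Context {R : realType}.

(** The remainder of order [n] of the Taylor expansion of [y |-> cos (a + y)] at [0]; the [i]-th
    derivative of the cosine is its shift by [i * (pi / 2)]. *)
Definition cos_rem (n : nat) (a y : R) : R :=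
  cos (a + y) - \sum_(i < n) cos (a + i%:R * (pi / 2)) * (y ^+ i / i`!%:R).

Lemma cos_remS n (a y : R) : cos_rem n.+1 a y =
  cos_rem n a y - cos (a + n%:R * (pi / 2)) * (y ^+ n / n`!%:R).
Proof. by rewrite /cos_rem big_ord_recr/= opprD addrA. Qed.

Lemma is_derive_divided_power n (c y : R) :
  is_derive y 1 (fun y : R => c * (y ^+ n.+1 / n.+1`!%:R)) (c * (y ^+ n / n`!%:R)).
Proof.
have := is_deriveZ (c / n.+1`!%:R) (is_deriveX n.+1 (is_derive_id y 1)).
rewrite (_ : _ \*: _ = fun y : R => c * (y ^+ n.+1 / n.+1`!%:R)); last first.
  apply/funext => z; rewrite -[LHS]/(c / n.+1`!%:R * (id ^+ n.+1 : R -> R) z) exprfctE.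
  by rewrite mulrAC mulrA.
move=> d; apply: (is_derive_eq d).
rewrite /GRing.scale/= factS natrM.
have n1 : (n.+1%:R : R) != 0 by rewrite pnatr_eq0.
have nf : (n`!%:R : R) != 0 by rewrite pnatr_eq0 -lt0n fact_gt0.
by field; rewrite nf addrC natr1.
Qed.

(** Differentiation lowers the order of the remainder by one and shifts its phase, so that
    estimates on the remainders go by induction on the order, for all phases at once. *)
Lemma is_derive_cos_rem n (a y : R) :
  is_derive y 1 (cos_rem n.+1 a) (cos_rem n (a + pi / 2) y).
Proof.
elim: n => [|n IH].
  rewrite (_ : cos_rem 1 a = fun y => cos (a + y) - cos a); last first.
    by apply/funext => z; rewrite /cos_rem big_ord1/= mul0r addr0 expr0 fact0 divr1 mulr1.
  rewrite /cos_rem big_ord0 subr0 addrAC cosDpihalf.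
  apply: is_derive_eq.
  by rewrite subr0 add0r mulr1.
have d2 := is_derive_divided_power n (cos (a + n.+1%:R * (pi / 2))) y.
rewrite (_ : cos_rem n.+2 a = cos_rem n.+1 a - (fun y : R => cos (a + n.+1%:R * (pi / 2)) * (y ^+ n.+1 / n.+1`!%:R))); last first.
  by apply/funext => z; rewrite cos_remS.
apply: (is_derive_eq (is_deriveB IH d2)).
rewrite cos_remS (_ : a + n.+1%:R * _ = a + pi / 2 + n%:R * (pi / 2))//.
by rewrite -natr1; ring.
Qed.

Lemma cos_rem0 n (a : R) : cos_rem n.+1 a 0 = 0.
Proof.
rewrite /cos_rem big_ord_recl/= mul0r !addr0 expr0 fact0 divr1 mulr1.
rewrite big1 ?addr0 ?subrr// => i _.
by rewrite exprS !mul0r mulr0.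
Qed.

(** With [cos_remN] this reduces estimates of the remainder to [0 <= y]. *)
Lemma cosB_nat_pihalf n (a : R) :
  cos (a - n%:R * (pi / 2)) = (-1) ^+ n * cos (a + n%:R * (pi / 2)).
Proof.
elim: n a => [|n IH] a; first by rewrite !mul0r subr0 addr0 expr0 mul1r.
rewrite (_ : a - _ = (a - pi / 2) - n%:R * (pi / 2)); last by rewrite -natr1; ring.
rewrite IH (_ : a - _ + _ = a + n%:R * (pi / 2) - pi / 2); last by ring.
rewrite (_ : a + n.+1%:R * _ = a + n%:R * (pi / 2) + pi / 2); last by rewrite -natr1; ring.
by rewrite cosBpihalf cosDpihalf exprS; ring.
Qed.

Lemma cos_remN n (a y : R) : cos_rem n a (- y) = cos_rem n (- a) y.
Proof.
rewrite /cos_rem; congr (_ - _).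
  by rewrite -cosN opprD opprK.
apply: eq_bigr => i _.
rewrite exprNn -[in RHS]cosN opprD opprK cosB_nat_pihalf.
by ring.
Qed.

(** By the mean value theorem: the derivatives of [y ^ n.+1 / n.+1! - s * cos_rem n.+1 a y],
    [s = 1] or [s = -1], are nonnegative by the estimate of order [n]. *)
Lemma cos_rem_le n (a y : R) : `|cos_rem n a y| <= `|y| ^+ n / n`!%:R.
Proof.
wlog y0 : a y / 0 <= y.
  move=> H; have [|y0] := leP 0 y; first exact: H.
  by rewrite -(opprK y) cos_remN normrN H// oppr_ge0 ltW.
rewrite (ger0_norm y0); elim: n a y y0 => [|n IH] a y y0.
  by rewrite /cos_rem big_ord0 subr0 expr0 fact0 divr1 cos_max.
pose b (y : R) := y ^+ n.+1 / n.+1`!%:R.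
have db (z : R) : is_derive z 1 b (z ^+ n / n`!%:R).
  have := is_derive_divided_power n 1 z; rewrite mul1r.
  by rewrite (_ : (fun y : R => 1 * _) = b)//; apply/funext => w; rewrite mul1r.
have b0 : b 0 = 0 by rewrite /b exprS !mul0r.
have main (s : R) : `|s| = 1 -> 0 <= b y - s * cos_rem n.+1 a y.
  move=> s1.
  have dh (z : R) : is_derive z 1 (fun z => b z - s * cos_rem n.+1 a z)
      (z ^+ n / n`!%:R - s * cos_rem n (a + pi / 2) z).
    have d2 := is_deriveZ s (is_derive_cos_rem n a z).
    exact: (is_deriveB (db z) d2).
  have [|c] := MVT_segment y0 (fun z _ => dh z).
    apply: continuous_subspaceT => z; apply: differentiable_continuous.
    by apply/derivable1_diffP; case: (dh z).
  rewrite in_itv/= => /andP[c0 cy].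
  rewrite b0 cos_rem0 mulr0 !subr0 => ->.
  rewrite mulr_ge0// subr_ge0; apply: le_trans (ler_norm _) _.
  by rewrite normrM s1 mul1r IH.
rewrite -/(b y) ler_norml.
have := main 1; have := main (-1); rewrite normrN normr1 => /(_ erefl) + /(_ erefl).
by lra.
Qed.

Lemma cos_lip (x y : R) : `|cos x - cos y| <= `|x - y|.
Proof.
have := cos_rem_le 1 y (x - y).
by rewrite /cos_rem big_ord1/= mul0r addr0 expr0 expr1 fact0 (_ : 1`! = 1)%N// !divr1 mulr1 addrCA subrr addr0.
Qed.

Lemma sin_lip (x y : R) : `|sin x - sin y| <= `|x - y|.
Proof.
rewrite -!cosBpihalf; apply: le_trans (cos_lip _ _) _.
by rewrite (_ : x - _ - _ = x - y)//; ring.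
Qed.

Lemma sin_le_norm (x : R) : `|sin x| <= `|x|.
Proof. by have := sin_lip x 0; rewrite sin0 !subr0. Qed.

Lemma cos_quad (a y : R) : `|cos (a + y) - cos a + y * sin a| <= `|y| ^+ 2.
Proof.
have := cos_rem_le 2 a y.
rewrite /cos_rem 2!big_ord_recr big_ord0/= mul0r !addr0 add0r expr0 expr1 !mul1r fact0 (_ : 1`! = 1)%N// cosDpihalf.
rewrite (_ : _ - (_ + _) = cos (a + y) - cos a + y * sin a); last by field.
move=> /le_trans; apply.
by rewrite ler_pdivrMr// ler_peMr ?exprn_ge0// ler1n.
Qed.

Lemma cosDn2pi (x : R) (n : int) : cos (x + n%:~R * (2 * pi)) = cos x.
Proof.
have H (m : nat) (z : R) : cos (z + m%:R * (2 * pi)) = cos z.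
  have := periodicn (@cosD2pi R) m z.
  by rewrite -[(_ *+ 2) *+ m]mulr_natl -[pi *+ 2]mulr_natl.
case: n => n; first exact: H.
by rewrite -[LHS](H n.+1) NegzE mulrNz mulNr -pmulrn subrK.
Qed.

Lemma sinDn2pi (x : R) (n : int) : sin (x + n%:~R * (2 * pi)) = sin x.
Proof. by rewrite -!cosBpihalf addrAC cosDn2pi. Qed.

(** On the fractional part [r] of [t] the equation reads [sin (pi r) = 0], and [sin] is positive
    on ]0, pi[. *)
Lemma cos_2pi_eq1 (t : R) : cos (2 * pi * t) = 1 -> exists n : int, t = n%:~R.
Proof.
move=> ct; exists (Num.floor t).
pose r := t - (Num.floor t)%:~R.
have r0 : 0 <= r by rewrite subr_ge0 floor_le.
have r1 : r < 1 by rewrite /r; have := floorD1_gt t; rewrite intrD; lra.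
have cr : cos (2 * pi * r) = 1.
  apply: etrans ct; rewrite /r -[RHS](cosDn2pi _ (- Num.floor t)); congr cos.
  by rewrite mulrNz; ring.
have [r0'|] := leP r 0; first by apply/eqP; rewrite -subr_eq0 -/r eq_le r0 r0'.
move=> r0'.
have : 0 < sin (pi * r).
  by apply: sin_gt0_pi; rewrite mulr_gt0 ?pi_gt0//= gtr_pMr ?pi_gt0.
have : sin (pi * r) ^+ 2 = 0.
  have := cos_mulr2n (pi * r); rewrite -(mulr_natl (pi * r)) mulrA cr.
  have := cos2Dsin2 (pi * r); rewrite -(mulr_natl (_ ^+ 2)) => e1 e2.
  by lra.
by move/eqP; rewrite sqrf_eq0 => /eqP->; rewrite ltxx.
Qed.

End cosine_taylor.

(** * Trigonometric polynomials close to a step function *)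

Section trigonometric_polynomials.
Context {R : realType}.
Implicit Types (g h : R -> R) (l : seq (R * int * R)).

(** The triple [(a, j, c)] stands for the mode [a cos (2 pi j z + c)]. *)
Definition trig_eval l (z : R) : R :=
  \sum_(t <- l) t.1.1 * cos (2 * pi * t.1.2%:~R * z + t.2).

Definition trig_poly g := exists l, forall z, g z = trig_eval l z.

Lemma trig_poly_mode (a : R) (j : int) (c : R) :
  trig_poly (fun z => a * cos (2 * pi * j%:~R * z + c)).
Proof. by exists [:: (a, j, c)] => z; rewrite /trig_eval big_seq1. Qed.

Lemma trig_poly_cst (a : R) : trig_poly (fun=> a).
Proof.
have [l H] := trig_poly_mode a 0 0; exists l => z; rewrite -H.
by rewrite mulr0 mul0r addr0 cos0 mulr1.
Qed.

Lemma trig_polyD g h : trig_poly g -> trig_poly h -> trig_poly (fun z => g z + h z).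
Proof.
by move=> [l gl] [k hk]; exists (l ++ k) => z; rewrite gl hk /trig_eval big_cat.
Qed.

Lemma trig_poly_sum (I : Type) (s : seq I) (g : I -> R -> R) :
  (forall i, trig_poly (g i)) -> trig_poly (fun z => \sum_(i <- s) g i z).
Proof.
move=> gt; elim: s => [|i s IH].
  by have [l H] := trig_poly_cst 0; exists l => z; rewrite big_nil -H.
by have [l H] := trig_polyD (gt i) IH; exists l => z; rewrite big_cons -H.
Qed.

(** The product-to-sum formula, mode by mode. *)
Lemma trig_polyM g h : trig_poly g -> trig_poly h -> trig_poly (fun z => g z * h z).
Proof.
move=> [l gl] [k hk].
have [m H] := trig_poly_sum l (fun t => trig_poly_sum k (fun s => trig_polyD
  (trig_poly_mode (t.1.1 * s.1.1 / 2) (t.1.2 + s.1.2) (t.2 + s.2))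
  (trig_poly_mode (t.1.1 * s.1.1 / 2) (t.1.2 - s.1.2) (t.2 - s.2)))).
exists m => z; rewrite -H gl hk mulr_suml; apply: eq_bigr => t _.
rewrite mulr_sumr; apply: eq_bigr => s _.
rewrite intrD intrB.
set A := 2 * pi * t.1.2%:~R * z + t.2; set B := 2 * pi * s.1.2%:~R * z + s.2.
rewrite (_ : 2 * pi * (t.1.2%:~R - s.1.2%:~R) * z + (t.2 - s.2) = A - B); last by rewrite /A /B; ring.
rewrite (_ : 2 * pi * (t.1.2%:~R + s.1.2%:~R) * z + (t.2 + s.2) = A + B); last by rewrite /A /B; ring.
by rewrite (cosD A B) (cosB A B); field.
Qed.

Lemma trig_polyX g n : trig_poly g -> trig_poly (fun z => g z ^+ n).
Proof.
move=> gt; elim: n => [|n IH]; first exact: trig_poly_cst.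
by have [l H] := trig_polyM gt IH; exists l => z; rewrite exprS H.
Qed.

Lemma trig_poly_sin : trig_poly (fun z => sin (2 * pi * z)).
Proof.
have [l H] := trig_poly_mode 1 1 (- (pi / 2)); exists l => z.
by rewrite -H mul1r mulr1 cosBpihalf.
Qed.

Lemma trig_polyD1 g (z : R) : trig_poly g -> g (z + 1) = g z.
Proof.
move=> [l gl]; rewrite !gl; apply: eq_bigr => t _; congr (_ * _).
rewrite -(cosDn2pi (2 * pi * t.1.2%:~R * z + t.2) t.1.2); congr cos; ring.
Qed.

Lemma trig_poly_lip g : trig_poly g ->
  exists2 L : R, 0 <= L & forall x y, `|g x - g y| <= L * `|x - y|.
Proof.
move=> [l gl]; exists (\sum_(t <- l) `|t.1.1| * `|2 * pi * t.1.2%:~R|).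
  by apply: sumr_ge0 => t _; rewrite mulr_ge0.
move=> x y; rewrite !gl /trig_eval -sumrB mulr_suml.
apply: le_trans (ler_norm_sum _ _ _) _; apply: ler_sum => t _.
rewrite -mulrBr [leLHS]normrM -[leRHS]mulrA ler_wpM2l// -normrM.
apply: le_trans (cos_lip _ _) _.
by rewrite le_eqVlt; apply/orP; left; apply/eqP; congr (`|_|); ring.
Qed.

(** [sin (2 pi z)] increases on [0, 1/4] and is symmetric about [1/4]. *)
Lemma sin_2pi_ge (e z : R) : 0 < e -> e <= z <= 1 / 2 - e ->
  0 < sin (2 * pi * e) <= sin (2 * pi * z).
Proof.
move=> e0; have pi0 := pi_gt0 R; wlog z4 : z / z <= 1 / 4.
  move=> H ez; have [z4|z4] := leP z (1 / 4); first exact: H.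
  have := H (1 / 2 - z).
  rewrite (_ : 2 * pi * (1 / 2 - z) = pi - 2 * pi * z); last by field.
  rewrite sinB sinpi cospi mul0r sub0r mulN1r opprK; apply; lra.
move=> /andP[ez ze]; apply/andP; split.
  by apply: sin_gt0_pi; rewrite !mulr_gt0//=; nra.
rewrite leNgt ltr_sin ?in_itv/= -?leNgt.
- by rewrite ler_pM2l// mulr_gt0.
- by apply/andP; split; nra.
- by apply/andP; split; nra.
Qed.

Lemma bernoulli_ineq (a : R) n : -1 <= a -> 1 + n%:R * a <= (1 + a) ^+ n.
Proof.
move=> a1; elim: n => [|n IH]; first by rewrite mul0r addr0 expr0.
rewrite exprS -natr1; have n0 : (0 : R) <= n%:R by [].
apply: (@le_trans _ _ ((1 + a) * (1 + n%:R * a))).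
  by have := mulr_ge0 n0 (sqr_ge0 a); rewrite expr2; lra.
by rewrite ler_wpM2l//; lra.
Qed.

(** With [x = (1 + sin) / 2], the polynomial [(1 - x ^ n) ^ (2 ^ n)] tends to [0] where
    [2 x > 1] and to [1] where [2 x < 1]: both follow from Bernoulli's inequality, because
    [2 ^ n * x ^ n = (1 + sin) ^ n]. *)
Lemma trig_poly_step (e : R) : 0 < e -> exists g, [/\ trig_poly g,
  forall z, 0 <= g z <= 1,
  forall z, e <= z <= 1 / 2 - e -> g z <= e &
  forall z, 1 / 2 + e <= z <= 1 - e -> 1 - e <= g z].
Proof.
move=> e0.
have [e2|e2] := ltP (1 / 4) e.
  exists (fun=> 0); split; first exact: trig_poly_cst.
  - by move=> z; rewrite lexx ler01.
  - by move=> z _; exact: ltW.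
  - by move=> z; lra.
set h := sin (2 * pi * e).
have h0 : 0 < h by have /andP[] := @sin_2pi_ge e e e0 ltac:(lra).
have h1 : h <= 1 by exact: sin_le1.
have [n ne] : exists n : nat, (e * h)^-1 < n%:R by exists (Num.truncn (e * h)^-1).+1; exact: truncnS_gt.
have neh : 1 <= e * (n%:R * h).
  by rewrite mulrCA -ler_pdivrMr ?mulr_gt0// mul1r ltW.
have neh0 : 0 <= n%:R * h by rewrite mulr_ge0// ltW.
pose x (z : R) := (1 + sin (2 * pi * z)) / 2.
have x0 z : 0 <= x z by rewrite /x; have := sin_geN1 (2 * pi * z); lra.
have x1 z : x z <= 1 by rewrite /x; have := sin_le1 (2 * pi * z); lra.
have xn z : 0 <= x z ^+ n <= 1 by rewrite exprn_ge0//= exprn_ile1.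
have xnE z : (2 ^ n)%:R * x z ^+ n = (1 + sin (2 * pi * z)) ^+ n.
  by rewrite natrX -exprMn /x mulrC divfK// pnatr_eq0.
exists (fun z => (1 - x z ^+ n) ^+ (2 ^ n)); split.
- apply: trig_polyX.
  have [l H] := trig_polyD (trig_poly_cst 1) (trig_polyM (trig_poly_cst (-1)) (@trig_polyX x n
    (trig_polyM (trig_polyD (trig_poly_cst 1) trig_poly_sin) (trig_poly_cst 2^-1)))).
  by exists l => z; rewrite -H mulN1r.
- move=> z; have /andP[? ?] := xn z; rewrite exprn_ge0 ?subr_ge0//=.
  by rewrite exprn_ile1// ?subr_ge0// lerBlDr lerDl.
- move=> z ez; have /andP[_] := sin_2pi_ge e0 ez; rewrite -/h => hz.
  have /andP[y0 y1] := xn z; set y := x z ^+ n in y0 y1 *.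
  have M1 : (1 - y) ^+ (2 ^ n) * (1 + y) ^+ (2 ^ n) <= 1.
    rewrite -exprMn exprn_ile1//; first by rewrite mulr_ge0//; lra.
    by rewrite -subr_sqr expr1n lerBlDr lerDl sqr_ge0.
  have M2 : n%:R * h <= (1 + y) ^+ (2 ^ n).
    apply: le_trans (bernoulli_ineq _ _); last by lra.
    rewrite /y xnE; apply: (@le_trans _ _ ((1 + h) ^+ n)).
      by apply: le_trans (bernoulli_ineq _ _); lra.
    have H : (1 + h) ^+ n <= (1 + sin (2 * pi * z)) ^+ n.
      by rewrite lerXn2r ?nnegrE//; lra.
    by lra.
  have : (1 - y) ^+ (2 ^ n) * (n%:R * h) <= 1.
    by apply: le_trans M1; rewrite ler_wpM2l// exprn_ge0// subr_ge0.
  move=> H; rewrite -(ler_pM2r (_ : 0 < n%:R * h)); first by lra.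
  by have := lt_le_trans ltr01 neh; rewrite pmulr_rgt0.
- move=> z ez.
  have /andP[_] := @sin_2pi_ge e (z - 1 / 2) e0 ltac:(lra).
  rewrite (_ : 2 * pi * (z - 1 / 2) = 2 * pi * z - pi); last by field.
  rewrite sinB cospi sinpi mulr0 subr0 mulrN1 -/h => hz.
  have /andP[y0 y1] := xn z; set y := x z ^+ n in y0 y1 *.
  have M1 : 1 - (2 ^ n)%:R * y <= (1 - y) ^+ (2 ^ n).
    by have := @bernoulli_ineq (- y) (2 ^ n); rewrite mulrN; apply; lra.
  apply: le_trans M1; rewrite lerD2l lerN2 /y xnE.
  apply: (@le_trans _ _ ((1 - h) ^+ n)).
    by have := sin_geN1 (2 * pi * z); move=> ?; rewrite lerXn2r ?nnegrE//; lra.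
  have M3 : (1 - h) ^+ n * (1 + h) ^+ n <= 1.
    rewrite -exprMn exprn_ile1//; first by rewrite mulr_ge0//; lra.
    by rewrite -subr_sqr expr1n lerBlDr lerDl sqr_ge0.
  have M4 : n%:R * h <= (1 + h) ^+ n.
    by apply: le_trans (bernoulli_ineq _ _); lra.
  have : (1 - h) ^+ n * (n%:R * h) <= 1.
    by apply: le_trans M3; rewrite ler_wpM2l// exprn_ge0// subr_ge0.
  move=> H; rewrite -(ler_pM2r (_ : 0 < n%:R * h)); first by lra.
  by have := lt_le_trans ltr01 neh; rewrite pmulr_rgt0.
Qed.

End trigonometric_polynomials.

(** * Series of modes: differentiability and analyticity *)

Section geometric_domination.
Context {R : realType}.
Implicit Types (u v : nat -> R) (s t C : R).

(** Convergence is stated with the sum as an argument, so that sums are combined without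
    convergence side conditions. *)
Definition sums_to u s := series u @ \oo --> s.

Lemma sums_toB u v s t : sums_to u s -> sums_to v t -> sums_to (fun m => u m - v m) (s - t).
Proof.
move=> us vt; rewrite /sums_to (_ : series _ = (fun n => series u n - series v n)); last first.
  by apply/funext => n; rewrite /series/= sumrB.
exact: cvgB.
Qed.

Lemma sums_toMr u s c : sums_to u s -> sums_to (fun m => u m * c) (s * c).
Proof.
move=> us; rewrite /sums_to (_ : series _ = (fun n => series u n * c)); last first.
  by apply/funext => n; rewrite /series/= mulr_suml.
by apply: cvgMl.
Qed.

Lemma sums_toD u v s t : sums_to u s -> sums_to v t -> sums_to (fun m => u m + v m) (s + t).
Proof.
move=> us vt; rewrite /sums_to (_ : series _ = (fun n => series u n + series v n)); last first.
  by apply/funext => n; rewrite /series/= big_split.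
exact: cvgD.
Qed.

Lemma sums_to0 : sums_to (fun=> 0) 0.
Proof.
rewrite /sums_to (_ : series _ = fun=> 0); first exact: cvg_cst.
by apply/funext => n; rewrite /series/= big1.
Qed.

Lemma sums_to_sum n (u : nat -> nat -> R) (s : nat -> R) :
  (forall i, sums_to (u i) (s i)) ->
  sums_to (fun m => \sum_(i < n) u i m) (\sum_(i < n) s i).
Proof.
move=> us; elim: n => [|n IH].
  rewrite big_ord0 (_ : (fun m => _) = fun=> 0); first exact: sums_to0.
  by apply/funext => m; rewrite big_ord0.
rewrite big_ord_recr/= (_ : (fun m => _) = fun m => \sum_(i < n) u i m + u n m).
  exact: sums_toD.
by apply/funext => m; rewrite big_ord_recr.
Qed.

Lemma sums_to_unique u s t : sums_to u s -> sums_to u t -> s = t.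
Proof. by move=> us ut; apply: cvg_unique us ut; exact: norm_hausdorff. Qed.

Lemma geo_sum_le C n : 0 <= C -> \sum_(0 <= m < n) C / 2 ^+ m <= 2 * C.
Proof.
move=> C0; suff -> : \sum_(0 <= m < n) C / 2 ^+ m = 2 * C - 2 * C / 2 ^+ n.
  by rewrite lerBlDr lerDl divr_ge0// ?mulr_ge0// exprn_ge0.
elim: n => [|n IH]; first by rewrite big_geq// expr0 divr1 subrr.
rewrite big_nat_recr//= IH exprS.
have : (2 : R) ^+ n != 0 by rewrite expf_neq0.
by move=> H; field.
Qed.

Lemma geo_sums_to u C : (forall m, `|u m| <= C / 2 ^+ m) -> exists s, sums_to u s.
Proof.
move=> uC; have C0 : 0 <= C by have := uC 0%N; rewrite expr0 divr1; apply: le_trans.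
suff : cvgn (series u) by move=> /cvg_ex[s us]; exists s.
apply: normed_cvg; apply: nondecreasing_is_cvgn.
  by apply: nondecreasing_series => // n _ _ /=.
exists (2 * C) => _ [n _ <-]; apply: le_trans (geo_sum_le n C0).
by apply: ler_sum => i _; exact: uC.
Qed.

Lemma geo_sums_to_le u s C : (forall m, `|u m| <= C / 2 ^+ m) -> sums_to u s -> `|s| <= 2 * C.
Proof.
move=> uC us; have C0 : 0 <= C by have := uC 0%N; rewrite expr0 divr1; apply: le_trans.
have H : `|series u n| @[n --> \oo] --> `|s| by exact: cvg_norm.
rewrite -(cvg_lim (@Rhausdorff R) H); apply: limr_le.
  by apply/cvg_ex; exists `|s|.
apply: nearW => n.
apply: le_trans (ler_norm_sum _ _ _) _; apply: le_trans (geo_sum_le n C0).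
by apply: ler_sum => i _; exact: uC.
Qed.

End geometric_domination.

Section mode_series.
Context {R : realType}.
Implicit Types (l : seq (R * R * R)) (w : R -> R).

(** The triple [(a, om, c)] stands for the mode [a cos (om x + c)]. *)
Definition mode_eval l (x : R) : R :=
  \sum_(t <- l) t.1.1 * cos (t.1.2 * x + t.2).

(** A weighted absolute sum of the amplitudes.  With [w om = om ^ j] it bounds the [j]-th
    derivative; growth of [w] is what forces smoothness of a series of such sums. *)
Definition mode_weight w l : R := \sum_(t <- l) `|t.1.1| * w `|t.1.2|.

Definition mode_derive (j : nat) l : seq (R * R * R) :=
  [seq (t.1.1 * t.1.2 ^+ j, t.1.2, t.2 + j%:R * (pi / 2)) | t <- l].

Lemma mode_eval_derive j l x : mode_eval (mode_derive j l) x =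
  \sum_(t <- l) t.1.1 * t.1.2 ^+ j * cos (t.1.2 * x + t.2 + j%:R * (pi / 2)).
Proof. by rewrite /mode_eval big_map; apply: eq_bigr => t _ /=; rewrite addrA. Qed.

Lemma mode_derive0 l : mode_derive 0 l = l.
Proof.
rewrite /mode_derive -[RHS]map_id; apply: eq_map => -[[a om] c] /=.
by rewrite expr0 mulr1 mul0r addr0.
Qed.

Lemma mode_eval_le (w : R -> R) l x : (forall om, 0 <= om -> 1 <= w om) ->
  `|mode_eval l x| <= mode_weight w l.
Proof.
move=> w1; apply: le_trans (ler_norm_sum _ _ _) _; apply: ler_sum => t _.
rewrite normrM ler_wpM2l//; apply: le_trans (cos_max _) _; exact: w1.
Qed.

Lemma mode_eval_derive_le (w : R -> R) K j l x : (forall om, 0 <= om -> om ^+ j <= K * w om) ->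
  `|mode_eval (mode_derive j l) x| <= K * mode_weight w l.
Proof.
move=> wK; rewrite mode_eval_derive.
apply: le_trans (ler_norm_sum _ _ _) _; rewrite /mode_weight mulr_sumr; apply: ler_sum => t _.
rewrite !normrM -mulrA [leRHS]mulrCA ler_wpM2l//.
apply: (@le_trans _ _ (`|t.1.2 ^+ j| * 1)); first by rewrite ler_wpM2l// cos_max.
by rewrite mulr1 normrX wK.
Qed.

Lemma mode_eval_lip (w : R -> R) j l x y : (forall om, 0 <= om -> om ^+ j.+1 <= w om) ->
  `|mode_eval (mode_derive j l) x - mode_eval (mode_derive j l) y| <= mode_weight w l * `|x - y|.
Proof.
move=> wK; rewrite !mode_eval_derive -sumrB.
apply: le_trans (ler_norm_sum _ _ _) _; rewrite /mode_weight mulr_suml; apply: ler_sum => t _.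
rewrite -mulrBr !normrM -!mulrA ler_wpM2l//.
apply: (@le_trans _ _ (`|t.1.2 ^+ j| * (`|t.1.2| * `|x - y|))).
  rewrite ler_wpM2l// -normrM; apply: le_trans (cos_lip _ _) _.
  by rewrite le_eqVlt; apply/orP; left; apply/eqP; congr (`|_|); ring.
by rewrite mulrA ler_wpM2r// normrX -exprSr wK.
Qed.

Lemma mode_eval_quad (w : R -> R) j l x h : (forall om, 0 <= om -> om ^+ j.+2 <= w om) ->
  `|mode_eval (mode_derive j l) (x + h) - mode_eval (mode_derive j l) x
    - mode_eval (mode_derive j.+1 l) x * h| <= mode_weight w l * h ^+ 2.
Proof.
move=> wK; rewrite !mode_eval_derive mulr_suml -!sumrB.
apply: le_trans (ler_norm_sum _ _ _) _; rewrite /mode_weight mulr_suml; apply: ler_sum => t _.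
set a := t.1.1; set om := t.1.2; set b := om * x + t.2 + j%:R * (pi / 2).
rewrite (_ : om * x + t.2 + j.+1%:R * (pi / 2) = b + pi / 2); last first.
  by rewrite /b -natr1; ring.
rewrite (_ : om * (x + h) + t.2 + j%:R * (pi / 2) = b + om * h); last by rewrite /b; ring.
rewrite cosDpihalf exprS.
rewrite (_ : _ - _ = a * om ^+ j * (cos (b + om * h) - cos b + om * h * sin b)); last by ring.
rewrite 2![in leLHS]normrM -!mulrA ler_wpM2l// mulrA.
apply: (@le_trans _ _ (`|om ^+ j| * `|om * h| ^+ 2)).
  by rewrite ler_wpM2l// cos_quad.
rewrite normrM exprMn mulrA (_ : `|h| ^+ 2 = h ^+ 2); last by rewrite -normrX ger0_norm ?sqr_ge0.
by rewrite ler_wpM2r ?sqr_ge0// normrX -exprD addn2 wK.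
Qed.

(** A quadratic error bound survives limits, unlike differentiability itself. *)
Lemma derivable_of_quad (f : R -> R) (x d C : R) :
  (forall h, `|f (x + h) - f x - d * h| <= C * h ^+ 2) ->
  derivable f x 1 /\ derive1 f x = d.
Proof.
move=> H.
have C0 : 0 <= C by have := H 1; rewrite expr1n [C * _]mulr1; apply: le_trans.
have C1 : 0 < C + 1 by rewrite ltr_wpDl.
have L : (fun h : R => h^-1 *: (f (h *: 1 + x) - f x)) @ 0^' --> d.
  apply/cvgrPdist_lt => e e0.
  near=> h.
  have h0 : h != 0 by near: h; exact: nbhs_dnbhs_neq.
  rewrite /GRing.scale/= mulr1 distrC.
  have -> : h^-1 * (f (h + x) - f x) - d = h^-1 * (f (x + h) - f x - d * h).
    by rewrite [h + x]addrC; field.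
  rewrite normrM normfV -ltr_pdivlMl ?invr_gt0 ?normr_gt0// invrK.
  apply: le_lt_trans (H h) _.
  rewrite -normr_id -[h ^+ 2]ger0_norm ?sqr_ge0// normrX expr2 mulrA mulrC normr_id ltr_pM2l ?normr_gt0//.
  have : `|h| < e / (C + 1).
    by near: h; apply: dnbhs0_lt; rewrite divr_gt0.
  rewrite ltr_pdivlMr// => /le_lt_trans; apply.
  by rewrite mulrC ler_wpM2l// lerDl.
split; first by apply/cvg_ex; exists d.
by rewrite derive1E; exact: cvg_lim.
Unshelve. all: by end_near. Qed.

(** A series of modes whose weights for [(1 + om) ^ (k + 1)] decay geometrically can be
    differentiated term by term [k] times: the spare factor [1 + om] bounds the
    second-order remainders, and the modulus of continuity of the last derivative. *)
Lemma continuously_differentiable_mode_series (k : nat) (l : nat -> seq (R * R * R)) (C : R) (f : R -> R) :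
  (forall m, mode_weight (fun om => (1 + om) ^+ k.+1) (l m) <= C / 2 ^+ m) ->
  (forall x, sums_to (fun m => mode_eval (l m) x) (f x)) ->
  continuously_differentiable k f.
Proof.
set w := fun om : R => (1 + om) ^+ k.+1 => wC lf.
have wj j om : (j <= k.+1)%N -> 0 <= om -> om ^+ j <= w om.
  move=> jk om0; apply: (@le_trans _ _ ((1 + om) ^+ j)).
    by rewrite lerXn2r ?nnegrE ?addr_ge0// lerDr.
  by rewrite /w ler_weXn2l// lerDl.
have [g gS] : {g : nat -> R -> R | forall j, (j <= k)%N -> forall x,
    sums_to (fun m => mode_eval (mode_derive j (l m)) x) (g j x)}.
  have H (jx : nat * R) : {s : R | (jx.1 <= k)%N -> sums_to (fun m => mode_eval (mode_derive jx.1 (l m)) jx.2) s}.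
    case: jx => j x /=; apply: cid; case: (leqP j k) => [jk|_]; last by exists 0.
    have [|s ss] := @geo_sums_to _ (fun m => mode_eval (mode_derive j (l m)) x) C.
      move=> m; apply: le_trans (wC m); rewrite -[leRHS]mul1r.
      by apply: mode_eval_derive_le => om om0; rewrite mul1r wj// ltnW.
    by exists s.
  by exists (fun j x => sval (H (j, x))) => j jk x; exact: (svalP (H (j, x))).
have dg j x : (j < k)%N -> derivable (g j) x 1 /\ derive1 (g j) x = g j.+1 x.
  move=> jk; apply: (@derivable_of_quad _ _ _ (2 * C)) => h.
  have S := sums_toB (sums_toB (gS j (ltnW jk) (x + h)) (gS j (ltnW jk) x))
    (sums_toMr (c := h) (gS j.+1 jk x)).
  rewrite -mulrA; apply: (geo_sums_to_le _ S) => m.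
  apply: (@le_trans _ _ (mode_weight w (l m) * h ^+ 2)).
    by apply: mode_eval_quad => om om0; apply: wj.
  by rewrite mulrAC ler_wpM2r ?sqr_ge0// wC.
have fg j : (j <= k)%N -> derive1n j f = g j.
  elim: j => [_|j IH jk].
    apply/funext => x; rewrite derive1n0; apply: sums_to_unique (lf x) _.
    have := gS 0%N (leq0n _) x; rewrite (_ : (fun m => _) = fun m => mode_eval (l m) x)//.
    by apply/funext => m; rewrite mode_derive0.
  by rewrite derive1nS IH 1?ltnW//; apply/funext => x; have [] := dg j x jk.
split.
  by move=> j jk x; rewrite fg 1?ltnW//; have [] := dg j x jk.
rewrite fg// => x; apply/cvgrPdist_lt => e e0.
have C0 : 0 <= C.
  have := wC 0%N; rewrite expr0 divr1; apply: le_trans.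
  by apply: sumr_ge0 => t _; rewrite mulr_ge0// /w exprn_ge0// addr_ge0.
near=> y.
apply: (@le_lt_trans _ _ (2 * (C * `|x - y|))).
  apply: (geo_sums_to_le _ (sums_toB (gS k (leqnn k) x) (gS k (leqnn k) y))) => m.
  apply: (@le_trans _ _ (mode_weight w (l m) * `|x - y|)).
    by apply: mode_eval_lip => om om0; exact: wj.
  by rewrite mulrAC ler_wpM2r// wC.
have : `|x - y| < e / (2 * C + 1).
  by near: y; apply: cvgr_dist_lt; rewrite ?divr_gt0// ltr_wpDl// mulr_ge0.
rewrite ltr_pdivlMr ?ltr_wpDl ?mulr_ge0// => /le_lt_trans; apply.
by rewrite mulrA mulrC ler_wpM2l// lerDl.
Unshelve. all: by end_near. Qed.

Lemma expr_div_fact_le_expR (x : R) n : 0 <= x -> x ^+ n / n`!%:R <= expR x.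
Proof.
move=> x0; have H := is_cvg_series_exp_coeff x.
apply: (@le_trans _ _ (series (exp_coeff x) n.+1)).
  rewrite /series/= big_nat_recr//= lerDr; apply: sumr_ge0 => i _.
  exact: exp_coeff_ge0.
rewrite -[expR x]/(limn (series (exp_coeff x))); apply: nondecreasing_cvgn_le => //.
by apply: nondecreasing_series => i _ _; exact: exp_coeff_ge0.
Qed.

(** Around every point the Taylor series of the sum converges on the unit ball: the
    remainder of order [n] of a mode is at most [|om h| ^ n / n! <= exp (2 |om|) / 2 ^ n]. *)
Lemma real_analytic_mode_series (l : nat -> seq (R * R * R)) (C : R) (f : R -> R) :
  (forall m, mode_weight (fun om => expR (2 * om)) (l m) <= C / 2 ^+ m) ->
  (forall x, sums_to (fun m => mode_eval (l m) x) (f x)) ->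
  real_analytic f.
Proof.
set w := fun om : R => expR (2 * om) => wC lf x.
have wj j om : 0 <= om -> om ^+ j <= j`!%:R * w om.
  move=> om0; rewrite -ler_pdivrMl ?ltr0n ?fact_gt0// mulrC.
  apply: le_trans (expr_div_fact_le_expR j om0) _.
  by rewrite /w ler_expR; lra.
have [a aS] : {a : nat -> R | forall j,
    sums_to (fun m => mode_eval (mode_derive j (l m)) x) (a j)}.
  have H (j : nat) : {s : R | sums_to (fun m => mode_eval (mode_derive j (l m)) x) s}.
    apply: cid; apply: (@geo_sums_to _ _ (j`!%:R * C)) => m.
    rewrite -mulrA; apply: (@le_trans _ _ (j`!%:R * mode_weight w (l m))); last by rewrite ler_wpM2l.
    by apply: mode_eval_derive_le => om om0; exact: wj.
  by exists (fun j => sval (H j)) => j; exact: (svalP (H j)).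
exists (fun n => a n / n`!%:R), 1; split => // h h1.
have C0 : 0 <= C.
  have := wC 0%N; rewrite expr0 divr1; apply: le_trans.
  by apply: sumr_ge0 => t _; rewrite mulr_ge0// /w expR_ge0.
have B n : `|f (x + h) - series (fun n => a n / n`!%:R * h ^+ n) n| <= 2 * (C / 2 ^+ n).
  rewrite /series/= big_mkord.
  have S := sums_toB (lf (x + h)) (sums_to_sum (n := n) (fun i => sums_toMr (c := h ^+ i) (sums_toMr (c := i`!%:R^-1) (aS i)))).
  apply: (geo_sums_to_le _ S) => m.
  apply: (@le_trans _ _ (mode_weight w (l m) / 2 ^+ n)); last first.
    by rewrite mulrAC ler_wpM2r// invr_ge0 exprn_ge0.
  under eq_bigr => i _ do rewrite mode_eval_derive -mulrA mulr_suml.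
  rewrite exchange_big -sumrB /mode_weight mulr_suml.
  apply: le_trans (ler_norm_sum _ _ _) _; apply: ler_sum => t _ /=.
  rewrite [X in `|X|](_ : _ = t.1.1 * cos_rem n (t.1.2 * x + t.2) (t.1.2 * h)); last first.
    rewrite /cos_rem mulrBr mulrDr addrAC mulr_sumr; congr (_ - _).
    by apply: eq_bigr => i _; rewrite exprMn; ring.
  rewrite normrM -mulrA ler_wpM2l//.
  apply: le_trans (cos_rem_le _ _ _) _.
  rewrite ler_pdivlMr ?exprn_gt0// mulrAC -exprMn mulrC.
  rewrite mulrC; apply: (@le_trans _ _ (expR (`|t.1.2 * h| * 2))).
    by apply: expr_div_fact_le_expR; rewrite mulr_ge0.
  by rewrite ler_expR mulrC normrM ler_pM2l// ler_piMr// ltW.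
apply/cvgrPdist_lt => e e0.
have := @cvg_geometric R (2 * C) 2^-1; rewrite ger0_norm// => /(_ ltac:(lra)).
move=> /cvgrPdist_lt/(_ e e0); apply: filterS => n /=.
rewrite sub0r normrN => H; apply: le_lt_trans (B n) _.
apply: le_lt_trans H; rewrite exprVn mulrA; exact: ler_norm.
Qed.

End mode_series.

(** * Translations, windows and null sets of the Lebesgue measure *)

Section almost_everywhere.
Context {d} {T : measurableType d} {R : realType} (mu : {measure set T -> \bar R}).
Implicit Types P Q : set T.

Lemma ae_imp P Q : (forall x, P x -> Q x) ->
  {ae mu, forall x, P x} -> {ae mu, forall x, Q x}.
Proof. by move=> PQ; apply: negligibleS => x /= nQ /PQ. Qed.

Lemma ae_and P Q : {ae mu, forall x, P x} -> {ae mu, forall x, Q x} ->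
  {ae mu, forall x, P x /\ Q x}.
Proof.
move=> nP nQ; apply: negligibleS (negligibleU nP nQ) => x /= /not_andP[]; by [left|right].
Qed.

Lemma ae_all (P : nat -> set T) : (forall n, {ae mu, forall x, P n x}) ->
  {ae mu, forall x, forall n, P n x}.
Proof.
move=> nP; apply: negligibleS (negligible_bigcup nP) => x /= /existsNP[n nPn].
by exists n.
Qed.

End almost_everywhere.

Section lebesgue_translation.
Context {R : realType}.
Local Notation mR := (measurableTypeR R).
Local Notation lam := (@lebesgue_measure R).

Lemma measurable_addr (a : R) : measurable_fun [set: mR] (fun x : mR => (x + a : mR)).
Proof. by apply: measurable_funD. Qed.

(** The translate of Lebesgue measure agrees with it on half-open intervals. *)
Lemma lebesgue_measure_translation (a : R) (A : set mR) : measurable A ->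
  lam ((fun x => x + a) @^-1` A) = lam A.
Proof.
move=> mA.
rewrite (@lebesgue_measure_unique R (pushforward lam (fun x : mR => (x + a : mR))) _ _ mA)//.
  exact: measurable_addr.
move=> _ H [[x y] /= _ <-]; rewrite /pushforward.
rewrite (_ : _ @^-1` _ = `]x - a, y - a]%classic); last first.
  by apply/seteqP; split => z /=; rewrite !in_itv/= ltrBlDr lerBrDr.
rewrite !lebesgue_measure_itv/= !lte_fin ltrD2r.
by case: ifP => // _; rewrite -!EFinB; congr EFin; ring.
Qed.

Lemma ge0_integral_translation (a : R) (D : set mR) (f : mR -> \bar R) : measurable D ->
  measurable_fun D f -> (forall x, D x -> (0 <= f x)%E) ->
  (\int[lam]_(x in (fun x => (x + a)%R) @^-1` D) f (x + a)%R = \int[lam]_(x in D) f x)%E.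
Proof.
move=> mD mf f0.
rewrite -[LHS](@ge0_integral_pushforward _ _ mR mR R _ (measurable_addr a) lam D f)//; last first.
  by move=> x /[!inE] /f0.
apply: eq_measure_integral; first exact: measurable_addr.
by move=> ? A mA _; exact: lebesgue_measure_translation.
Qed.

Lemma negligible_translation (a : R) (N : set mR) :
  lam.-negligible N -> lam.-negligible ((fun x => x + a) @^-1` N).
Proof.
move=> [A [mA A0 NA]]; exists ((fun x => x + a) @^-1` A); split.
- by rewrite -[X in measurable X]setTI; exact: measurable_addr.
- by rewrite lebesgue_measure_translation.
- by move=> x /NA.
Qed.

Lemma ae_translation (a : R) (P : set R) :
  {ae lam, forall x, P x} -> {ae lam, forall x, P (x + a)}.
Proof. exact: negligible_translation. Qed.

End lebesgue_translation.

Section windows.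
Context {R : realType}.
Local Notation mR := (measurableTypeR R).
Local Notation lam := (@lebesgue_measure R).

Definition bounded_borel (h : R -> R) := measurable_fun [set: mR] (h : mR -> R) /\ forall x, `|h x| <= 1.

Lemma bounded_borel_integrable (h : R -> R) (D : set mR) : bounded_borel h -> measurable D ->
  (lam D < +oo)%E -> lam.-integrable D (EFin \o h).
Proof.
move=> [mh h1] mD Doo; apply: measurable_bounded_integrable => //.
  exact: measurable_funS mh.
by exists 1; split; [exact: num_real|move=> x x1 y _ /=; exact: le_trans (h1 y) (ltW x1)].
Qed.

Lemma lebesgue_itv_lty (a b : R) : (lam `[a, b[%classic < +oo)%E.
Proof. by rewrite lebesgue_measure_itv/=; case: ifP => // _; rewrite -EFinB ltry. Qed.

(** Eigenfunctions are only measurable; their integrals over windows along the flow direction are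
    Lipschitz in the position [s], and can be compared at nearby times. *)
Definition window (c : R) (h : R -> R) (s : R) : R := \int[lam]_(y in `[0, c[) h (y + s).

Lemma bounded_borel_addr h s : bounded_borel h -> bounded_borel (fun y => h (y + s)).
Proof.
move=> [mh h1]; split; last by move=> x.
exact: (measurableT_comp (mh : measurable_fun [set: mR] (h : mR -> R)) (measurable_addr s)).
Qed.

Lemma window_itv c h s : bounded_borel h -> window c h s = \int[lam]_(y in `[s, s + c[) h y.
Proof.
move=> bh; have [mh h1] := bh; rewrite /window /Rintegral; congr fine.
have E : `[0, c[%classic = (fun x : mR => x + s) @^-1` `[s, s + c[%classic.
  by apply/seteqP; split => z /=; rewrite !in_itv/= lerDr [s + c]addrC ltrD2r.
rewrite E -(@integral_pushforward _ _ mR mR R _ (measurable_addr s) lam `[s, s + c[%classic (EFin \o h))//.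
- apply: eq_measure_integral; first exact: measurable_addr.
  by move=> ? A mA _; exact: lebesgue_measure_translation.
- exact/measurable_EFinP.
- rewrite -E; apply: (@bounded_borel_integrable (fun y => h (y + s))) => //.
    exact: bounded_borel_addr.
  exact: lebesgue_itv_lty.
Qed.

Lemma Rintegral_itv_1 (a b : R) : a <= b -> \int[lam]_(y in `[a, b[) (1 : R) = b - a.
Proof.
move=> ab; rewrite Rintegral_cst//= mul1r.
have := lebesgue_measure_itv `[a, b[; rewrite /= lte_fin => ->.
by case: ltP => //= ba; apply/esym/eqP; rewrite subr_eq0 eq_le ba ab.
Qed.

Lemma Rintegral_itv_cat (h : R -> R) (a b d : R) : bounded_borel h -> a <= b -> b <= d ->
  \int[lam]_(y in `[a, d[) h y = \int[lam]_(y in `[a, b[) h y + \int[lam]_(y in `[b, d[) h y.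
Proof.
move=> bh ab bd.
have E : `[a, d[%classic = `[a, b[%classic `|` `[b, d[%classic :> set mR.
  by rewrite -itv_bndbnd_setU// bnd_simp.
rewrite E Rintegral_setU//; first by rewrite -E; apply: bounded_borel_integrable => //; exact: lebesgue_itv_lty.
apply/disj_setPS => z /= []; rewrite !in_itv/= => /andP[_ zb] /andP[bz _].
by move: (lt_le_trans zb bz); rewrite ltxx.
Qed.

Lemma norm_Rintegral_itv_le (h : R -> R) (a b : R) : bounded_borel h -> a <= b ->
  `|\int[lam]_(y in `[a, b[) h y| <= b - a.
Proof.
move=> bh ab; have fin := lebesgue_itv_lty a b.
have I : lam.-integrable `[a, b[ (EFin \o h) by exact: bounded_borel_integrable.
apply: le_trans (le_normr_Rintegral _ I) _ => //.
apply: (@le_trans _ _ (\int[lam]_(y in `[a, b[) (1 : R))); last by rewrite Rintegral_itv_1.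
apply: le_Rintegral => //.
- exact: integrable_norm.
- apply: (@bounded_borel_integrable (fun=> 1)) => //.
  by split => [|x]; [exact: measurable_cst|rewrite normr1].
- by move=> x _; exact: bh.2.
Qed.

Lemma window_lip c h s t : 0 <= c -> bounded_borel h -> `|window c h s - window c h t| <= 2 * `|s - t|.
Proof.
move=> c0 bh.
wlog st : s t / s <= t.
  move=> H; have [|/ltW] := leP s t; first exact: H.
  by move=> ts; rewrite distrC [`|s - t|]distrC; exact: H.
rewrite !window_itv//.
have key (A B C D E d : R) : E = A + B -> E = C + D -> `|A| <= d -> `|D| <= d -> `|C - B| <= 2 * d.
  by rewrite !ler_norml; lra.
have -> : `|s - t| = t - s by rewrite ler0_norm ?opprB// subr_le0.
have E1 := Rintegral_itv_cat bh st (ltac:(lra) : t <= t + c).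
have E2 := Rintegral_itv_cat bh (ltac:(lra) : s <= s + c) (ltac:(lra) : s + c <= t + c).
apply: (key _ _ _ _ _ _ E1 E2 (norm_Rintegral_itv_le bh st)).
rewrite (_ : t - s = t + c - (s + c)); last by ring.
by apply: norm_Rintegral_itv_le => //; lra.
Qed.

Lemma window_lip_width c d h : 0 <= c -> c <= d -> bounded_borel h ->
  `|window d h 0 - window c h 0| <= d - c.
Proof.
move=> c0 cd bh; rewrite !window_itv// !add0r (Rintegral_itv_cat bh c0 cd) addrC addKr.
exact: norm_Rintegral_itv_le.
Qed.

Lemma window_le1 c h s : 0 <= c <= 1 -> bounded_borel h -> `|window c h s| <= 1.
Proof.
move=> /andP[c0 c1] bh; rewrite window_itv//.
apply: le_trans (norm_Rintegral_itv_le bh _) _; first by rewrite lerDl.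
by rewrite addrC addKr.
Qed.

End windows.

Section continuity_in_mean.
Context {R : realType}.
Local Notation mR := (measurableTypeR R).
Local Notation lam := (@lebesgue_measure R).

(** Heine's theorem in the form that also compares points of [a, b] with points just outside. *)
Lemma continuous_unif_itv (g : R -> R) (a b e : R) : continuous g -> 0 < e ->
  exists2 d : R, 0 < d & forall x h : R, a <= x <= b -> `|h| < d -> `|g (x + h) - g x| < e.
Proof.
move=> cg e0.
have /compact_near_coveringP H := @segment_compact R a b.
have : \forall h \near (0 : R), `[a, b] `<=` (fun x => `|g (x + h) - g x| < e).
  apply: (H R (nbhs (0 : R)) (fun h x => `|g (x + h) - g x| < e)) => x _.
  have cf : continuous (fun p : R * R => g (p.1 + p.2) - g p.1).
    move=> p; apply: continuousB.
      apply: continuous_comp; last exact: cg.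
      by apply: continuousD; [exact: cvg_fst|exact: cvg_snd].
    by apply: continuous_comp; [exact: cvg_fst|exact: cg].
  have := cf (x, 0); rewrite /continuous_at/= addr0 subrr => /cvgr0Pnorm_lt/(_ e e0).
  exact.
move=> /nbhs_ballP[d /= d0 dH]; exists d => // x h xab hd.
by apply: (dH h) => //=; rewrite /ball/= sub0r normrN.
Qed.

(** Approximation in mean by a continuous function, which is uniformly continuous on a compact
    interval. *)
Lemma continuity_in_mean (u : R -> R) (e : R) : bounded_borel u -> 0 < e ->
  exists2 d : R, 0 < d & forall h : R, `|h| < d ->
    (\int[lam]_(x in `[0%R, 1%R]) `|u (x + h) - u x|%:E <= e%:E)%E.
Proof.
move=> bu e0; have [mu u1] := bu.
have fin (a b : R) : (lam `[a, b]%classic < +oo)%E.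
  by rewrite lebesgue_measure_itv/=; case: ifP => // _; rewrite -EFinB ltry.
have iu : lam.-integrable `[(-1 : R), 2] (EFin \o u).
  by apply: bounded_borel_integrable.
have [g_ [cg ig cv]] := approximation_continuous_integrable (measurable_itv _) (fin _ _) iu.
have [n Hn] : exists n, (\int[lam]_(z in `[(-1)%R, 2%R]) `|(u z - g_ n z)%:E| <= (e / 4)%:E)%E.
  have e4 : (0 < (e / 4)%:E)%E by rewrite lte_fin divr_gt0.
  suff : \forall n \near \oo, (\int[lam]_(z in `[(-1)%R, 2%R]) `|(u z - g_ n z)%:E| < (e / 4)%:E)%E.
    by move=> [n _ /(_ n (leqnn n))/= /ltW ?]; exists n.
  have /fine_cvgP[fn fv] := cv.
  near=> n.
  have fnn : (\int[lam]_(z in `[(-1)%R, 2%R]) `|(u z - g_ n z)%:E|)%E \is a fin_num by near: n.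
  rewrite -(fineK fnn) lte_fin; near: n.
  by apply: (cvgr_lt _ fv); rewrite divr_gt0.
move: (g_ n) Hn (cg n) => g {cg ig cv g_ n} Hg cg.
have mg : measurable_fun [set: mR] (g : mR -> R) by exact: continuous_measurable_fun.
have e4p : 0 < e / 4 by rewrite divr_gt0.
have [d d0 Hd] := continuous_unif_itv 0 1 cg e4p.
exists (Num.min d 1); first by rewrite lt_min d0/=.
move=> h; rewrite lt_min => /andP[hd h1].
pose D := `[(0 : R), 1]%classic.
have mD : measurable (D : set mR) by exact: measurable_itv.
have m1 : measurable_fun [set: mR] (fun x : mR => `|u x - g x|%:E).
  by apply/measurable_EFinP; apply: measurableT_comp => //; exact: measurable_funB.
have mh (v : R -> R) : measurable_fun [set: mR] (v : mR -> R) -> measurable_fun [set: mR] (fun x : mR => v (x + h)).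
  by move=> mv; exact: (measurableT_comp mv (measurable_addr h)).
have m2 := mh _ mg.
apply: (@le_trans _ _ (\int[lam]_(x in D) (`|u (x + h) - g (x + h)|%:E + ((e / 4)%:E + `|u x - g x|%:E)))%E).
  apply: ge0_le_integral => //.
  - apply: (measurable_funS measurableT) => //; apply/measurable_EFinP.
    by apply: measurableT_comp => //; apply: measurable_funB => //; exact: mh.
  - apply: (measurable_funS measurableT) => //; apply/measurable_EFinP.
    apply: measurable_funD; first by apply: measurableT_comp => //; apply: measurable_funB => //; exact: mh.
    by apply: measurable_funD => //; exact/measurable_EFinP.
  - move=> x; rewrite /D/= in_itv/= => x01; rewrite -!EFinD lee_fin.
    have := Hd x h x01 hd => /ltW H.
    have -> : u (x + h) - u x = (u (x + h) - g (x + h)) + ((g (x + h) - g x) - (u x - g x)) by ring.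
    apply: le_trans (ler_normD _ _) _; rewrite lerD2l.
    by apply: le_trans (ler_normB _ _) _; rewrite lerD2r.
have i1 : (\int[lam]_(x in D) `|u x - g x|%:E <= (e / 4)%:E)%E.
  apply: le_trans Hg; apply: ge0_subset_integral => //.
  - exact: (measurable_funS measurableT).
  - by move=> x; rewrite /D/= !in_itv/=; lra.
have i2 : (\int[lam]_(x in D) `|u (x + h) - g (x + h)|%:E <= (e / 4)%:E)%E.
  pose E := (fun x => x + (- h)) @^-1` D.
  have mE : measurable (E : set mR) by rewrite -[X in measurable X]setTI; exact: measurable_addr.
  have -> : D = (fun x => x + h) @^-1` E :> set R.
    by apply/funext => x; rewrite /E /preimage/= addrK.
  have -> : (\int[lam]_(x in (fun x => (x + h)%R) @^-1` E) `|u (x + h) - g (x + h)|%:E)%E = (\int[lam]_(x in E) `|u x - g x|%:E)%E.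
    apply: (@ge0_integral_translation _ h E (fun x => `|u x - g x|%:E)) => //.
    exact: (measurable_funS measurableT).
  apply: le_trans Hg; apply: ge0_subset_integral => //.
  - exact: (measurable_funS measurableT).
  - move=> x; rewrite /E /D /preimage/= !in_itv/=; move: h1; rewrite ltr_norml.
    by lra.
have e4 : 0 <= e / 4 by rewrite divr_ge0// ltW.
have m3 : measurable_fun D (fun x : mR => `|u (x + h) - g (x + h)|%:E).
  by apply: (measurable_funS measurableT) => //; apply/measurable_EFinP; apply: measurableT_comp => //; apply: measurable_funB => //; exact: mh.
have m4 : measurable_fun D (fun x : mR => (e / 4)%:E + `|u x - g x|%:E)%E.
  apply: (measurable_funS measurableT) => //; apply/measurable_EFinP.
  by apply: measurable_funD => //; exact/measurable_EFinP.
have n4 (x : R) : D x -> (0 <= (e / 4)%:E + `|u x - g x|%:E)%E by move=> _; rewrite adde_ge0// lee_fin.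
rewrite ge0_integralD//.
rewrite ge0_integralD//; last exact: (measurable_funS measurableT _ m1).
have i3 : (\int[lam]_(_ in D) (e / 4)%:E = (e / 4)%:E)%E.
  rewrite integral_cst//=; have := lebesgue_measure_itv `[(0 : R), 1].
  by rewrite /= lte_fin ltr01 -EFinB subr0 => ->; rewrite mule1.
apply: (@le_trans _ _ ((e / 4)%:E + ((e / 4)%:E + (e / 4)%:E))%E).
  by apply: leeD => //; apply: leeD => //; rewrite i3.
by rewrite -!EFinD lee_fin; lra.
Unshelve. all: by end_near. Qed.

End continuity_in_mean.

Section product_lebesgue.
Context {R : realType}.
Local Notation mR := (measurableTypeR R).
Local Notation lam := (@lebesgue_measure R).
Local Notation lam2 := (lam \x lam)%E.

(** Tonelli's theorem for null sets; [ae_xsection_eq0] is the converse. *)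
Lemma ae_xsection (N : set (mR * mR)) : measurable N -> lam2 N = 0%E ->
  {ae lam, forall x : R, {ae lam, forall y : R, ~ N (x, y)}}.
Proof.
move=> mN N0.
have mf : measurable_fun [set: mR] (lam \o xsection N) by exact: measurable_fun_xsection.
have /(ae_eq_integral_abs lam measurableT mf) : (\int[lam]_x `|(lam \o xsection N) x| = 0)%E.
  rewrite -N0; apply: eq_integral => x _.
  by rewrite gee0_abs// measure_ge0.
apply: ae_imp => x /(_ I)/= Nx.
exists (xsection N x); split => //; first exact: measurable_xsection.
by move=> y /= /contrapT Nxy; rewrite /xsection/= inE.
Qed.

Lemma ae_xsection_eq0 (N : set (mR * mR)) : measurable N ->
  {ae lam, forall x : R, {ae lam, forall y : R, ~ N (x, y)}} -> lam2 N = 0%E.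
Proof.
move=> mN H.
have mf : measurable_fun [set: mR] (lam \o xsection N) by exact: measurable_fun_xsection.
transitivity (\int[lam]_x `|(lam \o xsection N) x|)%E.
  by apply: eq_integral => x _; rewrite gee0_abs// measure_ge0.
apply/(ae_eq_integral_abs lam measurableT mf).
apply: ae_imp H => x Nx _ /=.
apply: (@measure_negligible _ _ _ lam) => /=; first exact: measurable_xsection.
apply: negligibleS Nx => y; rewrite /xsection/= inE => Nxy /=.
by move/(_ Nxy).
Qed.

(** Tonelli's theorem, applied to the nonnegative function [P + 1]. *)
Lemma measurable_window (P : R * R -> R) (c : R) :
  measurable_fun [set: mR * mR] (P : mR * mR -> R) -> (forall p, `|P p| <= 1) ->
  measurable_fun [set: mR] ((fun x => window c (fun y => P (x, y)) 0) : mR -> R).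
Proof.
move=> mP P1.
pose Q (p : mR * mR) : \bar R := ((P p + 1) * \1_`[0, c[%classic p.2)%:E.
have mQ : measurable_fun [set: mR * mR] Q.
  apply/measurable_EFinP; apply: measurable_funM; first exact: measurable_funD.
  by apply: (measurableT_comp (f := \1_`[0, c[%classic : mR -> R)) => //; exact: measurable_snd.
have Q0 p : (0 <= Q p)%E.
  rewrite lee_fin mulr_ge0 ?indic_ge0// -lerBlDr sub0r.
  by have := P1 p; rewrite ler_norml => /andP[].
have := measurable_fun_fubini_tonelli_F (m2 := lam) Q mQ Q0.
rewrite /fubini_F => mF.
have bb x : bounded_borel (fun y => P (x, y)).
  by split => [|y]; [exact: (measurableT_comp mP (measurable_pair1 x))|exact: P1].
have fin := @lebesgue_itv_lty R 0 c.
have E x : window c (fun y => P (x, y)) 0 = fine (\int[lam]_y Q (x, y))%E - fine (lam `[0, c[%classic).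
  have -> : (\int[lam]_y Q (x, y) = \int[lam]_(y in `[0%R, c[) (P (x, y) + 1)%:E)%E.
    rewrite [RHS]integral_mkcond; apply: eq_integral => y _.
    by rewrite /Q patchE indicE/=; case: ifP => _; rewrite ?mulr1 ?mulr0.
  rewrite -[X in _ = X - _]/(\int[lam]_(y in `[0, c[) (P (x, y) + 1)) RintegralD//.
  - rewrite Rintegral_cst// mul1r /window addrK; apply: eq_Rintegral => y _; by rewrite addr0.
  - exact: bounded_borel_integrable.
  - apply: (@bounded_borel_integrable _ (fun=> 1)) => //.
    by split => [|y]; [exact: measurable_cst|rewrite normr1].
rewrite (_ : (fun x => _) = (fun x : mR => fine (\int[lam]_y Q (x, y))%E - fine (lam `[0, c[%classic))); last first.
  by apply/funext => x; exact: E.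
apply: measurable_funB => //.
exact: (measurableT_comp (f := fine) _ mF).
Qed.

(** By Lebesgue's differentiation theorem, a function all of whose windows starting at
    [0] vanish is the derivative of the zero function. *)
Lemma ae_eq0_of_window (h : R -> R) (b : R) : bounded_borel h ->
  (forall c, 0 <= c <= b -> window c h 0 = 0) ->
  {ae lam, forall y : R, 0 < y < b -> h y = 0}.
Proof.
move=> bh h0.
have [b0|b0] := leP b 0.
  by apply: aeW => y /= /andP[y0 yb]; move: (lt_le_trans yb b0); rewrite ltNge (ltW y0).
have fin := @lebesgue_itv_lty R.
have I0 : lam.-integrable `[0, b[ (EFin \o h) by exact: bounded_borel_integrable.
have lf := integrable_locally (measurable_itv `[0, b[) I0.
set f := h \_ _ in lf.
have bf : bounded_borel f.
  split; first by apply/(measurable_restrictT _ _).1 => //; exact: measurable_funS bh.1.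
  by move=> x; rewrite /f patchE; case: ifP => _; rewrite ?normr0 ?ler01//; exact: bh.2.
have If (y : R) : lam.-integrable `[(0 : R), y] (EFin \o f).
  apply: bounded_borel_integrable => //.
  by rewrite lebesgue_measure_itv/=; case: ifP => // _; rewrite -EFinB ltry.
have := FTC1 (a := BLeft 0) If lf; apply: ae_imp => y H /andP[y0 yb].
have [|_ Fy] := H; first by rewrite /= lte_fin.
have fE : f y = h y by rewrite /f patchE mem_set//= in_itv/= ltW.
rewrite -fE -Fy derive1E (@near_eq_derive _ R^o R^o _ (cst 0)) ?derive_cst//.
near=> x.
have x0 : 0 < x by near: x; exact: lt_nbhsr.
have xb : x < b by near: x; exact: lt_nbhsl.
have x0b : 0 <= x <= b by rewrite !ltW.
rewrite [RHS]/=; apply: etrans (h0 x x0b); rewrite /window.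
have If' : lam.-integrable `[(0 : R), x[ (EFin \o f) by exact: bounded_borel_integrable.
rewrite -(@Rintegral_itv_bndo_bndc _ (BLeft 0) x f If').
apply: eq_Rintegral => z; rewrite inE/= in_itv/= => /andP[z0 zx].
by rewrite addr0 /f patchE mem_set//= in_itv/= z0 (lt_trans zx).
Unshelve. all: by end_near. Qed.

End product_lebesgue.

(** * Functions on the special space *)

Section special_quotient.
Context {R : realType}.
Local Notation mR := (measurableTypeR R).
Local Notation lam := (@lebesgue_measure R).
Local Notation lam2 := (lam \x lam)%E.
Variables (alpha : R) (phi : ceiling R).
Local Notation X := (special_space alpha phi).
Local Notation mu := (special_measure alpha phi).
Local Notation pr x y := (special_pi alpha phi (x, y)).

Lemma special_pi_eq (p q : R * R) : special_rel alpha phi p q ->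
  special_pi alpha phi p = special_pi alpha phi q.
Proof. by move=> pq; apply/eqP; rewrite /special_pi eqmodE. Qed.

Lemma special_pi_inj (p q : R * R) : special_pi alpha phi p = special_pi alpha phi q ->
  special_rel alpha phi p q.
Proof. by move/eqP; rewrite /special_pi eqmodE. Qed.

Lemma special_pi_repr (u : X) : exists p, u = special_pi alpha phi p.
Proof. by exists (repr (u : {eq_quot special_rel alpha phi}%qT)); rewrite /special_pi reprK. Qed.

Lemma special_pi1 x y : pr (x + 1) y = pr x y.
Proof. by apply: special_pi_eq; apply/asboolP/Relation_Operators.rst_step/special_step_period. Qed.

Lemma special_pi_roof x y : pr (x + alpha) y = pr x (y + phi x).
Proof. by apply/esym/special_pi_eq; apply/asboolP/Relation_Operators.rst_step/special_step_roof. Qed.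

(** A function on the plane that is invariant under both generating moves descends to the
    quotient. *)
Definition special_lift (T : Type) (F : R * R -> T) (u : X) : T :=
  F (repr (u : {eq_quot special_rel alpha phi}%qT)).

Lemma special_liftE (T : Type) (F : R * R -> T) :
  (forall x y, F (x + 1, y) = F (x, y)) ->
  (forall x y, F (x + alpha, y) = F (x, y + phi x)) ->
  forall p, special_lift F (special_pi alpha phi p) = F p.
Proof.
move=> F1 Fa p; rewrite /special_lift.
have : special_rel alpha phi (repr (special_pi alpha phi p : {eq_quot special_rel alpha phi}%qT)) p.
  by apply: special_pi_inj; rewrite /special_pi reprK.
move: (repr _) => p' /asboolP; elim => {p p'} [p q []|p|p q _|p q r _ + _] //.
by move=> -> ->.
Qed.

Lemma special_measureE (N : set X) :
  mu N = lam2 (special_pi alpha phi @^-1` N `&` special_domain phi).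
Proof. by []. Qed.

Lemma ae_special_domain (P : set X) : {ae mu, forall u, P u} ->
  {ae lam, forall x : R, {ae lam, forall y : R, 0 <= x < 1 -> 0 <= y < phi x -> P (pr x y)}}.
Proof.
move=> [N [mN N0 PN]].
have mN' : measurable (special_pi alpha phi @^-1` N : set (mR * mR)) by exact: mN.
have := ae_xsection (measurableI _ _ mN' (measurable_special_domain phi)) N0.
apply: ae_imp => x; apply: ae_imp => y H x01 y0.
by apply: contrapT => nP; apply: H; split; [exact: PN|].
Qed.

Lemma ae_of_special_domain (P : set X) : measurable (~` P) ->
  {ae lam, forall x : R, {ae lam, forall y : R, 0 <= x < 1 -> 0 <= y < phi x -> P (pr x y)}} ->
  {ae mu, forall u, P u}.
Proof.
move=> mP H; exists (~` P); split => //.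
rewrite special_measureE; apply: ae_xsection_eq0.
  have mP' : measurable (special_pi alpha phi @^-1` (~` P) : set (mR * mR)) by exact: mP.
  exact: (measurableI _ _ mP' (measurable_special_domain phi)).
apply: ae_imp H => x; apply: ae_imp => y H [nP [x01 y0]].
exact: nP (H x01 y0).
Qed.

Lemma measurable_special_lift (F : R * R -> R) :
  (forall x y, F (x + 1, y) = F (x, y)) ->
  (forall x y, F (x + alpha, y) = F (x, y + phi x)) ->
  measurable_fun [set: mR * mR] (F : mR * mR -> mR) ->
  measurable_fun [set: X] (special_lift F : X -> mR).
Proof.
move=> F1 Fa mF _ B mB; rewrite setTI.
have := mF measurableT B mB; rewrite setTI => H.
rewrite /measurable/= /special_measurable/=.
rewrite (_ : special_pi alpha phi @^-1` _ = F @^-1` B)//.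
by apply/seteqP; split => p; rewrite /preimage/= special_liftE.
Qed.

(** The real line is a countable union of translates of [0, 1[. *)
Lemma ae_periodic (B : set R) : (forall x, B (x + 1) <-> B x) ->
  {ae lam, forall x : R, 0 <= x < 1 -> B x} -> {ae lam, forall x : R, B x}.
Proof.
move=> B1 H.
have Bn n x : B (x + n%:R) <-> B x.
  elim: n => [|n IH]; first by rewrite addr0.
  by rewrite -natr1 addrA; apply: iff_trans (B1 _) IH.
have Hp := ae_all (fun n => ae_translation (n%:R) H).
have Hm := ae_all (fun n => ae_translation (- n%:R) H).
apply: ae_imp (ae_and Hp Hm) => x [xp xm].
have f1 := floor_le x; have := floorD1_gt x; rewrite intrD => f2.
case: (Num.floor x) f1 f2 => [n|n] f1 f2.
  have := xm n; rewrite -(Bn n (x - n%:R)) subrK; apply.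
  by rewrite subr_ge0 f1/= ltrBlDl.
have := xp n.+1; rewrite Bn; apply.
by move: f1 f2; rewrite NegzE mulrNz -pmulrn; lra.
Qed.

End special_quotient.

Section real_eigenfunctions.
Context {R : realType}.
Local Notation mR := (measurableTypeR R).
Local Notation lam := (@lebesgue_measure R).
Variables (alpha : R) (phi : ceiling R).
Local Notation X := (special_space alpha phi).
Local Notation pr x y := (special_pi alpha phi (x, y)).

(** The real and imaginary parts [P] and [Q] of the lift to the plane of a bounded
    eigenfunction of eigenvalue [t]. *)
Record plane_eigenfunction (t : R) (P Q : R * R -> R) : Prop := PlaneEigenfunction {
  plane_measurable1 : measurable_fun [set: mR * mR] (P : mR * mR -> R) ;
  plane_measurable2 : measurable_fun [set: mR * mR] (Q : mR * mR -> R) ;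
  plane_bounded1 : forall p, `|P p| <= 1 ;
  plane_bounded2 : forall p, `|Q p| <= 1 ;
  plane_period1 : forall x y, P (x + 1, y) = P (x, y) ;
  plane_period2 : forall x y, Q (x + 1, y) = Q (x, y) ;
  plane_roof1 : forall x y, P (x + alpha, y) = P (x, y + phi x) ;
  plane_roof2 : forall x y, Q (x + alpha, y) = Q (x, y + phi x) ;
  plane_flow : forall s : R, {ae lam, forall x : R, {ae lam, forall y : R, 0 <= y < phi x ->
    P (x, y + s) = cos (2 * pi * t * s) * P (x, y) - sin (2 * pi * t * s) * Q (x, y) /\
    Q (x, y + s) = sin (2 * pi * t * s) * P (x, y) + cos (2 * pi * t * s) * Q (x, y)}} ;
  plane_nonzero : ~ {ae lam, forall x : R, {ae lam, forall y : R, 0 <= y < phi x ->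
    P (x, y) = 0 /\ Q (x, y) = 0}} }.

Lemma plane_eigenfunction_rot t P Q : plane_eigenfunction t P Q ->
  plane_eigenfunction t Q (fun p => - P p).
Proof.
move=> [mP mQ P1 Q1 Pp Qp Pr Qr fl nz]; split => //.
- exact: measurableT_comp.
- by move=> p; rewrite normrN.
- by move=> x y; rewrite Pp.
- by move=> x y; rewrite Pr.
- move=> s; apply: ae_imp (fl s) => x; apply: ae_imp => y H /H[-> ->].
  by split; ring.
- apply: contra_not nz; apply: ae_imp => x; apply: ae_imp => y H /H[-> /eqP].
  by rewrite oppr_eq0 => /eqP.
Qed.

(** Dividing an eigenfunction by one plus its modulus, which the flow preserves, makes it
    bounded. *)
Lemma eigenvalue_plane t : Defs.eigenvalue alpha phi t -> exists P Q, plane_eigenfunction t P Q.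
Proof.
move=> [F [[mRe mIm] nz fl]].
pose re u := complex.Re (F u); pose im u := complex.Im (F u).
pose m u := 1 + Num.sqrt (re u ^+ 2 + im u ^+ 2).
have m0 u : 0 < m u by rewrite ltr_wpDr// sqrtr_ge0.
have mRe' : measurable_fun [set: X] (re : X -> R) := mRe.
have mIm' : measurable_fun [set: X] (im : X -> R) := mIm.
have mm : measurable_fun [set: X] (m : X -> R).
  apply: measurable_funD => //; apply: measurableT_comp; first by apply: continuous_measurable_fun; exact: sqrt_continuous.
  by apply: measurable_funD; exact: measurable_funX.
have mi : measurable_fun [set: X] ((fun u => (m u)^-1) : X -> R).
  rewrite (_ : (fun u => _) = (fun u : X => m u `^ (-1))); last first.
    by apply/funext => u; rewrite powR_inv1// ltW.
  exact: (measurableT_comp (@measurable_powR R (-1)) mm).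
have mpi (f : X -> R) : measurable_fun [set: X] f -> measurable_fun [set: mR * mR] (f \o special_pi alpha phi : mR * mR -> R).
  by move=> mf; apply: (measurableT_comp mf); exact: measurable_special_pi.
have bd (a b : R) : `|a / (1 + Num.sqrt (a ^+ 2 + b ^+ 2))| <= 1.
  have s0 : 0 < 1 + Num.sqrt (a ^+ 2 + b ^+ 2) by rewrite ltr_wpDr// sqrtr_ge0.
  rewrite normrM normfV (gtr0_norm s0) ler_pdivrMr// mul1r.
  apply: (@le_trans _ _ (Num.sqrt (a ^+ 2 + b ^+ 2))); last by rewrite lerDr.
  by rewrite -sqrtr_sqr ler_wsqrtr// lerDl sqr_ge0.
exists ((fun u => re u / m u) \o special_pi alpha phi), ((fun u => im u / m u) \o special_pi alpha phi).
split.
- by apply: mpi; exact: measurable_funM.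
- by apply: mpi; exact: measurable_funM.
- by move=> p; exact: bd.
- by move=> p; rewrite /= /m addrC [re _ ^+ 2 + _]addrC [_ + 1]addrC; exact: bd.
- by move=> x y /=; rewrite special_pi1.
- by move=> x y /=; rewrite special_pi1.
- by move=> x y /=; rewrite special_pi_roof.
- by move=> x y /=; rewrite special_pi_roof.
- move=> s.
  apply: (ae_periodic (B := fun x => {ae lam, forall y : R, 0 <= y < phi x -> _})).
    by move=> x; rewrite ceiling_periodic; split; apply: ae_imp => y /=; rewrite !special_pi1.
  have := ae_special_domain (fl s); apply: ae_imp => x H x01; apply: ae_imp H => y H y0.
  have := H x01 y0; rewrite special_flowE /= => E.
  set u := pr x (y + s) in E *; set v := pr x y in E *.
  have reE : re u = cos (2 * pi * t * s) * re v - sin (2 * pi * t * s) * im v.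
    by rewrite /re E /im; case: (F v).
  have imE : im u = sin (2 * pi * t * s) * re v + cos (2 * pi * t * s) * im v.
    by rewrite /im E /re; case: (F v) => a b /=; ring.
  have mE : m u = m v.
    rewrite /m; congr (1 + Num.sqrt _); rewrite reE imE.
    have := cos2Dsin2 (2 * pi * t * s); set C := cos _; set S := sin _ => CS.
    by rewrite -[RHS]mul1r -CS; ring.
  by rewrite mE reE imE; split; ring.
- apply: contra_not nz => H; apply: (ae_of_special_domain (P := fun u => F u = 0)).
    have -> : ~` [set u | F u = 0] = ~` (re @^-1` [set 0] `&` im @^-1` [set 0]).
      congr (~` _); apply/seteqP; split => u /=; first by rewrite /re /im => ->.
      by rewrite /re /im; case: (F u) => a b /= [-> ->].
    apply: measurableC; apply: measurableI.
      by rewrite -[X in measurable X]setTI; exact: mRe'.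
    by rewrite -[X in measurable X]setTI; exact: mIm'.
  apply: ae_imp H => x; apply: ae_imp => y H _ y0; have /= := H y0.
  have mn : m (pr x y) != 0 by rewrite gt_eqF.
  move=> [/eqP + /eqP]; rewrite !mulf_eq0 !invr_eq0 (negbTE mn) !orbF /re /im.
  by case: (F _) => a b /= /eqP-> /eqP->.
Qed.

End real_eigenfunctions.

(** * Eigenvalues are integers when the returns split *)

Section mean_estimate.
Context {R : realType}.
Local Notation mR := (measurableTypeR R).
Local Notation lam := (@lebesgue_measure R).

(** Here [(u, v)] is a vector, [(u1, v1)] and [(u2, v2)] are perturbations of it, and the
    rotation of angle [w] takes the first perturbation near the second.  If [A] is
    the matrix of the rotation minus the identity, the product of the transpose of [A] by [A] is
    [2 - 2 cos w] times the identity, hence the factor on the left. *)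
Lemma rotation_pointwise (w u v u1 v1 u2 v2 e : R) :
  `|u2 - (cos w * u1 - sin w * v1)| <= 2 * e -> `|v2 - (sin w * u1 + cos w * v1)| <= 2 * e ->
  (2 - 2 * cos w) * `|u| <= 8 * (`|u1 - u| + `|u2 - u| + `|v1 - v| + `|v2 - v|) + 6 * e.
Proof.
set C := cos w; set S := sin w => H1 H2.
have C1 : -1 <= C <= 1 by rewrite cos_geN1 cos_le1.
have S1 : `|S| <= 1 by exact: sin_max.
have CS : C ^+ 2 + S ^+ 2 = 1 by exact: cos2Dsin2.
have E : (2 - 2 * C) * u = (C - 1) * (u2 - u - (u1 - u) - (u2 - (C * u1 - S * v1)))
  + S * (v2 - v - (v1 - v) - (v2 - (S * u1 + C * v1))) - (2 - 2 * C) * (u1 - u).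
  have -> : 2 - 2 * C = (C - 1) ^+ 2 + S ^+ 2 by rewrite -[X in X - _](_ : 1 + (C ^+ 2 + S ^+ 2) = _); [ring|rewrite CS; ring].
  by ring.
have C2 : 0 <= 2 - 2 * C <= 4 by lra.
have -> : (2 - 2 * C) * `|u| = `|(2 - 2 * C) * u|.
  by rewrite normrM [`|2 - 2 * C|]ger0_norm//; case/andP: C2.
rewrite E; apply: le_trans (ler_normB _ _) _; rewrite [X in _ + X <= _]normrM [`|2 - 2 * C|]ger0_norm; last by case/andP: C2.
have Cn : `|C - 1| <= 2 by rewrite ler_norml; lra.
have B1 : `|u2 - u - (u1 - u) - (u2 - (C * u1 - S * v1))| <= `|u2 - u| + `|u1 - u| + 2 * e.
  by apply: le_trans (ler_normB _ _) _; apply: lerD => //; exact: ler_normB.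
have B2 : `|v2 - v - (v1 - v) - (v2 - (S * u1 + C * v1))| <= `|v2 - v| + `|v1 - v| + 2 * e.
  by apply: le_trans (ler_normB _ _) _; apply: lerD => //; exact: ler_normB.
have T1 := ler_pM (normr_ge0 _) (normr_ge0 _) Cn B1.
have T2 := ler_pM (normr_ge0 _) (normr_ge0 _) S1 B2.
have T3 : (2 - 2 * C) * `|u1 - u| <= 4 * `|u1 - u| by rewrite ler_wpM2r//; case/andP: C2.
have T4 := ler_normD ((C - 1) * (u2 - u - (u1 - u) - (u2 - (C * u1 - S * v1)))) (S * (v2 - v - (v1 - v) - (v2 - (S * u1 + C * v1)))).
rewrite !normrM in T4.
move: T1 T2 T3 T4; have := normr_ge0 (u1 - u); have := normr_ge0 (u2 - u); have := normr_ge0 (v1 - v); have := normr_ge0 (v2 - v).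
rewrite -!normrM.
by lra.
Qed.

(** Integration of [rotation_pointwise] over [x].  The index [j] depends on [x] in an unknown way;
    the sum of the errors over all eight shifts bounds the error at [j]. *)
Lemma rotation_mean_estimate (U V : R -> R) (w h e : R) (s : nat -> R) :
  bounded_borel U -> bounded_borel V -> 0 < e ->
  (forall j d, (j < 8)%N -> d = s j \/ d = s j + h ->
    (\int[lam]_(x in `[0%R, 1%R]) `|U (x + d)%R - U x|%:E <= e%:E)%E /\
    (\int[lam]_(x in `[0%R, 1%R]) `|V (x + d)%R - V x|%:E <= e%:E)%E) ->
  {ae lam, forall x : R, exists2 j, (j < 8)%N &
    `|U (x + s j + h) - (cos w * U (x + s j) - sin w * V (x + s j))| <= 2 * e /\
    `|V (x + s j + h) - (sin w * U (x + s j) + cos w * V (x + s j))| <= 2 * e} ->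
  ((2 - 2 * cos w)%:E * \int[lam]_(x in `[0%R, 1%R]) `|U x|%:E <= (262 * e)%:E)%E.
Proof.
move=> bU bV e0 He Hx.
pose D := `[(0 : R), 1]%classic.
have mD : measurable (D : set mR) by exact: measurable_itv.
have C2 : 0 <= 2 - 2 * cos w by have := cos_le1 w; lra.
pose W (F : R -> R) (d x : R) : R := `|F (x + d) - F x|.
have mW' F d : bounded_borel F -> measurable_fun D (W F d : mR -> R).
  move=> bF; apply: (measurable_funS measurableT) => //.
  apply: measurableT_comp => //; apply: measurable_funB; last exact: bF.1.
  exact: (bounded_borel_addr d bF).1.
have mW F d : bounded_borel F -> measurable_fun D (fun x : mR => (W F d x)%:E).
  by move=> bF; apply/measurable_EFinP; exact: mW'.
pose G (j : nat) (x : R) : R := W U (s j) x + W U (s j + h) x + W V (s j) x + W V (s j + h) x.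
have G0 j x : (0 <= (G j x)%:E)%E by rewrite lee_fin /G /W !addr_ge0.
have mG j : measurable_fun D (fun x : mR => (G j x)%:E).
  by apply/measurable_EFinP; do 3 (apply: measurable_funD; last exact: mW'); exact: mW'.
have addI (F1 F2 : R -> R) (a b : R) : measurable_fun D (F1 : mR -> R) -> measurable_fun D (F2 : mR -> R) ->
    (forall x, 0 <= F1 x) -> (forall x, 0 <= F2 x) ->
    (\int[lam]_(x in D) (F1 x)%:E <= a%:E)%E -> (\int[lam]_(x in D) (F2 x)%:E <= b%:E)%E ->
    (\int[lam]_(x in D) (F1 x + F2 x)%:E <= (a + b)%:E)%E.
  move=> m1 m2 p1 p2 i1 i2; under eq_integral do rewrite EFinD.
  rewrite ge0_integralD//; first by rewrite EFinD; exact: leeD.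
  - by move=> x _; rewrite lee_fin.
  - exact/measurable_EFinP.
  - by move=> x _; rewrite lee_fin.
  - exact/measurable_EFinP.
have IG j : (j < 8)%N -> (\int[lam]_(x in D) (G j x)%:E <= (4 * e)%:E)%E.
  move=> j8; have [U1 V1] := He j (s j) j8 (or_introl erefl).
  have [U2 V2] := He j (s j + h) j8 (or_intror erefl).
  have W0 F d x : 0 <= W F d x by rewrite /W.
  have -> : 4 * e = e + e + e + e by ring.
  apply: (addI _ _ _ _); [|exact: mW'| | | |exact: V2].
  - by do 2 (apply: measurable_funD; last exact: mW'); exact: mW'.
  - by move=> x; rewrite !addr_ge0.
  - by move=> x; exact: W0.
  apply: (addI _ _ _ _); [|exact: mW'| | | |exact: V1].
  - by apply: measurable_funD; exact: mW'.
  - by move=> x; rewrite !addr_ge0.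
  - by move=> x; exact: W0.
  by apply: (addI _ _ _ _); [exact: mW'|exact: mW'|move=> x; exact: W0|move=> x; exact: W0|exact: U1|exact: U2].
rewrite -ge0_integralZl//; last first.
  by apply: (measurable_funS measurableT) => //; apply/measurable_EFinP; apply: measurableT_comp => //; exact: bU.1.
apply: (@le_trans _ _ (\int[lam]_(x in D) (\sum_(j < 8) (8%:E * (G j x)%:E) + (6 * e)%:E))%E).
  apply: ae_ge0_le_integral => //.
  - apply/measurable_EFinP; apply: measurable_funM => //.
    by apply: (measurable_funS measurableT) => //; apply: measurableT_comp => //; exact: bU.1.
  - move=> x _; apply: adde_ge0; last by rewrite lee_fin mulr_ge0// ltW.
    by apply: sume_ge0 => j _; apply: mule_ge0.
  - apply: emeasurable_funD => //; apply: emeasurable_sum => j.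
    by apply: measurable_funeM; exact: mG.
  apply: ae_imp Hx => x [j j8 [H1 H2]] _.
  have H := rotation_pointwise (U x) (V x) H1 H2.
  rewrite -EFinM; apply: (@le_trans _ _ (8%:E * (G j x)%:E + (6 * e)%:E)%E).
    by rewrite -EFinM -EFinD lee_fin /G /W !addrA.
  rewrite leeD2r// (bigD1 (Ordinal j8))//= leeDl//.
  by apply: sume_ge0 => i _; apply: mule_ge0.
rewrite ge0_integralD//; last 3 first.
- by move=> x _; apply: sume_ge0 => j _; apply: mule_ge0.
- by apply: emeasurable_sum => j; apply: measurable_funeM; exact: mG.
- by move=> x _; rewrite lee_fin mulr_ge0// ltW.
rewrite ge0_integral_sum//; last 2 first.
- by move=> j; apply: measurable_funeM; exact: mG.
- by move=> j x _; apply: mule_ge0.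
have -> : (\int[lam]_(x in D) (6 * e)%:E = (6 * e)%:E)%E.
  rewrite integral_cst//=; have := lebesgue_measure_itv `[(0 : R), 1].
  by rewrite /= lte_fin ltr01 -EFinB subr0 => ->; rewrite mule1.
apply: (@le_trans _ _ (\sum_(j < 8) (8 * (4 * e))%:E + (6 * e)%:E)%E).
  rewrite leeD2r//; apply: lee_sum => j _.
  rewrite ge0_integralZl//; last exact: mG.
  by rewrite EFinM lee_pmul2l//; exact: IG.
by rewrite sumEFin -EFinD lee_fin sumr_const card_ord -mulr_natr; lra.
Qed.

(** If the rotations by [N t] and by [(N + 1) t] are both close to the identity, so is their
    quotient, the rotation by [t]. *)
Lemma int_of_cos_near_1 (t i : R) : 0 < i ->
  (forall e : R, 0 < e -> exists N : nat, (2 - 2 * cos (2 * pi * t * N%:R)) * i <= e /\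
    (2 - 2 * cos (2 * pi * t * N.+1%:R)) * i <= e) ->
  exists n : int, t = n%:~R.
Proof.
move=> i0 H; apply: cos_2pi_eq1; apply/eqP; rewrite eq_le cos_le1/=.
apply/ler_addgt0Pr => e e0.
have [N [N0 N1]] := H (e / 2 * i) ltac:(by rewrite mulr_gt0// divr_gt0).
move: N0 N1; rewrite !ler_pM2r//.
set a := 2 * pi * t * N.+1%:R; set b := 2 * pi * t * N%:R => B A.
have -> : cos (2 * pi * t) = cos a * cos b + sin a * sin b.
  by rewrite -cosB; congr cos; rewrite /a /b -natr1; ring.
have ca := cos_le1 a; have cb := cos_le1 b.
have sa := cos2Dsin2 a; have sb := cos2Dsin2 b.
have s2 (x y : R) : x ^+ 2 <= 2 - 2 * y -> y <= 1 -> x ^+ 2 <= 2 * (1 - y) by lra.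
have p1 := mulr_ge0 (_ : 0 <= 1 - cos a) (_ : 0 <= 1 - cos b).
have := sqr_ge0 (sin a + sin b); have := sqr_ge0 (1 - cos a); have := sqr_ge0 (1 - cos b).
have := p1 ltac:(lra) ltac:(lra).
move: A B sa sb ca cb; rewrite !expr2.
by nra.
Qed.

End mean_estimate.

Section eigenvalues_are_integers.
Context {R : realType}.
Local Notation mR := (measurableTypeR R).
Local Notation lam := (@lebesgue_measure R).
Variables (alpha : R) (phi : ceiling R).

Definition birkhoff_sum (n : nat) (x : R) : R := \sum_(i < n) phi (x + i%:R * alpha).

(** The roof relation, iterated. *)
Lemma roof_birkhoff (P : R * R -> R) n x y : (forall x y, P (x + alpha, y) = P (x, y + phi x)) ->
  P (x + n%:R * alpha, y) = P (x, y + birkhoff_sum n x).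
Proof.
move=> roof; elim: n y => [|n IH] y; first by rewrite /birkhoff_sum big_ord0 mul0r !addr0.
rewrite -natr1 mulrDl mul1r addrA roof IH /birkhoff_sum big_ord_recr/=.
by rewrite -addrA [X in y + X]addrC.
Qed.

Lemma period_int (P : R * R -> R) (p : int) x y : (forall x y, P (x + 1, y) = P (x, y)) ->
  P (x + p%:~R, y) = P (x, y).
Proof. by move=> per; exact: (periodic_int (fun x' => per x' y)). Qed.

Variables (t : R) (P Q : R * R -> R).
Hypothesis PQ : plane_eigenfunction alpha phi t P Q.
Hypothesis phi_ge : forall x, 1 / 2 <= phi x.

Let bP x : bounded_borel (fun y => P (x, y)).
Proof.
split => [|y]; last exact: (plane_bounded1 PQ).
exact: (measurableT_comp (plane_measurable1 PQ) (measurable_pair1 x)).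
Qed.

Let bQ x : bounded_borel (fun y => Q (x, y)).
Proof.
split => [|y]; last exact: (plane_bounded2 PQ).
exact: (measurableT_comp (plane_measurable2 PQ) (measurable_pair1 x)).
Qed.

(** A window of length [c <= 1 / 2 <= phi x] starting at height [0] stays in the fundamental
    domain, so that its integral inherits the eigenvalue equation. *)
Lemma window_flow (c s : R) : 0 <= c <= 1 / 2 -> {ae lam, forall x : R,
  window c (fun y => P (x, y)) s = cos (2 * pi * t * s) * window c (fun y => P (x, y)) 0
    - sin (2 * pi * t * s) * window c (fun y => Q (x, y)) 0 /\
  window c (fun y => Q (x, y)) s = sin (2 * pi * t * s) * window c (fun y => P (x, y)) 0
    + cos (2 * pi * t * s) * window c (fun y => Q (x, y)) 0}.
Proof.
move=> /andP[c0 c2]; apply: ae_imp (plane_flow PQ s) => x H.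
have fin := @lebesgue_itv_lty R 0 c.
have mD : measurable (`[(0 : R), c[%classic : set mR) by exact: measurable_itv.
have IP s' : lam.-integrable `[(0 : R), c[ (EFin \o (fun y => P (x, y + s'))).
  by apply: bounded_borel_integrable => //; exact: (bounded_borel_addr s' (bP x)).
have IQ s' : lam.-integrable `[(0 : R), c[ (EFin \o (fun y => Q (x, y + s'))).
  by apply: bounded_borel_integrable => //; exact: (bounded_borel_addr s' (bQ x)).
have scale (k : R) (F : R -> R) : lam.-integrable `[(0 : R), c[ (EFin \o F) ->
    lam.-integrable `[(0 : R), c[ (EFin \o (fun y => k * F y)).
  by move=> iF; exact: (integrableZl mD k iF).
have aeR (F G : R -> R) : lam.-integrable `[(0 : R), c[ (EFin \o F) ->
    lam.-integrable `[(0 : R), c[ (EFin \o G) ->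
    {ae lam, forall y : R, 0 <= y < phi x -> F y = G y} ->
    \int[lam]_(y in `[(0 : R), c[) F y = \int[lam]_(y in `[(0 : R), c[) G y.
  move=> iF iG FG; rewrite /Rintegral; congr fine; apply: ae_eq_integral => //.
  - exact: measurable_int iF.
  - exact: measurable_int iG.
  - apply: ae_imp FG => y E /=; rewrite in_itv/= => /andP[y0 yc].
    by rewrite E// y0/= (lt_le_trans yc)// (le_trans c2).
split.
  rewrite /window -!RintegralZl// -RintegralB; [|exact: mD|exact: scale|exact: scale].
  apply: aeR => //.
    exact: (integrableB mD (scale _ _ (IP 0)) (scale _ _ (IQ 0))).
  by apply: ae_imp H => y H /H[-> _]; rewrite addr0.
rewrite /window -!RintegralZl// -RintegralD; [|exact: mD|exact: scale|exact: scale].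
apply: aeR => //.
  exact: (integrableD mD (scale _ _ (IP 0)) (scale _ _ (IQ 0))).
by apply: ae_imp H => y H /H[_ ->]; rewrite addr0.
Qed.

(** In the quotient, moving the base point by [N alpha] amounts to flowing for the time
    [birkhoff_sum N x], and an integral over a window is Lipschitz in the position of the window. *)
Lemma window_birkhoff (c h e : R) (p : int) (N M : nat) x : 0 <= c ->
  N%:R * alpha = p%:~R + h -> `|birkhoff_sum N x - M%:R| <= e ->
  `|window c (fun y => P (x + h, y)) 0 - window c (fun y => P (x, y)) M%:R| <= 2 * e /\
  `|window c (fun y => Q (x + h, y)) 0 - window c (fun y => Q (x, y)) M%:R| <= 2 * e.
Proof.
move=> c0 Nh bM.
have shift (F : R * R -> R) : (forall x y, F (x + 1, y) = F (x, y)) ->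
    (forall x y, F (x + alpha, y) = F (x, y + phi x)) ->
    window c (fun y => F (x + h, y)) 0 = window c (fun y => F (x, y)) (birkhoff_sum N x).
  move=> per roof; rewrite /window; apply: eq_Rintegral => y _.
  by rewrite addr0 -(roof_birkhoff _ _ _ roof) Nh [p%:~R + h]addrC addrA period_int.
rewrite (shift _ (plane_period1 PQ) (plane_roof1 PQ)) (shift _ (plane_period2 PQ) (plane_roof2 PQ)).
by split; (apply: le_trans (window_lip _ _ c0 _) _; [by []|rewrite ler_pM2l]).
Qed.

(** The windows of [P] and [Q] cannot all vanish, by differentiation; the part of the
    fundamental domain above height [1 / 2] is reached by the flow. *)
Lemma window_nonzero : (forall x, phi x <= 5 / 4) -> exists c : R, 0 <= c <= 1 / 2 /\
  ~ {ae lam, forall x : R, window c (fun y => P (x, y)) 0 = 0 /\ window c (fun y => Q (x, y)) 0 = 0}.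
Proof.
move=> phi_le; apply: contrapT => /forallNP H.
have Hc c : 0 <= c <= 1 / 2 -> {ae lam, forall x : R, window c (fun y => P (x, y)) 0 = 0 /\ window c (fun y => Q (x, y)) 0 = 0}.
  by move=> c2; have /not_andP[|/contrapT] := H c.
have nk (n k : nat) : 0 <= Num.min (k%:R / n.+1%:R) (1 / 2 : R) <= 1 / 2.
  by rewrite le_min divr_ge0//= ge_min lexx orbT divr_ge0.
have Hall := ae_all (fun n => ae_all (fun k => Hc _ (nk n k))).
have Hzero : {ae lam, forall x : R, {ae lam, forall y : R, 0 < y < 1 / 2 -> P (x, y) = 0 /\ Q (x, y) = 0}}.
  apply: ae_imp Hall => x Hx.
  have dense (h : R -> R) : bounded_borel h ->
      (forall n k : nat, window (Num.min (k%:R / n.+1%:R) (1 / 2)) h 0 = 0) ->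
      forall c, 0 <= c <= 1 / 2 -> window c h 0 = 0.
    move=> bh h0 c /andP[c0 c2]; apply/eqP; rewrite -normr_le0; apply/ler_addgt0Pr => e e0.
    rewrite add0r; pose n := Num.truncn e^-1; pose k := Num.truncn (c * n.+1%:R).
    have n0 : (0 : R) < n.+1%:R by [].
    have /andP[k1 k2] := truncn_itv (mulr_ge0 c0 (ltW n0)).
    have kc : k%:R / n.+1%:R <= c by rewrite ler_pdivrMr.
    have := h0 n k; rewrite min_l; last exact: le_trans c2.
    move=> h00; have -> : window c h 0 = window c h 0 - window (k%:R / n.+1%:R) h 0 by rewrite h00 subr0.
    apply: le_trans (window_lip_width _ kc bh) _; first by rewrite divr_ge0.
    have ne : n.+1%:R^-1 <= e by rewrite invf_ple ?posrE// ltW// truncnS_gt.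
    apply: le_trans ne; rewrite lerBlDr -[X in X + _]mul1r -mulrDl ler_pdivlMr//.
    by rewrite addrC natr1 ltW.
  have Hp := ae_eq0_of_window (bP x) (dense _ (bP x) (fun n k => (Hx n k).1)).
  have Hq := ae_eq0_of_window (bQ x) (dense _ (bQ x) (fun n k => (Hx n k).2)).
  by apply: ae_imp (ae_and Hp Hq) => y [Py Qy] y0; rewrite Py// Qy.
have neq (a : R) : {ae lam, forall y : R, y != a}.
  exists [set a]; split => //; first exact: lebesgue_measure_set1.
  by move=> y /= /negP; rewrite negbK => /eqP.
apply: (plane_nonzero PQ).
have F1 := plane_flow PQ (- (1 / 2)); have F2 := plane_flow PQ (-1).
apply: ae_imp (ae_and Hzero (ae_and F1 F2)) => x [Z [f1 f2]].
have Z1 := ae_translation (- (1 / 2)) Z; have Z2 := ae_translation (-1) Z.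
have N0 := ae_and (neq 0) (ae_and (neq (1 / 2)) (neq 1)).
apply: ae_imp (ae_and (ae_and Z f1) (ae_and N0 (ae_and f2 (ae_and Z1 Z2)))).
move=> y [[zy fy1] [[y0 [y1 y2]] [fy2 [zy1 zy2]]]] /andP[y3 y4].
have back (a C S : R) : C ^+ 2 + S ^+ 2 = 1 -> P (x, y + a) = 0 -> Q (x, y + a) = 0 ->
    P (x, y + a) = C * P (x, y) - S * Q (x, y) -> Q (x, y + a) = S * P (x, y) + C * Q (x, y) ->
    P (x, y) = 0 /\ Q (x, y) = 0.
  move=> CS -> -> e1 e2.
  have p0 : P (x, y) = C * (C * P (x, y) - S * Q (x, y)) + S * (S * P (x, y) + C * Q (x, y)).
    by rewrite -[LHS]mul1r -CS; ring.
  have q0 : Q (x, y) = C * (S * P (x, y) + C * Q (x, y)) - S * (C * P (x, y) - S * Q (x, y)).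
    by rewrite -[LHS]mul1r -CS; ring.
  by split; [rewrite p0|rewrite q0]; rewrite -e1 -e2 !mulr0 ?addr0 ?subr0.
have y40 := phi_le x.
have [yl|yl] := ltP y (1 / 2); first by apply: zy; rewrite lt_neqAle eq_sym y0 y3 yl.
have yl' : 1 / 2 < y by rewrite lt_neqAle eq_sym y1 yl.
have [ym|ym] := ltP y 1.
  have [|p0 q0] := zy1; first by lra.
  have [|e1 e2] := fy1; first by rewrite y3 y4.
  exact: (back _ _ _ (cos2Dsin2 _) p0 q0 e1 e2).
have ym' : 1 < y by rewrite lt_neqAle eq_sym y2 ym.
have [|p0 q0] := zy2; first by lra.
have [|e1 e2] := fy2; first by rewrite y3 y4.
exact: (back _ _ _ (cos2Dsin2 _) p0 q0 e1 e2).
Qed.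

End eigenvalues_are_integers.

Section integrality.
Context {R : realType}.
Local Notation mR := (measurableTypeR R).
Local Notation lam := (@lebesgue_measure R).

(** What excludes eigenvalues that are not integers: at a time [N] when the rotation is close to
    the identity, the sum of the roof is ambiguous, close to [N] or to [N + 1] according to the
    position of the point in a short interval.  Eight shifts are enough to reach both cases. *)
Definition split_returns (alpha : R) (phi : ceiling R) := forall e : R, 0 < e ->
  exists (N : nat) (p : int) (h : R) (s : nat -> R),
    [/\ N%:R * alpha = p%:~R + h, `|h| <= e,
        forall j, (j < 8)%N -> `|s j| <= e,
        forall x, exists2 j, (j < 8)%N & `|birkhoff_sum alpha phi N (x + s j) - N%:R| <= e &
        forall x, exists2 j, (j < 8)%N & `|birkhoff_sum alpha phi N (x + s j) - N.+1%:R| <= e].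

(** The pair [(U, V)] of the window integrals of [P] and [Q] is not null.  At a return time close
    to [M] it is almost invariant, because the base translation is close to the identity, and it
    is rotated by the angle [2 pi t M]; continuity in mean forces that angle to be close to [0]. *)
Lemma split_returns_cos (alpha : R) (phi : ceiling R) (t c : R) (P Q : R * R -> R) :
  split_returns alpha phi -> plane_eigenfunction alpha phi t P Q ->
  (forall x, 1 / 2 <= phi x) -> 0 <= c <= 1 / 2 ->
  ~ {ae lam, forall x : R, window c (fun y => P (x, y)) 0 = 0} ->
  exists n : int, t = n%:~R.
Proof.
move=> ret PQ phi_ge /andP[c0 c2] nz.
pose U x := window c (fun y => P (x, y)) 0.
pose V x := window c (fun y => Q (x, y)) 0.
have bU : bounded_borel U.
  split; first exact: (measurable_window _ (plane_measurable1 PQ) (plane_bounded1 PQ)).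
  move=> x; apply: window_le1; first by rewrite c0; lra.
  split => [|y]; last exact: (plane_bounded1 PQ).
  exact: (measurableT_comp (plane_measurable1 PQ) (measurable_pair1 x)).
have bV : bounded_borel V.
  split; first exact: (measurable_window _ (plane_measurable2 PQ) (plane_bounded2 PQ)).
  move=> x; apply: window_le1; first by rewrite c0; lra.
  split => [|y]; last exact: (plane_bounded2 PQ).
  exact: (measurableT_comp (plane_measurable2 PQ) (measurable_pair1 x)).
pose D := `[(0 : R), 1]%classic.
have mD : measurable (D : set mR) by exact: measurable_itv.
have mU : measurable_fun D (EFin \o U : mR -> \bar R).
  by apply/measurable_EFinP; exact: (measurable_funS measurableT _ bU.1).
pose I := (\int[lam]_(x in D) `|U x|%:E)%E.
have I0 : (0 <= I)%E by apply: integral_ge0 => x _; rewrite lee_fin.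
have Ifin : I \is a fin_num.
  rewrite ge0_fin_numE//; have /integrableP[_] : lam.-integrable D (EFin \o U).
    apply: bounded_borel_integrable => //.
    by rewrite lebesgue_measure_itv/= lte_fin ltr01 -EFinB ltry.
  by [].
have In0 : I != 0%E.
  apply/eqP => /(ae_eq_integral_abs lam mD mU) H; apply: nz.
  apply: (ae_periodic (B := fun x => U x = 0)).
    move=> x; rewrite /U (_ : (fun y => P (x + 1, y)) = fun y => P (x, y))//.
    by apply/funext => y; exact: (plane_period1 PQ).
  apply: ae_imp H => x H /andP[x0 x1].
  by have := H; rewrite /D/= in_itv/= x0 (ltW x1) => /(_ isT)[].
have i0 : 0 < fine I by rewrite fine_gt0// lt_neqAle eq_sym In0 I0/= ltey_eq Ifin.
apply: (int_of_cos_near_1 i0) => e e0.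
have e2 : 0 < e / 262 by rewrite divr_gt0.
have [d d0 Hd] := continuity_in_mean bU e2.
have [d' d0' Hd'] := continuity_in_mean bV e2.
pose r := Num.min (e / 262) (Num.min (d / 3) (d' / 3)).
have r0 : 0 < r by rewrite !lt_min e2 !divr_gt0.
have [re rd rd'] : [/\ r <= e / 262, r <= d / 3 & r <= d' / 3].
  by rewrite /r !ge_min !lexx !orbT.
have [N [p [h [s [Nh hr sr H0 H1]]]]] := ret r r0.
have small j D' : (j < 8)%N -> D' = s j \/ D' = s j + h -> `|D'| <= 2 * r.
  move=> j8 [->|->]; have := sr j j8; first by move: r0; lra.
  by move=> sj; apply: le_trans (ler_normD _ _) _; lra.
have cont j D' : (j < 8)%N -> D' = s j \/ D' = s j + h ->
    (\int[lam]_(x in `[0%R, 1%R]) `|U (x + D')%R - U x|%:E <= (e / 262)%:E)%E /\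
    (\int[lam]_(x in `[0%R, 1%R]) `|V (x + D')%R - V x|%:E <= (e / 262)%:E)%E.
  move=> j8 D'E; have := small j D' j8 D'E => sD.
  by split; [apply: Hd|apply: Hd']; apply: le_lt_trans sD _; lra.
have main M : (forall x, exists2 j, (j < 8)%N & `|birkhoff_sum alpha phi N (x + s j) - M%:R| <= r) ->
    (2 - 2 * cos (2 * pi * t * M%:R)) * fine I <= e.
  move=> HM; rewrite -lee_fin EFinM fineK//.
  have -> : e = 262 * (e / 262) by field.
  apply: (rotation_mean_estimate (h := h) (s := s) bU bV e2 cont).
  have G := window_flow PQ phi_ge M%:R (ltac:(by rewrite c0) : 0 <= c <= 1 / 2).
  apply: ae_imp (ae_all (fun j => ae_translation (s j) G)) => x Gx.
  have [j j8 Hj] := HM x; exists j => //.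
  have [g1 g2] := Gx j.
  have [B1 B2] := window_birkhoff PQ c0 Nh Hj.
  rewrite g1 in B1; rewrite g2 in B2.
  by split; [apply: le_trans B1 _|apply: le_trans B2 _]; rewrite ler_pM2l.
by exists N; split; exact: main.
Qed.

(** Near every point [birkhoff_sum N] takes values close to [N] and to [N + 1], while
    the rotation by [N alpha] is close to the identity: both [exp (2 i pi t N)] and
    [exp (2 i pi t (N + 1))] tend to [1]. *)
Lemma eigenvalue_int (alpha : R) (phi : ceiling R) (t : R) :
  split_returns alpha phi -> (forall x, 1 / 2 <= phi x <= 5 / 4) ->
  Defs.eigenvalue alpha phi t -> exists n : int, t = n%:~R.
Proof.
move=> ret phib /eigenvalue_plane[P [Q PQ]].
have phi_ge x : 1 / 2 <= phi x by case/andP: (phib x).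
have [|c [c2 nz]] := window_nonzero PQ; first by move=> x; case/andP: (phib x).
have [HP|] := pselect {ae lam, forall x : R, window c (fun y => P (x, y)) 0 = 0}; last first.
  exact: (split_returns_cos ret PQ).
apply: (split_returns_cos ret (plane_eigenfunction_rot PQ) phi_ge c2) => HQ.
by apply: nz; exact: ae_and.
Qed.

End integrality.

(** * The sequence of steps, frequencies and times *)

Section periodic_mean.
Context {R : realType}.
Local Notation lam := (@lebesgue_measure R).

(** After reduction to [0 <= s <= 1], the part of the window beyond [1] is the translate of the
    missing part [0, s[. *)
Lemma window_periodic (g : R -> R) (s : R) : bounded_borel g -> (forall x, g (x + 1) = g x) ->
  window 1 g s = window 1 g 0.
Proof.
move=> bg g1; have gz := periodic_int g1.
wlog s01 : s / 0 <= s <= 1.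
  move=> H; rewrite -(H (s - (Num.floor s)%:~R)); last first.
    by have := floor_le s; have := floorD1_gt s; rewrite intrD; lra.
  rewrite /window; apply: eq_Rintegral => y _.
  by rewrite -[LHS](gz (- Num.floor s)) intrN -addrA.
have /andP[s0 s1] := s01.
rewrite !window_itv// (Rintegral_itv_cat bg s1) ?lerDr//.
rewrite add0r (Rintegral_itv_cat bg s0 s1) addrC; congr (_ + _).
rewrite -[in X in `[X, _[](add0r 1) [in X in `[_, X[](addrC s 1).
rewrite add0r -window_itv// /window -[RHS](_ : \int[lam]_(y in `[0, s[) g (y + 1) = _)//.
by apply: eq_Rintegral => y _; rewrite g1.
Qed.

End periodic_mean.

Section coboundary_modes.
Context {R : realType}.
Implicit Types (L : seq (R * int * R)).

(** The modes of [G (q (x + alpha)) - G (q x)], where [G] has the modes [L] and [q alpha] is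
    [rho] plus an integer: the difference of two cosines is a product of sines, and the amplitude
    of the mode [j] acquires the factor [2 sin (pi j rho)]. *)
Definition coboundary_modes L (q : nat) (rho : R) : seq (R * R * R) :=
  [seq (- 2 * t.1.1 * sin (pi * t.1.2%:~R * rho), 2 * pi * t.1.2%:~R * q%:R,
        t.2 + pi * t.1.2%:~R * rho - pi / 2) | t <- L].

Lemma coboundary_modesE L (q : nat) (p : int) (alpha x : R) :
  mode_eval (coboundary_modes L q (q%:R * alpha - p%:~R)) x =
  trig_eval L (q%:R * (x + alpha)) - trig_eval L (q%:R * x).
Proof.
rewrite /mode_eval big_map -sumrB; apply: eq_bigr => -[[a j] c] _ /=.
set rho := q%:R * alpha - p%:~R; set th := pi * j%:~R * rho.
set B := 2 * pi * j%:~R * (q%:R * x) + c.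
have -> : cos (2 * pi * j%:~R * (q%:R * (x + alpha)) + c) = cos (B + th + th).
  rewrite -[RHS](cosDn2pi _ (j * p)); congr cos.
  by rewrite /th /rho /B intrM; ring.
have -> : cos B = cos (B + th - th) by congr cos; ring.
rewrite (_ : 2 * pi * j%:~R * q%:R * x + (c + th - pi / 2) = B + th - pi / 2); last by rewrite /B; ring.
by rewrite cosBpihalf (cosD (B + th) th) (cosB (B + th) th); ring.
Qed.

(** The weight is the product of a constant of [L], of the Diophantine distance [rho] and of the
    value of [w] at a frequency proportional to [q].  This is where the arithmetic of the
    rotation pays for the regularity of the ceiling. *)
Lemma coboundary_modes_weight (w : R -> R) L : (forall x, 0 <= x -> 0 <= w x) ->
  (forall x y, 0 <= x -> x <= y -> w x <= w y) ->
  exists (J : nat) (A : R), 0 <= A /\ forall (q : nat) (rho : R),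
    mode_weight w (coboundary_modes L q rho) <= A * (`|rho| * w (2 * pi * J%:R * q%:R)).
Proof.
move=> w0 wmon.
pose J := (\sum_(t <- L) `|t.1.2|)%N.
exists J, (\sum_(t <- L) `|2 * t.1.1 * pi * t.1.2%:~R|); split.
  by apply: sumr_ge0 => t _.
move=> q rho; rewrite /mode_weight big_map mulr_suml big_seq [leRHS]big_seq.
apply: ler_sum => t tL /=.
have jJ : `|t.1.2%:~R| <= (J%:R : R).
  rewrite -intr_norm -[X in _ <= X]/((J%:Z)%:~R : R) ler_int -abszE lez_nat /J.
  by rewrite (big_rem t tL)/= leq_addr.
rewrite mulrA; apply: ler_pM => //.
- by apply: w0.
- rewrite !normrM normrN -!mulrA; do 2 rewrite ler_wpM2l//.
  by rewrite -!normrM mulrA; apply: sin_le_norm.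
- apply: wmon => //; rewrite !normrM !normr_nat (ger0_norm (pi_ge0 R)).
  by rewrite ler_wpM2r// ler_wpM2l// mulr_ge0 ?pi_ge0.
Qed.

End coboundary_modes.

Section tower.
Context {R : realType}.
Local Notation mR := (measurableTypeR R).

(** The data of the construction at stage [m]: a smooth step function [G m], a frequency
    [q m], the modes [l m] of the coboundary of [x |-> G m (q m x)], and a time [N m] such
    that [N m * alpha] is close, modulo the integer [p m], to a quarter of the period
    [1 / q m].  Each stage is invisible at the times [N i] of the previous stages, and the
    previous stages are almost constant along the translation by [N m * alpha]. *)
Record tower (w : R -> R) (alpha : R) (G : nat -> R -> R) (q : nat -> nat)
    (l : nat -> seq (R * R * R)) (N : nat -> nat) (p : nat -> int) : Prop := Tower {
  tower_borel : forall m, measurable_fun [set: mR] (G m : mR -> R) ;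
  tower_period : forall m x, G m (x + 1) = G m x ;
  tower_01 : forall m x, 0 <= G m x <= 1 ;
  tower_low : forall m z, (2 ^+ (m + 6))^-1 <= z <= 1 / 2 - (2 ^+ (m + 6))^-1 ->
    G m z <= (2 ^+ (m + 6))^-1 ;
  tower_high : forall m z, 1 / 2 + (2 ^+ (m + 6))^-1 <= z <= 1 - (2 ^+ (m + 6))^-1 ->
    1 - (2 ^+ (m + 6))^-1 <= G m z ;
  tower_q_gt0 : forall m, (0 < q m)%N ;
  tower_q_ge : forall m, (m <= q m)%N ;
  tower_modes : forall m x, mode_eval (l m) x = G m ((q m)%:R * (x + alpha)) - G m ((q m)%:R * x) ;
  tower_weight : forall m, mode_weight w (l m) <= 2^-1 ^+ (m + 6) ;
  tower_weight_late : forall i m, (i < m)%N -> (N i)%:R * mode_weight w (l m) <= 2^-1 ^+ (m + 6) ;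
  tower_shift : forall m, `|(N m)%:R * alpha - (p m)%:~R| <= (q m)%:R^-1 ;
  tower_early : forall m x, `|\sum_(i < m) (G i ((q i)%:R * (x + ((N m)%:R * alpha - (p m)%:~R))) - G i ((q i)%:R * x))| <= 2^-1 ^+ m ;
  tower_quarter : forall m x,
    `|G m ((q m)%:R * (x + ((N m)%:R * alpha - (p m)%:~R))) - G m ((q m)%:R * x + 1 / 4)| <= 2^-1 ^+ m }.

(** The stages are chosen one after the other.  At stage [m] the step function [trig_eval (L m)]
    is given; first [q m] is taken so large, and [q m * alpha] so close to an integer, that the
    coboundary is negligible even after the times [N i] of the previous stages and that the
    previous functions hardly vary over the length [1 / q m]; then [N m] is found by density of
    the orbit.  The state of the recursion is the pair of the sum of the previous times and of
    a Lipschitz constant of the sum of the previous functions. *)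
Lemma tower_exists (w : R -> R) (alpha : R) : irrational alpha ->
  (forall x, 0 <= x -> 0 <= w x) -> (forall x y, 0 <= x -> x <= y -> w x <= w y) ->
  (forall (J Q : nat) (e : R), 0 < e -> exists (q : nat) (p : int),
     [/\ (0 < q)%N, (Q <= q)%N & `|q%:R * alpha - p%:~R| * w (2 * pi * J%:R * q%:R) <= e]) ->
  exists G q l N p, tower w alpha G q l N p.
Proof.
move=> ia w0 wmon small.
have half_gt0 m : 0 < (2^-1 : R) ^+ m by rewrite exprn_gt0// invr_gt0.
have w_ge0 l : 0 <= mode_weight w l by apply: sumr_ge0 => t _; rewrite mulr_ge0// w0.
(* the step functions *)
have [L HL] : {L : nat -> seq (R * int * R) | forall m,
    [/\ forall z, 0 <= trig_eval (L m) z <= 1,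
        forall z, (2 ^+ (m + 6))^-1 <= z <= 1 / 2 - (2 ^+ (m + 6))^-1 -> trig_eval (L m) z <= (2 ^+ (m + 6))^-1 &
        forall z, 1 / 2 + (2 ^+ (m + 6))^-1 <= z <= 1 - (2 ^+ (m + 6))^-1 -> 1 - (2 ^+ (m + 6))^-1 <= trig_eval (L m) z]}.
  have H m : {L : seq (R * int * R) | [/\ forall z, 0 <= trig_eval L z <= 1,
        forall z, (2 ^+ (m + 6))^-1 <= z <= 1 / 2 - (2 ^+ (m + 6))^-1 -> trig_eval L z <= (2 ^+ (m + 6))^-1 &
        forall z, 1 / 2 + (2 ^+ (m + 6))^-1 <= z <= 1 - (2 ^+ (m + 6))^-1 -> 1 - (2 ^+ (m + 6))^-1 <= trig_eval L z]}.
    apply: cid; have [|g [[L gL] g1 g2 g3]] := @trig_poly_step R (2 ^+ (m + 6))^-1.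
      by rewrite invr_gt0 exprn_gt0.
    exists L; split => z; [|move=> zH..]; rewrite -gL; [exact: g1|exact: g2|exact: g3].
  by exists (fun m => sval (H m)) => m; exact: (svalP (H m)).
have tL m : trig_poly (trig_eval (L m)) by exists (L m).
have [La La0 HLa] : exists2 La : nat -> R, (forall m, 0 <= La m) &
    forall m x y, `|trig_eval (L m) x - trig_eval (L m) y| <= La m * `|x - y|.
  have H m : {a : R | 0 <= a /\ forall x y, `|trig_eval (L m) x - trig_eval (L m) y| <= a * `|x - y|}.
    by apply: cid; have [a a0 Ha] := trig_poly_lip (tL m); exists a.
  by exists (fun m => sval (H m)) => m; have [] := svalP (H m).
(* one stage, given a bound M for the previous times and a Lipschitz constant K for the
   sum of the previous functions *)
pose spec m (M : nat) (K : R) (z : nat * seq (R * R * R) * nat * int) :=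
  let: (q, l, N, p) := z in
  [/\ (0 < q)%N, (m <= q)%N, M.+1%:R * mode_weight w l <= 2^-1 ^+ (m + 6) &
   [/\ forall x, mode_eval l x = trig_eval (L m) (q%:R * (x + alpha)) - trig_eval (L m) (q%:R * x),
    K / q%:R <= 2^-1 ^+ m,
    `|N%:R * alpha - p%:~R - 1 / (4 * q%:R)| <= 1 / (4 * q%:R) &
    La m * q%:R * `|N%:R * alpha - p%:~R - 1 / (4 * q%:R)| <= 2^-1 ^+ m]].
have next m (MK : nat * R) : {z | 0 <= MK.2 -> spec m MK.1 MK.2 z}.
  case: MK => M K; apply: cid => /=; have [K0|_] := leP 0 K; last by exists (0%N, [::], 0%N, 0 : int).
  have [J [A [A0 HJ]]] := coboundary_modes_weight (L m) w0 wmon.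
  have [Q HQ] : exists Q : nat, K * 2 ^+ m < Q%:R by exists (Num.truncn (K * 2 ^+ m)).+1; exact: truncnS_gt.
  have e0 : 0 < 2^-1 ^+ (m + 6) / (M.+1%:R * (A + 1)) :> R.
    by rewrite divr_gt0// mulr_gt0// ltr_wpDl.
  have [q [p0 [q0 qQ qs]]] := small J (Q + m)%N _ e0.
  have q0' : (0 : R) < q%:R by rewrite ltr0n.
  have d0 : 0 < Num.min (1 / (4 * q%:R)) (2^-1 ^+ m / (La m * q%:R + 1)) :> R.
    by rewrite lt_min !divr_gt0 ?mulr_gt0// ltr_wpDl// mulr_ge0// ltW.
  have [N [p Np]] := dense_orbit (1 / (4 * q%:R)) ia d0.
  move: Np; rewrite lt_min => /andP[Np1 Np2].
  exists (q, coboundary_modes (L m) q (q%:R * alpha - p0%:~R), N, p) => _ /=; split => //.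
  - exact: leq_trans (leq_addl _ _) qQ.
  - apply: (@le_trans _ _ (M.+1%:R * (A * (2^-1 ^+ (m + 6) / (M.+1%:R * (A + 1)))))).
      by rewrite ler_wpM2l//; apply: le_trans (HJ _ _) _; rewrite ler_wpM2l.
    have A1 : 0 < A + 1 by rewrite ltr_wpDl.
    have -> : M.+1%:R * (A * (2^-1 ^+ (m + 6) / (M.+1%:R * (A + 1)))) = 2^-1 ^+ (m + 6) * (A / (A + 1)).
      by field; rewrite gt_eqF//= addrC natr1 pnatr_eq0.
    by apply: ler_piMr; [exact: ltW|rewrite ler_pdivrMr// mul1r lerDl].
  split.
  - by move=> x; exact: coboundary_modesE.
  - rewrite ler_pdivrMr// mulrC exprVn ler_pdivlMr ?exprn_gt0//.
    apply: le_trans (ltW HQ) _; rewrite ler_nat; exact: leq_trans (leq_addr _ _) qQ.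
  - exact: ltW.
  - move: Np2; rewrite ltr_pdivlMr; last by rewrite ltr_wpDl// mulr_ge0// ltW.
    by move=> /ltW; apply: le_trans; rewrite mulrC ler_wpM2l// lerDl.
pose stage m (MK : nat * R) := sval (next m MK).
pose qOf (z : nat * seq (R * R * R) * nat * int) := z.1.1.1.
pose NOf (z : nat * seq (R * R * R) * nat * int) := z.1.2.
pose fix st m : nat * R := if m is m'.+1 then
    let z := stage m' (st m') in (((st m').1 + NOf z)%N, (st m').2 + La m' * (qOf z)%:R)
  else (0%N, 0).
pose z m := stage m (st m).
have st0 m : 0 <= (st m).2.
  by elim: m => [|m IH] //=; rewrite addr_ge0// mulr_ge0.
have zP m : spec m (st m).1 (st m).2 (z m) by exact: (svalP (next m (st m)) (st0 m)).
pose q m := qOf (z m); pose l m := (z m).1.1.2; pose N m := NOf (z m); pose p m := (z m).2.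
have zE m : z m = (q m, l m, N m, p m) by rewrite /q /l /N /p; case: (z m) => [[[]]].
have HP m : spec m (st m).1 (st m).2 (q m, l m, N m, p m) by rewrite -zE.
have NM i m : (i < m)%N -> (N i <= (st m).1)%N.
  elim: m => // m IH; rewrite ltnS leq_eqVlt => /predU1P[->|im] /=.
    exact: leq_addl.
  exact: leq_trans (IH im) (leq_addr _ _).
have stE m : (st m).2 = \sum_(i < m) La i * (q i)%:R.
  by elim: m => [|m IH]; [rewrite big_ord0|rewrite big_ord_recr/= -IH].
exists (fun m => trig_eval (L m)), q, l, N, p; split.
- move=> m; apply: continuous_measurable_fun.
  move=> x; apply/cvgrPdist_lt => e e0; near=> y.
  apply: le_lt_trans (HLa m x y) _.
  have : `|x - y| < e / (La m + 1).
    near: y; have d0 : 0 < e / (La m + 1) by rewrite divr_gt0// ltr_wpDl.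
    exact: (nbhsx_ballx x (e / (La m + 1)) d0).
  rewrite ltr_pdivlMr ?ltr_wpDl// => /le_lt_trans; apply.
  by rewrite mulrC ler_wpM2l// lerDl.
- by move=> m x; exact: trig_polyD1.
- by move=> m x; have [H _ _] := HL m; exact: H.
- by move=> m; have [_ H _] := HL m.
- by move=> m; have [_ _ H] := HL m.
- by move=> m; have [] := HP m.
- by move=> m; have [] := HP m.
- by move=> m x; have [_ _ _ [H _ _ _]] := HP m.
- move=> m; have [_ _ H _] := HP m; apply: le_trans H.
  by rewrite ler_peMl// ler1n.
- move=> i m im; have [_ _ H _] := HP m; apply: le_trans H.
  by rewrite ler_wpM2r// ler_nat; apply: leq_trans (NM i m im) _.
- move=> m; have [q0 _ _ [_ _ H _]] := HP m.
  have q0' : (0 : R) < (q m)%:R by rewrite ltr0n.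
  rewrite (_ : _ - _ = ((N m)%:R * alpha - (p m)%:~R - 1 / (4 * (q m)%:R)) + 1 / (4 * (q m)%:R)); last by rewrite subrK.
  apply: le_trans (ler_normD _ _) _.
  rewrite [`|1 / _|]ger0_norm; last by rewrite divr_ge0// mulr_ge0// ltW.
  apply: le_trans (lerD H (lexx _)) _.
  by rewrite -mulrDl ler_pdivrMr ?mulr_gt0// mulrCA mulVf ?gt_eqF//; lra.
- move=> m x; have [q0 _ _ [_ HK H _]] := HP m.
  set h := (N m)%:R * alpha - (p m)%:~R in H *.
  have q0' : (0 : R) < (q m)%:R by rewrite ltr0n.
  have hq : `|h| <= (q m)%:R^-1.
    rewrite (_ : h = (h - 1 / (4 * (q m)%:R)) + 1 / (4 * (q m)%:R)); last by rewrite subrK.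
    apply: le_trans (ler_normD _ _) _.
    rewrite [`|1 / _|]ger0_norm; last by rewrite divr_ge0// mulr_ge0// ltW.
    apply: le_trans (lerD H (lexx _)) _.
    by rewrite -mulrDl ler_pdivrMr ?mulr_gt0// mulrCA mulVf ?gt_eqF//; lra.
  apply: le_trans (ler_norm_sum _ _ _) _; apply: le_trans HK; rewrite stE mulr_suml.
  apply: ler_sum => i _; apply: le_trans (HLa _ _ _) _.
  rewrite -mulrBr addrC addKr normrM normr_nat -mulrA; apply: ler_wpM2l => //.
  by rewrite ler_wpM2l.
- move=> m x; have [q0 _ _ [_ _ _ H]] := HP m.
  have q0' : (0 : R) < (q m)%:R by rewrite ltr0n.
  apply: le_trans (HLa _ _ _) _; apply: le_trans H; rewrite -mulrA ler_wpM2l//.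
  rewrite -[X in X * `|_ - 1 / _|]normr_nat -normrM.
  rewrite le_eqVlt; apply/orP; left; apply/eqP; congr (`|_|).
  by field; rewrite gt_eqF.
Unshelve. all: by end_near. Qed.

End tower.

(** * The ceiling function and its returns *)

Section tower_ceiling.
Context {R : realType}.
Local Notation mR := (measurableTypeR R).
Local Notation lam := (@lebesgue_measure R).

Lemma sums_to_shift (u : nat -> R) s M : sums_to u s -> sums_to (fun m => u (m + M)%N) (s - series u M).
Proof.
move=> us; rewrite /sums_to.
rewrite (_ : series _ = fun n => series u (n + M)%N - series u M).
  by apply: cvgB; [rewrite cvg_shiftn|exact: cvg_cst].
apply/funext => n; rewrite /series/= (@big_cat_nat _ _ _ M 0 (n + M))//= ?leq_addl// [X in _ = X - _]addrC addrK.
by rewrite -{2}[M]add0n big_addn addnK.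
Qed.

Lemma geo_sums_to_tail (u : nat -> R) s C M : (forall m, (M <= m)%N -> `|u m| <= C / 2 ^+ m) ->
  sums_to u s -> `|s - series u M| <= 2 * (C / 2 ^+ M).
Proof.
move=> uC us; apply: (@geo_sums_to_le _ (fun m => u (m + M)%N)); last exact: sums_to_shift.
move=> m.
by apply: le_trans (uC _ (leq_addl _ _)) _; rewrite addnC exprD invfM mulrA.
Qed.

Lemma norm_Rintegral_01_le (h : R -> R) (d : R) : lam.-integrable `[0, 1[ (EFin \o h) ->
  (forall x, `|h x| <= d) -> `|\int[lam]_(x in `[0, 1[) h x| <= d.
Proof.
move=> I hd; have fin := @lebesgue_itv_lty R 0 1.
apply: le_trans (le_normr_Rintegral _ I) _ => //.
rewrite [leRHS](_ : d = \int[lam]_(x in `[0, 1[) d); last first.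
  rewrite Rintegral_cst//= -[LHS]mulr1; congr (_ * _).
  have := lebesgue_measure_itv `[(0 : R), 1[; rewrite /= lte_fin ltr01 => ->.
  by rewrite -EFinB subr0.
apply: le_Rintegral => //; first exact: integrable_norm.
apply: measurable_bounded_integrable => //.
by exists `|d|; split => // x dx y _ /=; exact: ltW.
Qed.

Section fixed_tower.
Variables (w : R -> R) (alpha : R) (G : nat -> R -> R) (q : nat -> nat).
Variables (l : nat -> seq (R * R * R)) (N : nat -> nat) (p : nat -> int).
Hypothesis tow : tower w alpha G q l N p.
Hypothesis w1 : forall om, 0 <= om -> 1 <= w om.

Local Notation g m x := (G m ((q m)%:R * x)).

Lemma tower_geo m : (2^-1 : R) ^+ (m + 6) = (1 / 64) / 2 ^+ m.
Proof. by rewrite exprD exprVn [2^-1 ^+ 6](_ : _ = 1 / 64) 1?mulrC//; field. Qed.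

Lemma tower_mode_le m x : `|mode_eval (l m) x| <= (1 / 64) / 2 ^+ m.
Proof.
rewrite -tower_geo; apply: le_trans (tower_weight tow m); exact: mode_eval_le.
Qed.

Lemma tower_wave_borel m : bounded_borel (fun x => g m x).
Proof.
split=> [|x].
- apply: (measurableT_comp (tower_borel tow m)).
  apply: (measurable_funM (f := cst (q m)%:R)); [exact: measurable_cst|exact: measurable_id].
- by have /andP[h0 h1] := tower_01 tow m ((q m)%:R * x); rewrite ger0_norm.
Qed.

Lemma tower_wave_int m (n : int) x : g m (x + n%:~R) = g m x.
Proof.
by rewrite mulrDr -[(q m)%:R * n%:~R]/(((q m)%:Z)%:~R * n%:~R) -intrM (periodic_int (tower_period tow m)).
Qed.

(** The ceiling is one plus the sum of the coboundaries.  The integral of each coboundary is zero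
    by periodicity, and the series converges uniformly. *)
Lemma ceiling_of_tower : exists phi : ceiling R,
  [/\ forall x, 7 / 8 <= phi x <= 9 / 8, measurable_fun [set: mR] (phi : mR -> mR) &
      forall x, sums_to (fun m => mode_eval (l m) x) (phi x - 1)].
Proof.
have [f fE] : exists f, forall x, sums_to (fun m => mode_eval (l m) x) (f x).
  exists (fun x => sval (cid (geo_sums_to (tower_mode_le ^~ x)))) => x.
  exact: svalP (cid _).
have f1 x : `|f x| <= 1 / 8.
  by apply: le_trans (geo_sums_to_le (tower_mode_le ^~ x) (fE x)) _; lra.
have mode1 m x : mode_eval (l m) (x + 1) = mode_eval (l m) x.
  by rewrite !(tower_modes tow) addrAC !(tower_wave_int m 1).
have mmode m : measurable_fun [set: mR] (mode_eval (l m) : mR -> mR).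
  rewrite (_ : mode_eval _ = fun x => g m (x + alpha) - g m x).
    apply: measurable_funB; last exact: (tower_wave_borel m).1.
    exact: (bounded_borel_addr alpha (tower_wave_borel m)).1.
  by apply/funext => x; rewrite (tower_modes tow).
have mS M : measurable_fun [set: mR] (fun x : mR => series (fun m => mode_eval (l m) x) M : mR).
  elim: M => [|M IH].
    rewrite (_ : (fun x => _) = cst 0); first exact: measurable_cst.
    by apply/funext => x; rewrite /series/= big_geq.
  rewrite (_ : (fun x => _) = fun x => series (fun m => mode_eval (l m) x) M + mode_eval (l M) x).
    exact: measurable_funD IH (mmode M).
  by apply/funext => x; rewrite /series/= big_nat_recr.
have mf : measurable_fun [set: mR] (f : mR -> mR).
  by apply: (@measurable_fun_cvg _ _ _ setT (fun M (x : mR) => series (fun m => mode_eval (l m) x) M)) => // x _; exact: fE.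
have bf : bounded_borel f by split=> // x; apply: le_trans (f1 x) _; lra.
have fin01 := @lebesgue_itv_lty R 0 1.
have m01 : measurable (`[0, 1[ : set mR) by [].
have If : lam.-integrable `[0, 1[ (EFin \o f) by exact: bounded_borel_integrable.
have I1 : lam.-integrable `[0, 1[ (EFin \o (fun=> (1 : R))).
  apply: bounded_borel_integrable => //; split=> [|x]; [exact: measurable_cst|by rewrite normr1].
have IS M : lam.-integrable `[0, 1[ (EFin \o (fun x => series (fun m => mode_eval (l m) x) M)) /\
    \int[lam]_(x in `[0, 1[) (series (fun m => mode_eval (l m) x) M) = 0.
  have Ig m s : lam.-integrable `[0, 1[ (EFin \o (fun x => g m (x + s))).
    by apply: bounded_borel_integrable => //; exact: bounded_borel_addr (tower_wave_borel m).
  elim: M => [|M [I0 E0]].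
    rewrite (_ : (fun x => _) = fun=> 0); last by apply/funext => x; rewrite /series/= big_geq.
    by split; [exact: integrable0|rewrite Rintegral_cst// mul0r].
  have Ig' := Ig M alpha; have Ig0 := Ig M 0.
  have ID := integrableB m01 Ig' Ig0.
  have E : (fun x => series (fun m => mode_eval (l m) x) M.+1) =
      (fun x => series (fun m => mode_eval (l m) x) M + (g M (x + alpha) - g M (x + 0))).
    apply/funext => x; rewrite /series/= big_nat_recr//=; congr (_ + _).
    by rewrite (tower_modes tow) addr0.
  rewrite E; split; first exact: (integrableD m01 I0 ID).
  rewrite (RintegralD m01 I0 ID) E0 add0r (RintegralB m01 Ig' Ig0).
  rewrite -[X in X - _]/(window 1 (fun x => g M x) alpha) -[X in _ - X]/(window 1 (fun x => g M x) 0).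
  rewrite (window_periodic alpha (tower_wave_borel M)) ?subrr// => x; exact: (tower_wave_int M 1).
have Ef : \int[lam]_(x in `[0, 1[) f x = 0.
  apply/eqP; rewrite -normr_le0; apply/ler_addgt0Pr => e e0; rewrite add0r.
  have [M HM] : exists M : nat, e^-1 < 2 ^+ M.
    exists (Num.truncn e^-1).+1; apply: lt_trans (truncnS_gt _) _.
    by rewrite -natrX ltr_nat ltn_expl.
  have [IM EM] := IS M.
  rewrite (_ : \int[lam]_(x in `[0, 1[) f x =
      \int[lam]_(x in `[0, 1[) (f x - series (fun m => mode_eval (l m) x) M)); last first.
    by rewrite (RintegralB m01 If IM) EM subr0.
  apply: (@le_trans _ _ (2 * ((1 / 64) / 2 ^+ M))).
    apply: norm_Rintegral_01_le; first exact: (integrableB m01 If IM).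
    by move=> x; apply: geo_sums_to_tail (fE x) => m _; exact: tower_mode_le.
  have M0 : (0 : R) < 2 ^+ M by rewrite exprn_gt0.
  rewrite mulrA ler_pdivrMr//; move: HM; rewrite -[X in X < _]div1r ltr_pdivrMr// => HM.
  by rewrite mulrC; lra.
pose phi0 x := 1 + f x.
have phi1 x : phi0 (x + 1) = phi0 x.
  rewrite /phi0; congr (_ + _); apply: sums_to_unique (fE (x + 1)) _.
  by under eq_fun do rewrite mode1; exact: fE.
have phiB x : 7 / 8 <= phi0 x <= 9 / 8.
  by have := f1 x; rewrite ler_norml /phi0 => /andP[h1 h2]; lra.
have phi_gt0 x : 0 < phi0 x by have /andP[h _] := phiB x; apply: lt_le_trans h; lra.
have Iphi : lam.-integrable `[0, 1[ (EFin \o phi0) by exact: (integrableD m01 I1 If).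
have Ephi : (\int[lam]_(x in `[0%R, 1%R[) (phi0 x)%:E = 1)%E.
  have : \int[lam]_(x in `[0, 1[) phi0 x = 1.
    by rewrite (RintegralD m01 I1 If) Ef addr0 Rintegral_itv_1// subr0.
  rewrite /Rintegral => H; rewrite -[LHS]fineK ?H//.
  exact: integrable_fin_num Iphi.
exists (Ceiling phi1 phi_gt0 Iphi Ephi); split => //=.
  by apply: measurable_funD => //; exact: measurable_cst.
by move=> x; rewrite /phi0 addrC addKr.
Qed.

(** Along the [N m] iterates the sums over [phi] telescope; the stages before [m] do not see the
    shift [N m * alpha], the stages after [m] do not see the time [N m], and stage [m] is shifted
    by a quarter of its period. *)
Lemma tower_birkhoff (phi : ceiling R) m x :
  (forall x, sums_to (fun m => mode_eval (l m) x) (phi x - 1)) ->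
  `|birkhoff_sum alpha phi (N m) x - (N m)%:R
    - (G m ((q m)%:R * x + 1 / 4) - G m ((q m)%:R * x))| <= 3 / 2 ^+ m.
Proof.
move=> phiE; set h := (N m)%:R * alpha - (p m)%:~R.
pose D i := g i (x + h) - g i x.
have DE i : D i = \sum_(j < N m) mode_eval (l i) (x + j%:R * alpha).
  rewrite /D /h addrA (_ : x + (N m)%:R * alpha - (p m)%:~R = x + (N m)%:R * alpha + (- p m)%:~R); last by rewrite intrN.
  rewrite tower_wave_int -(big_mkord xpredT (fun j => mode_eval (l i) (x + j%:R * alpha))).
  rewrite (eq_bigr (fun j => g i (x + j.+1%:R * alpha) - g i (x + j%:R * alpha))).
    by rewrite (telescope_sumr (fun j => g i (x + j%:R * alpha)))// mul0r addr0.
  by move=> j _; rewrite (tower_modes tow) -natr1 mulrDl mul1r addrA.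
have DS : sums_to D (birkhoff_sum alpha phi (N m) x - (N m)%:R).
  rewrite (_ : D = fun i => \sum_(j < N m) mode_eval (l i) (x + j%:R * alpha)); last exact/funext.
  rewrite (_ : _ - _ = \sum_(j < N m) (phi (x + j%:R * alpha) - 1)).
    apply: (@sums_to_sum _ (N m) (fun j i => mode_eval (l i) (x + j%:R * alpha))
      (fun j => phi (x + j%:R * alpha) - 1)) => j; exact: phiE.
  by rewrite sumrB sumr_const card_ord.
have Dlate i : (m.+1 <= i)%N -> `|D i| <= (1 / 64) / 2 ^+ i.
  move=> mi; rewrite DE -tower_geo; apply: le_trans (tower_weight_late tow mi).
  apply: le_trans (ler_norm_sum _ _ _) _.
  rewrite (_ : _ * _ = \sum_(j < N m) mode_weight w (l i)); last by rewrite sumr_const card_ord mulr_natl.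
  apply: ler_sum => j _.
  exact: mode_eval_le.
have tail := geo_sums_to_tail Dlate DS.
have early := tower_early tow m x; have quarter := tower_quarter tow m x.
rewrite -/h in early quarter.
set B := birkhoff_sum _ _ _ _ - _ in tail *.
have E : series D m.+1 = \sum_(i < m) D i + D m by rewrite /series/= big_nat_recr//= big_mkord.
rewrite E in tail; rewrite -/(D _) in early.
have m0 : (0 : R) < (2 ^+ m)^-1 by rewrite invr_gt0 exprn_gt0.
have t2 : 2 * (1 / 64 / 2 ^+ m.+1) <= (2 ^+ m)^-1 :> R.
  by rewrite exprS invfM; lra.
rewrite exprVn in early quarter.
move: tail early quarter; rewrite /D.
set a := \sum_(i < m) _; set b := g m (x + h); set c := G m (_ + 1 / 4); set d := g m x.
rewrite !ler_norml => /andP[h1 h2] /andP[h3 h4] /andP[h5 h6]; apply/andP; split; lra.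
Qed.

(** Among eight equally spaced translates one falls, modulo the integers, in a given interval of
    length [1 / 8]. *)
Lemma eighth_window (z a : R) : exists (j : nat) (n : int),
  (j < 8)%N /\ a <= z + j%:R / 8 - n%:~R <= a + 1 / 8.
Proof.
pose F := Num.floor (8 * (z - a)).
have F1 : F%:~R <= 8 * (z - a) by exact: floor_le.
have F2 : 8 * (z - a) < F%:~R + 1 by have := floorD1_gt (8 * (z - a)); rewrite intrD.
pose j := `|((- F) %% 8)%Z|%N; pose n := ((- F) %/ 8)%Z.
have jE : (j%:Z = (- F) %% 8)%Z by rewrite /j gez0_abs// modz_ge0.
have FE : - F%:~R = n%:~R * 8 + j%:R :> R.
  rewrite -intrN {1}(divz_eq (- F) 8) intrD intrM -/n; congr (_ * _ + _).
  by rewrite -jE.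
exists j, (- n); split; last by rewrite intrN; apply/andP; split; lra.
by rewrite -ltz_nat jE ltz_pmod.
Qed.

(** By [tower_birkhoff] the excess of the sum over [N m] is [G m (z + 1/4) - G m z], where [z] is
    [q m * x].  It is close to [0] when [z] and [z + 1/4] are in the lower half of the step, and
    close to [1] when [z] is in the lower half and [z + 1/4] in the upper one; the shifts
    [j / (8 q m)] reach both cases. *)
Lemma split_returns_of_tower (phi : ceiling R) :
  (forall x, sums_to (fun m => mode_eval (l m) x) (phi x - 1)) -> split_returns alpha phi.
Proof.
move=> phiE e e0.
have [m m0 me] : exists2 m, (0 < m)%N & 4 / m%:R <= e.
  exists (Num.truncn (4 / e)).+1 => //; rewrite ler_pdivrMr// mulrC -ler_pdivrMr//.
  exact/ltW/truncnS_gt.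
have m0' : (0 : R) < m%:R by rewrite ltr0n.
have q0 : (0 : R) < (q m)%:R by rewrite ltr0n (tower_q_gt0 tow).
have qe : (q m)%:R^-1 <= e.
  apply: le_trans me; apply: (@le_trans _ _ m%:R^-1); last by rewrite ler_peMl ?invr_ge0//; lra.
  by rewrite lef_pV2 ?posrE// ler_nat (tower_q_ge tow).
have pe : 4 / 2 ^+ m <= e.
  apply: le_trans me; rewrite ler_wpM2l// lef_pV2 ?posrE ?exprn_gt0//.
  by rewrite -natrX ler_nat ltnW// ltn_expl.
pose em : R := (2 ^+ (m + 6))^-1.
have em0 : 0 < em by rewrite invr_gt0 exprn_gt0.
have em1 : em <= 1 / 64 * (2 ^+ m)^-1.
  by rewrite /em exprD invfM mulrC; apply: ler_wpM2r; [rewrite invr_ge0 exprn_ge0|lra].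
have m1 : (2 ^+ m)^-1 <= 1 :> R by rewrite invf_le1 ?exprn_gt0// exprn_ege1// ler1n.
exists (N m), (p m), ((N m)%:R * alpha - (p m)%:~R), (fun j => j%:R / 8 / (q m)%:R).
have move_window (x : R) (j : nat) : (q m)%:R * (x + j%:R / 8 / (q m)%:R) = (q m)%:R * x + j%:R / 8.
  by rewrite mulrDr; congr (_ + _); rewrite [LHS]mulrC divfK// gt_eqF.
have G_int z (n : int) : G m z = G m (z - n%:~R).
  by rewrite -intrN (periodic_int (tower_period tow m)).
split.
- by rewrite addrC subrK.
- exact: le_trans (tower_shift tow m) _.
- move=> j j8; apply: le_trans qe.
  rewrite ger0_norm; last by rewrite !divr_ge0// ltW.
  rewrite ler_piMl// ?invr_ge0 ?ltW//.
  by rewrite ltr_pdivrMr// mul1r ltr_nat.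
- move=> x; have [j [n [j8 /andP[z1 z2]]]] := eighth_window ((q m)%:R * x) (1 / 16).
  exists j => //; have := tower_birkhoff m (x + j%:R / 8 / (q m)%:R) phiE.
  rewrite move_window (G_int _ n) [G m ((q m)%:R * x + j%:R / 8)](G_int _ n).
  set z := _ + _ / 8 - n%:~R in z1 z2 *.
  rewrite (_ : (q m)%:R * x + j%:R / 8 + 1 / 4 - n%:~R = z + 1 / 4); last by rewrite /z; ring.
  have H1 : G m z <= em by apply: (tower_low tow); rewrite -/em; apply/andP; split; lra.
  have H2 : G m (z + 1 / 4) <= em by apply: (tower_low tow); rewrite -/em; apply/andP; split; lra.
  have /andP[p1 _] := tower_01 tow m z; have /andP[p2 _] := tower_01 tow m (z + 1 / 4).
  by rewrite !ler_norml => /andP[h1 h2]; apply/andP; split; lra.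
- move=> x; have [j [n [j8 /andP[z1 z2]]]] := eighth_window ((q m)%:R * x) (5 / 16).
  exists j => //; have := tower_birkhoff m (x + j%:R / 8 / (q m)%:R) phiE.
  rewrite move_window (G_int _ n) [G m ((q m)%:R * x + j%:R / 8)](G_int _ n).
  set z := _ + _ / 8 - n%:~R in z1 z2 *.
  rewrite (_ : (q m)%:R * x + j%:R / 8 + 1 / 4 - n%:~R = z + 1 / 4); last by rewrite /z; ring.
  have H1 : G m z <= em by apply: (tower_low tow); rewrite -/em; apply/andP; split; lra.
  have H2 : 1 - em <= G m (z + 1 / 4) by apply: (tower_high tow); rewrite -/em; apply/andP; split; lra.
  have /andP[p1 _] := tower_01 tow m z; have /andP[_ p2] := tower_01 tow m (z + 1 / 4).
  by rewrite -natr1 !ler_norml => /andP[h1 h2]; apply/andP; split; lra.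
Qed.

End fixed_tower.
End tower_ceiling.

(** * Every integer is an eigenvalue *)

Section tower_eigenfunctions.
Context {R : realType}.
Local Notation mR := (measurableTypeR R).
Local Notation lam := (@lebesgue_measure R).
Variables (w : R -> R) (alpha : R) (G : nat -> R -> R) (q : nat -> nat).
Variables (l : nat -> seq (R * R * R)) (N : nat -> nat) (p : nat -> int).
Hypothesis tow : tower w alpha G q l N p.
Hypothesis w1 : forall om, 0 <= om -> 1 <= w om.

Local Notation g m x := (G m ((q m)%:R * x)).

Definition tower_bit m x : bool := 1 / 2 < g m x.

(** The function [g m] takes mostly values close to [0] or [1]; [tower_bit] rounds it and
    [tower_rem] is what remains. *)
Definition tower_rem m x : R := g m x - (tower_bit m x)%:R.

(** Rounding is optimal: the comparison with an arbitrary bit [b] lets the bit of one point be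
    used at its neighbour on the orbit. *)
Lemma tower_rem_le m x (b : bool) : `|tower_rem m x| <= `|g m x - b%:R|.
Proof.
have /andP[g0 g1] := tower_01 tow m ((q m)%:R * x).
rewrite /tower_rem /tower_bit; case: ltP => gh; case: b => //=; rewrite ?subr0.
- by rewrite ler0_norm ?ger0_norm//; lra.
- by rewrite ger0_norm ?ler0_norm//; lra.
Qed.

Lemma measurable_tower_rem m : measurable_fun [set: mR] (tower_rem m : mR -> mR).
Proof.
have mg := (tower_wave_borel tow m).1.
apply: measurable_funB => //.
have mb : measurable_fun [set: mR] (fun x => tower_bit m x).
  by apply: measurable_fun_ltr => //; exact: measurable_cst.
rewrite (_ : (fun x => _) = fun x => if tower_bit m x then 1 else 0); last first.
  by apply/funext => x; case: tower_bit.
by apply: measurable_fun_ifT => //; exact: measurable_cst.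
Qed.

Lemma tower_rem_period m x : tower_rem m (x + 1) = tower_rem m x.
Proof. by rewrite /tower_rem /tower_bit !(tower_wave_int tow m 1). Qed.

(** The points where the series of the remainders converges absolutely, written with partial sums
    so that it is visibly a Borel set. *)
Definition tower_good : set R :=
  \bigcup_(K in [set: nat]) \bigcap_(n in [set: nat]) [set x | \sum_(0 <= m < n) `|tower_rem m x| <= K%:R].

Lemma measurable_tower_good : measurable (tower_good : set mR).
Proof.
apply: bigcup_measurable => K _; apply: bigcap_measurable; first by exists 0%N.
move=> n _; rewrite -[X in measurable X]setTI.
have : measurable_fun [set: mR] (fun x : mR => \sum_(0 <= m < n) `|tower_rem m x| : mR).
  by apply: measurable_sum => m; apply: measurableT_comp => //; exact: measurable_tower_rem.
move=> mf; rewrite (_ : [set x | _] = (fun x : mR => \sum_(0 <= m < n) `|tower_rem m x|) @^-1` `]-oo, K%:R]).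
  by apply: mf.
by apply/seteqP; split=> x; rewrite /= in_itv.
Qed.

Lemma tower_good_period x : tower_good (x + 1) <-> tower_good x.
Proof.
rewrite /tower_good; split=> -[K _ H]; exists K => // n _; have := H n I => /=.
- by under eq_bigr do rewrite tower_rem_period.
- by under [X in _ -> X <= _]eq_bigr do rewrite tower_rem_period.
Qed.

(** The remainders of [x] and of [x + alpha] differ by at most the coboundaries, which are
    summable. *)
Lemma tower_good_alpha x : tower_good (x + alpha) <-> tower_good x.
Proof.
have H y z : (forall m, `|tower_rem m y| <= `|tower_rem m z| + (1 / 64) / 2 ^+ m) ->
    tower_good z -> tower_good y.
  move=> yz [K _ zK]; exists K.+1 => // n _ /=.
  apply: (@le_trans _ _ (\sum_(0 <= m < n) `|tower_rem m z| + \sum_(0 <= m < n) (1 / 64) / 2 ^+ m)).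
    by rewrite -big_split/=; apply: ler_sum => m _.
  rewrite [leRHS](_ : _ = K%:R + 1); last by rewrite natr1.
  apply: lerD; first exact: zK.
  by apply: le_trans (geo_sum_le n _) _; lra.
split; apply: H => m.
- apply: le_trans (tower_rem_le m x (tower_bit m (x + alpha))) _.
  rewrite (_ : g m x - _ = tower_rem m (x + alpha) - mode_eval (l m) x).
    by apply: le_trans (ler_normB _ _) _; rewrite lerD2l (tower_mode_le tow).
  by rewrite (tower_modes tow) /tower_rem; ring.
- apply: le_trans (tower_rem_le m (x + alpha) (tower_bit m x)) _.
  rewrite (_ : g m (x + alpha) - _ = tower_rem m x + mode_eval (l m) x).
    by apply: le_trans (ler_normD _ _) _; rewrite lerD2l (tower_mode_le tow).
  by rewrite (tower_modes tow) /tower_rem; ring.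
Qed.

(** The transfer function: the divergent series of the functions [g m] converges on the good
    set after removal of the integers [tower_bit m x].  Its partial sums satisfy the
    cohomological equation up to an integer, and a limit of integers is an integer. *)
Lemma tower_transfer : exists theta : R -> R,
  [/\ measurable_fun [set: mR] (theta : mR -> mR),
      forall x, theta (x + 1) = theta x &
      forall x (phi : R), tower_good x -> sums_to (fun m => mode_eval (l m) x) (phi - 1) ->
        exists n : int, theta (x + alpha) = theta x + phi + n%:~R].
Proof.
have ex x : exists s, sums_to (fun m => \1_tower_good x * tower_rem m x) s.
  rewrite indicE; case: (boolP (x \in tower_good)) => [|_]; last first.
    by exists 0; under eq_fun do rewrite mul0r; exact: sums_to0.
  rewrite inE => -[K _ xK].
  suff : cvgn (series (fun m => 1 * tower_rem m x)) by move=> /cvg_ex[s us]; exists s.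
  under eq_fun do rewrite mul1r.
  apply: normed_cvg; apply: nondecreasing_is_cvgn.
    by apply: nondecreasing_series => // n _ _ /=.
  by exists K%:R => _ [n _ <-]; exact: xK.
have [theta thE] : exists theta : R -> R, forall x, sums_to (fun m => \1_tower_good x * tower_rem m x) (theta x).
  by exists (fun x => sval (cid (ex x))) => x; exact: svalP (cid _).
exists theta; split.
- apply: (@measurable_fun_cvg _ _ _ setT (fun M (x : mR) => series (fun m => \1_tower_good x * tower_rem m x) M)).
    move=> M; rewrite /series/=; apply: measurable_sum => m; apply: measurable_funM.
      by apply: measurable_indic; exact: measurable_tower_good.
    exact: measurable_tower_rem.
  by move=> x _; exact: thE.
- move=> x; apply: sums_to_unique (thE (x + 1)) _.
  rewrite (_ : (fun m => _) = fun m => \1_tower_good x * tower_rem m x) //.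
  apply/funext => m; rewrite tower_rem_period; congr (_ * _); rewrite !indicE; congr (_%:R).
  by congr nat_of_bool; apply/idP/idP; rewrite !inE => /tower_good_period.
- move=> x phi gx phiE.
  have th x' : tower_good x' -> sums_to (fun m => tower_rem m x') (theta x').
    move=> gx'; rewrite (_ : (fun m => _) = fun m => \1_tower_good x' * tower_rem m x') //.
    by apply/funext => m; rewrite indicE mem_set// mul1r.
  have D := sums_toB (sums_toB (th _ ((tower_good_alpha x).2 gx)) (th _ gx)) phiE.
  set L := _ - (phi - 1) in D.
  (* the integrality of the limit [L] is read off the continuous function [cos (2 pi _)] *)
  have cL : cos (2 * pi * L) = 1.
    have : (fun M => cos (2 * pi * series (fun m => tower_rem m (x + alpha) - tower_rem m x - mode_eval (l m) x) M)) @ \oo --> cos (2 * pi * L).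
      apply: continuous_cvg; first exact: continuous_cos.
      by apply: cvgMr.
    rewrite (_ : (fun M => _) = fun=> 1); first by move/cvg_lim => <-//; rewrite lim_cst.
    apply/funext => M.
    have [n ->] : exists n : int, series (fun m => tower_rem m (x + alpha) - tower_rem m x - mode_eval (l m) x) M = n%:~R.
      elim: M => [|M [n IH]]; first by exists 0; rewrite /series/= big_geq.
      exists (n + (tower_bit M x)%:Z - (tower_bit M (x + alpha))%:Z).
      rewrite /series/= big_nat_recr//= -[X in X + _]/(series _ M) IH (tower_modes tow) /tower_rem.
      by rewrite intrD intrN intrD; ring.
    by rewrite mulrC -[_ * _]add0r cosDn2pi cos0.
  have [n nE] := cos_2pi_eq1 cL.
  by exists (n - 1); rewrite intrB -nE /L; ring.
Qed.

(** [tower_rem m] exceeds [2 ^- (m + 6)] only when [q m * x] is that close to a multiple of [1 / 2].  On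
    the unit interval this excludes [2 * q m + 1] intervals, of total length at most six times
    that bound; summed over [m] the exclusions leave a set of positive measure. *)
Lemma tower_good_positive : ~ {ae lam, forall x : R, 0 <= x < 1 -> ~ tower_good x}.
Proof.
pose e m : R := (2 ^+ (m + 6))^-1.
have e0 m : 0 < e m by rewrite invr_gt0 exprn_gt0.
have q0 m : (0 : R) < (q m)%:R by rewrite ltr0n (tower_q_gt0 tow).
have q1 m : (1 : R) <= (q m)%:R by rewrite ler1n (tower_q_gt0 tow).
pose I m (k : nat) : set R := `](k%:R / 2 - e m) / (q m)%:R, (k%:R / 2 + e m) / (q m)%:R[%classic.
pose C m : set R := \big[setU/set0]_(k < (2 * q m).+1) I m k.
have mI m k : measurable (I m k : set mR) by rewrite /I; exact: measurable_itv.
have mC m : measurable (C m : set mR) by apply: bigsetU_measurable => k _.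
have lamI m k : lam (I m k) = (2 * e m / (q m)%:R)%:E.
  rewrite lebesgue_measure_itv/= lte_fin ltr_pM2r ?invr_gt0//.
  by rewrite ifT; [rewrite -EFinB; congr (_%:E); ring|have := e0 m; lra].
have lamC m : (lam (C m) <= (6 * e m)%:E)%E.
  have /le_trans := @content_subadditive _ _ _ lam (C m) (I m) (2 * q m).+1 (fun k _ => mI m k) (mC m) (@subset_refl _ _).
  apply.
  rewrite (eq_bigr (fun=> (2 * e m / (q m)%:R)%:E)); last by move=> k _; exact: lamI.
  rewrite sumEFin sumr_const card_ord lee_fin -[leLHS]mulr_natl mulrA ler_pdivrMr//.
  by have := e0 m; have := q1 m; rewrite -natr1 natrM; nra.
have small m x : 0 <= x < 1 -> ~ C m x -> `|tower_rem m x| <= e m.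
  move=> /andP[x0 x1] nC; set z := (q m)%:R * x; have z0 : 0 <= z by rewrite mulr_ge0.
  have zq : z < (q m)%:R by rewrite /z -[ltRHS]mulr1 ltr_pM2l.
  have far k : (k < (2 * q m).+1)%N -> e m <= `|z - k%:R / 2|.
    move=> kq; rewrite leNgt; apply/negP => zk; apply: nC; rewrite /C -bigcup_mkord.
    exists k => //; rewrite /I /= in_itv/= ltr_pdivrMr// ltr_pdivlMr// [x * _]mulrC -/z.
    by move: zk; rewrite ltr_norml => /andP[h1 h2]; apply/andP; split; lra.
  pose a := Num.truncn z; have /andP[a1 a2] := truncn_itv z0.
  have aq : (a < q m)%N by rewrite -(ltr_nat R); exact: le_lt_trans a1 zq.
  rewrite -/a -natr1 in a1 a2; pose u := z - a%:R.
  have gE : G m z = G m u by rewrite /u -[a%:R]/((a%:Z)%:~R) -intrN (periodic_int (tower_period tow m)).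
  have := far (2 * a)%N; rewrite ltnS leq_mul2l ltnW// => /(_ isT).
  have := far (2 * a).+1; rewrite ltnS ltn_mul2l/= aq => /(_ isT).
  have := far (2 * a).+2; rewrite ltnS -[(2 * a).+2]addn2 -[X in (_ + X)%N]/(2 * 1)%N -mulnDr addn1 leq_mul2l/= aq => /(_ isT).
  rewrite -(natr1 (2 * a)) !natrM -(natr1 a).
  rewrite (_ : z - 2 * (a%:R + 1) / 2 = u - 1); last by rewrite /u; field.
  rewrite (_ : z - (2 * a%:R + 1) / 2 = u - 1 / 2); last by rewrite /u; field.
  rewrite (_ : z - 2 * a%:R / 2 = u); last by rewrite /u; field.
  have u0 : 0 <= u by rewrite /u; lra.
  have u1 : u < 1 by rewrite /u; lra.
  rewrite (ler0_norm (_ : u - 1 <= 0)) ?(ger0_norm u0); last by lra.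
  move=> h1 h2 h3; have /andP[G0 G1] := tower_01 tow m u.
  have [uh|uh] := lerP u (1 / 2).
  - rewrite ler0_norm in h2; last by lra.
    apply: le_trans (tower_rem_le m x false) _; rewrite -/z gE subr0 ger0_norm//.
    by apply: (tower_low tow); rewrite -/(e m); apply/andP; split; lra.
  - rewrite ger0_norm in h2; last by lra.
    apply: le_trans (tower_rem_le m x true) _; rewrite -/z gE ler0_norm; last by rewrite /=; lra.
    suff : 1 - e m <= G m u by rewrite /=; lra.
    by apply: (tower_high tow); rewrite -/(e m); apply/andP; split; lra.
move=> [Z [mZ Z0 HZ]].
have cover : `[0, 1[%classic `<=` Z `|` \bigcup_m C m.
  move=> x /=; rewrite in_itv/= => x01; apply: contrapT => /not_orP[nZ nC].
  apply: nZ; apply: HZ => /= /(_ x01); apply; exists 1%N => // n _ /=.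
  apply: (@le_trans _ _ (\sum_(0 <= m < n) (1 / 64) / 2 ^+ m)).
    apply: ler_sum => m _; apply: le_trans (small m x x01 _) _.
      by move=> Cm; apply: nC; exists m.
    by rewrite /e -exprVn tower_geo.
  by apply: le_trans (geo_sum_le n _) _; lra.
have mU : measurable (\bigcup_m C m : set mR) by apply: bigcup_measurable => m _; exact: mC.
have : (lam `[0%R, 1%R[%classic <= lam Z + lam (\bigcup_m C m))%E.
  apply: (@le_trans _ _ (lam (Z `|` \bigcup_m C m))); last exact: measureU2.
  by apply: le_measure => //; rewrite inE//; exact: measurableU.
rewrite Z0 add0e lebesgue_measure_itv/= lte_fin ltr01 -EFinB subr0.
apply/negP; rewrite -ltNge.
have /le_lt_trans := @measure_sigma_subadditive _ _ _ lam (\bigcup_m C m) C mC mU (@subset_refl _ _).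
apply.
apply: (@le_lt_trans _ _ (1 / 2)%:E); last by rewrite lte_fin; lra.
apply: lime_le; first exact: is_cvg_nneseries.
apply: nearW => n; apply: (@le_trans _ _ (\sum_(0 <= m < n) ((6 / 64) / 2 ^+ m)%:E)%E).
  apply: lee_sum => m _; apply: le_trans (lamC m) _.
  rewrite lee_fin /e -exprVn tower_geo.
  by move: ((2 ^+ m)^-1 : R) => d; lra.
by rewrite sumEFin lee_fin; apply: le_trans (geo_sum_le n _) _; lra.
Qed.

(** On the good set the function [exp (2 i pi n (theta x + y))] is compatible with the roof
    relation, because [theta] solves the cohomological equation modulo the integers and [n] is
    an integer.  It is extended by zero. *)
Lemma tower_eigenvalue_int (phi : ceiling R) (n : int) :
  (forall x, 1 / 2 <= phi x) ->
  (forall x, sums_to (fun m => mode_eval (l m) x) (phi x - 1)) -> Defs.eigenvalue alpha phi n%:~R.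
Proof.
move=> phi_lb phiE; have [theta [mth th1 tha]] := tower_transfer.
pose A (z : R * R) := 2 * pi * n%:~R * (theta z.1 + z.2).
pose F (z : R * R) : R[i] := (\1_tower_good z.1 * cos (A z) +i* (\1_tower_good z.1 * sin (A z)))%C.
have ind1 x : \1_tower_good (x + 1) = \1_tower_good x :> R.
  by rewrite !indicE; congr (_%:R); congr nat_of_bool; apply/idP/idP; rewrite !inE => /tower_good_period.
have inda x : \1_tower_good (x + alpha) = \1_tower_good x :> R.
  by rewrite !indicE; congr (_%:R); congr nat_of_bool; apply/idP/idP; rewrite !inE => /tower_good_alpha.
have F1 x y : F (x + 1, y) = F (x, y) by rewrite /F /A /= ind1 th1.
have Fa x y : F (x + alpha, y) = F (x, y + phi x).
  rewrite /F /A /= inda indicE; case: (boolP (x \in tower_good)) => [|_]; last by rewrite !mul0r.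
  rewrite inE => gx; have [k ->] := tha x (phi x) gx (phiE x).
  rewrite (_ : 2 * pi * n%:~R * _ = 2 * pi * n%:~R * (theta x + (y + phi x)) + (n * k)%:~R * (2 * pi)).
    by rewrite cosDn2pi sinDn2pi.
  by rewrite intrM; ring.
have mA : measurable_fun [set: mR * mR] (A : mR * mR -> mR).
  apply: (measurable_funM (f := cst _)); first exact: measurable_cst.
  apply: measurable_funD; last exact: measurable_snd.
  exact: measurableT_comp mth measurable_fst.
have mind : measurable_fun [set: mR * mR] (fun z : mR * mR => \1_tower_good z.1 : mR).
  by apply: measurableT_comp measurable_fst; apply: measurable_indic; exact: measurable_tower_good.
exists (special_lift F); split.
- split.
  + apply: (@measurable_special_lift _ alpha phi (fun z => complex.Re (F z))).
    * by move=> x y; rewrite F1.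
    * by move=> x y; rewrite Fa.
    * apply: measurable_funM => //; apply: measurableT_comp mA.
      by apply: continuous_measurable_fun; exact: continuous_cos.
  + apply: (@measurable_special_lift _ alpha phi (fun z => complex.Im (F z))).
    * by move=> x y; rewrite F1.
    * by move=> x y; rewrite Fa.
    * apply: measurable_funM => //; apply: measurableT_comp mA.
      by apply: continuous_measurable_fun; exact: continuous_sin.
- move=> /ae_special_domain F0; apply: tower_good_positive; apply: ae_imp F0 => x F0 x01 gx.
  have : {ae lam, forall y : R, ~ (0 <= y < 1 / 2)}.
    apply: ae_imp F0 => y /(_ x01) F0 /andP[y0 y1].
    have : special_lift F (special_pi alpha phi (x, y)) = 0.
      by apply: F0; rewrite y0/=; apply: lt_le_trans y1 (phi_lb x).
    rewrite special_liftE// /F /= indicE mem_set// !mul1r => -[c0 s0].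
    by have := cos2Dsin2 (A (x, y)); rewrite c0 s0 !expr0n/= addr0 => /eqP; rewrite eq_sym oner_eq0.
  move=> [Z [mZ Z0 HZ]].
  have : (lam `[0%R, (1 / 2)%R[%classic <= lam Z)%E.
    by apply: le_measure; rewrite ?inE// => y /=; rewrite in_itv/= => yh; apply: HZ => /=; apply.
  by rewrite Z0 lebesgue_measure_itv/= lte_fin ifT ?lee_fin; lra.
- move=> s; apply: aeW => u; have [[x y] ->] := special_pi_repr u.
  rewrite special_flowE !special_liftE// /F /= (_ : A (x, y + s) = 2 * pi * n%:~R * s + A (x, y)); last first.
    by rewrite /A /=; ring.
  rewrite cosD sinD /cis; apply/eqP; rewrite eq_complex /=.
  by apply/andP; split; apply/eqP; ring.
Qed.

End tower_eigenfunctions.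

(** * The spectrum is not purely discrete *)

Section cmeasurable.
Context {R : realType} (alpha : R) (phi : ceiling R).
Local Notation X := (special_space alpha phi).
Local Notation mu := (special_measure alpha phi).
Local Notation mR := (measurableTypeR R).

Lemma cmeasurableB (F G : X -> R[i]) : cmeasurable F -> cmeasurable G ->
  cmeasurable (fun u => F u - G u).
Proof.
move=> [F1 F2] [G1 G2]; split.
- rewrite (_ : (fun u => _) = fun u => complex.Re (F u) - complex.Re (G u)); first exact: measurable_funB.
  by apply/funext => u; case: (F u) => ? ?; case: (G u).
- rewrite (_ : (fun u => _) = fun u => complex.Im (F u) - complex.Im (G u)); first exact: measurable_funB.
  by apply/funext => u; case: (F u) => ? ?; case: (G u).
Qed.

Lemma cmeasurable_lincomb n (c : 'I_n -> R[i]) (F : 'I_n -> X -> R[i]) :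
  (forall i, cmeasurable (F i)) -> cmeasurable (fun u => \sum_(i < n) c i * F i u).
Proof.
elim: n c F => [|n IH] c F mF.
  rewrite (_ : (fun u => _) = fun=> 0); first by split; exact: measurable_cst.
  by apply/funext => u; rewrite big_ord0.
have [H1 H2] := IH (c \o widen_ord (leqnSn n)) (F \o widen_ord (leqnSn n)) (fun i => mF _).
have [M1 M2] := mF ord_max.
have mc (r : R) (h : X -> mR) : measurable_fun [set: X] h -> measurable_fun [set: X] (fun u => r * h u : mR).
  by move=> mh; apply: (measurable_funM (f := cst r)) => //; exact: measurable_cst.
split.
- rewrite (_ : (fun u => _) = fun u => complex.Re (\sum_(i < n) (c \o widen_ord (leqnSn n)) i * (F \o widen_ord (leqnSn n)) i u)
     + (complex.Re (c ord_max) * complex.Re (F ord_max u) - complex.Im (c ord_max) * complex.Im (F ord_max u))).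
    by apply: measurable_funD => //; apply: measurable_funB; exact: mc.
  apply/funext => u; rewrite big_ord_recr /=; set z := \sum_(i < n) _.
  by case: z => ? ?; case: (c ord_max) => ? ?; case: (F ord_max u).
- rewrite (_ : (fun u => _) = fun u => complex.Im (\sum_(i < n) (c \o widen_ord (leqnSn n)) i * (F \o widen_ord (leqnSn n)) i u)
     + (complex.Re (c ord_max) * complex.Im (F ord_max u) + complex.Im (c ord_max) * complex.Re (F ord_max u))).
    by apply: measurable_funD => //; apply: measurable_funD; exact: mc.
  apply/funext => u; rewrite big_ord_recr /=; set z := \sum_(i < n) _.
  by case: z => ? ?; case: (c ord_max) => ? ?; case: (F ord_max u).
Qed.

Lemma measurable_normc (F : X -> R[i]) : cmeasurable F ->
  measurable_fun [set: X] (fun u => Normc.normc (F u) : mR).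
Proof.
move=> [F1 F2]; rewrite (_ : (fun u => _) = Num.sqrt \o (fun u => complex.Re (F u) ^+ 2 + complex.Im (F u) ^+ 2)).
  apply: measurableT_comp; first by apply: continuous_measurable_fun; exact: sqrt_continuous.
  by apply: measurable_funD; exact: measurable_funX.
by apply/funext => u /=; case: (F u).
Qed.

Lemma normc_ge0 (z : R[i]) : 0 <= Normc.normc z.
Proof. by case: z => a b; exact: sqrtr_ge0. Qed.

(** Chebyshev's inequality at level [1 / 2]. *)
Lemma L2norm_markov (F : X -> R[i]) (e : R) : cmeasurable F -> 0 < e -> (L2norm F < e%:E)%E ->
  (mu [set u | (1 / 2 <= Normc.normc (F u))%R] <= (4 * e ^+ 2)%:E)%E.
Proof.
move=> mF e0 Fe; have mn := measurable_normc mF.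
have E : (\int[mu]_u ((Normc.normc (F u) ^+ 2)%:E) < (e ^+ 2)%:E)%E.
  rewrite (_ : (\int[mu]_u _ = L2norm F `^ 2)%E); last first.
    rewrite /L2norm poweR_Lnorm ?pnatr_eq0//; apply: eq_integral => u _.
    by rewrite abse_EFin poweR_EFin ger0_norm ?normc_ge0// powR_mulrn ?normc_ge0.
  have := Lnorm_ge0 mu 2%:E (fun u => (Normc.normc (F u))%:E); rewrite -/(L2norm F).
  move: Fe; case: (L2norm F) => [r| |]//; rewrite !lte_fin lee_fin => re r0.
  by rewrite powR_mulrn// ltrXn2r.
have m2 : measurable_fun [set: X] (fun u => (Normc.normc (F u) ^+ 2)%:E).
  by apply/measurable_EFinP; exact: measurable_funX.
have q0 : 0 < 1 / 4 :> R by lra.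
have := le_integral_abse mu measurableT m2 q0.
rewrite (eq_integral (fun u => (Normc.normc (F u) ^+ 2)%:E)); last first.
  by move=> u _; rewrite abse_EFin ger0_norm ?exprn_ge0 ?normc_ge0.
rewrite (_ : _ `&` _ = [set u | (1 / 2 <= Normc.normc (F u))%R]).
  move=> /le_lt_trans - /(_ _ E).
  have K (M : \bar R) : ((1 / 4)%:E * M < (e ^+ 2)%:E -> M <= (4 * e ^+ 2)%:E)%E.
    case: M => [r| |]//=; last by rewrite leNye.
      by rewrite -EFinM lte_fin lee_fin; lra.
    by rewrite mulry gtr0_sg// mul1e ltNge leey.
  exact: K.
have nn u := normc_ge0 (F u).
rewrite setTI; apply/seteqP; split => u /=; rewrite lee_fin ger0_norm ?exprn_ge0// => h.
- by have := nn u; nra.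
- by have := nn u; nra.
Qed.

End cmeasurable.

Section time_one.
Context {R : realType} (alpha : R) (phi : ceiling R).
Local Notation X := (special_space alpha phi).
Local Notation mu := (special_measure alpha phi).
Local Notation mR := (measurableTypeR R).
Local Notation lam := (@lebesgue_measure R).
Local Notation lam2 := (@lebesgue_measure R \x @lebesgue_measure R)%E.
Local Notation pr x y := (special_pi alpha phi (x, y)).

(** The rectangle [0, e[ x [1/5, 3/10[ is measured slice by slice: a slice lies in [B] up to a
    part whose vertical translate lies in the slice of [B] over [x + a0].  Integrating over [x]
    counts the measure of [B] at most twice. *)
Lemma rectangle_image_measure (B : set X) (a0 e : R) : measurable B -> 0 < e ->
  (forall x y, 0 <= x < e -> 1 / 5 <= y < 3 / 10 -> [/\ 0 <= x < 1, 0 <= y < phi x,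
     0 <= x + a0 < 1 & 0 <= y + (1 - phi x) < phi (x + a0)]) ->
  {ae lam, forall x : R, {ae lam, forall y : R, 0 <= x < e -> 1 / 5 <= y < 3 / 10 ->
     B (pr x y) \/ B (pr (x + a0) (y + (1 - phi x)))}} ->
  ((e / 20)%:E <= mu B)%E.
Proof.
move=> mB e0 dom H.
have mB' : measurable (special_pi alpha phi @^-1` B : set (mR * mR)) by exact: mB.
have mN := measurableI _ _ mB' (measurable_special_domain phi).
rewrite special_measureE; set Nn := _ `&` _ in mN *.
pose I x := lam (xsection Nn x).
have mI : measurable_fun [set: mR] (I : mR -> \bar R) by exact: measurable_fun_xsection.
have I0 x : (0 <= I x)%E by exact: measure_ge0.
have -> : lam2 Nn = (\int[lam]_x I x)%E by [].
have low : {ae lam, forall x : R, 0 <= x < e -> ((1 / 10)%:E <= I x + I (x + a0)%R)%E}.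
  apply: ae_imp H => x [Z [mZ Z0 HZ]] xe.
  pose T : set R := (fun y => y + (1 - phi x)) @^-1` xsection Nn (x + a0).
  have mS : measurable (xsection Nn x : set mR) by exact: measurable_xsection.
  have mS' : measurable (xsection Nn (x + a0) : set mR) by exact: measurable_xsection.
  have mT : measurable (T : set mR).
    by have := measurable_addr (1 - phi x) measurableT mS'; rewrite setTI.
  have <- : lam T = I (x + a0) by exact: lebesgue_measure_translation.
  have cover : `[1 / 5, 3 / 10[%classic `<=` (xsection Nn x `|` T) `|` Z.
    move=> y /=; rewrite in_itv/= => yI; apply: contrapT => /not_orP[/not_orP[n1 n2] nZ].
    apply: nZ; apply: HZ => /= /(_ xe yI).
    have [d1 d2 d3 d4] := dom x y xe yI.
    by case=> By; [apply: n1|apply: n2]; rewrite /T /= /xsection/= inE; split.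
  have -> : (1 / 10)%:E = lam `[(1 / 5 : R), (3 / 10 : R)[%classic :> \bar R.
    rewrite lebesgue_measure_itv/= lte_fin ifT; last by lra.
    by rewrite -EFinB; congr (_%:E); field.
  apply: (@le_trans _ _ (lam ((xsection Nn x `|` T) `|` Z))).
    apply: le_measure => //; rewrite inE//.
    exact: (measurableU _ _ (measurableU _ _ mS mT) mZ).
  have U1 : (lam ((xsection Nn x `|` T) `|` Z) <= lam (xsection Nn x `|` T) + lam Z)%E.
    by apply: measureU2 => //; exact: measurableU.
  have U2 : (lam (xsection Nn x `|` T) <= lam (xsection Nn x) + lam T)%E by exact: measureU2.
  by apply: le_trans U1 _; rewrite Z0 adde0.
have mI' : measurable_fun [set: mR] (fun x : mR => I (x + a0)).
  exact: measurableT_comp mI (measurable_addr a0).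
have II : (\int[lam]_x I (x + a0)%R = \int[lam]_x I x)%E.
  by have := ge0_integral_translation a0 measurableT mI (fun x _ => I0 x); rewrite preimage_setT.
have me : measurable (`[0, e[%classic : set mR) by [].
have J : ((e / 10)%:E <= \int[lam]_x I x + \int[lam]_x I x)%E.
  apply: (@le_trans _ _ (\int[lam]_(x in `[0%R, e[) (I x + I (x + a0)%R))%E).
    apply: (@le_trans _ _ (\int[lam]_(x in `[0%R, e[) (1 / 10)%:E)%E).
      have -> : (\int[lam]_(x in `[0%R, e[) (1 / 10)%:E = (1 / 10)%:E * lam `[0%R, e[%classic)%E.
        exact: integral_cst.
      by rewrite lebesgue_measure_itv/= lte_fin e0 -EFinB subr0 -EFinM lee_fin; lra.
    have mII : measurable_fun `[0, e[%classic (fun x : mR => (I x + I (x + a0)%R)%E).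
      by apply: (measurable_funS (E := setT)) => //; exact: emeasurable_funD.
    have II0 x : `[0, e[%classic x -> (0 <= I x + I (x + a0)%R)%E by move=> _; rewrite adde_ge0.
    have low' : {ae lam, forall x, `[0, e[%classic x -> ((1 / 10)%:E <= I x + I (x + a0)%R)%E}.
      by apply: ae_imp low => x H1; rewrite /= in_itv.
    by apply: ae_ge0_le_integral low' => // x _; rewrite lee_fin; lra.
  rewrite ge0_integralD//; try by apply: measurable_funS measurableT _ _.
  apply: leeD; first exact: ge0_subset_integral.
  by rewrite -II; apply: ge0_subset_integral.
have : (0 <= \int[lam]_x I x)%E by exact: integral_ge0.
case: (\int[lam]_x I x)%E J => [r| |]//=; first by rewrite -EFinD !lee_fin; lra.
all: by rewrite ?leey ?leeNy_eq.
Qed.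


Hypothesis phi_bounds : forall x, 7 / 8 <= phi x <= 9 / 8.
Hypothesis mphi : measurable_fun [set: mR] (phi : mR -> mR).

Let S (z : R * R) : R * R := (z.1 + alpha, z.2 - phi z.1).
Let S' (z : R * R) : R * R := (z.1 - alpha, z.2 + phi (z.1 - alpha)).

Let SK z : S' (S z) = z.
Proof. by case: z => x y; rewrite /S' /S /= addrK subrK. Qed.

Let rectangle (e : R) : set (R * R) :=
  [set z : R * R | exists2 j : int, 0 <= z.1 + j%:~R < e & 1 / 5 <= z.2 <= 3 / 10].

(** The points of the plane whose class meets the rectangle [0, e[ x [1/5, 3/10]. *)
Definition rectangle_orbits (e : R) : set (R * R) :=
  [set z | exists n, rectangle e (iter n S z) \/ rectangle e (iter n S' z)].

Lemma rectangle_orbits_roof e x y :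
  rectangle_orbits e (x + alpha, y) <-> rectangle_orbits e (x, y + phi x).
Proof.
have -> : (x + alpha, y) = S (x, y + phi x) by rewrite /S /= addrK.
move: (x, y + phi x) => z; rewrite /rectangle_orbits; split=> -[n [|]].
- by exists n.+1; left; rewrite iterSr.
- case: n => [|n]; first by exists 1%N; left.
  by rewrite iterSr SK; exists n; right.
- case: n => [|n]; first by move=> zA; exists 1%N; right; suff : rectangle e (S' (S z)) by []; rewrite SK.
  by rewrite iterSr; exists n; left.
- by exists n.+1; right; rewrite iterSr SK.
Qed.

Lemma rectangle_orbits_period e x y : rectangle_orbits e (x + 1, y) <-> rectangle_orbits e (x, y).
Proof.
have phi1 x' : phi (x' + 1) = phi x' by exact: ceiling_periodic.
have E n : iter n S (x + 1, y) = ((iter n S (x, y)).1 + 1, (iter n S (x, y)).2).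
  by elim: n => //= n ->; rewrite /S /= phi1 addrAC.
have E' n : iter n S' (x + 1, y) = ((iter n S' (x, y)).1 + 1, (iter n S' (x, y)).2).
  by elim: n => //= n ->; rewrite /S' /= addrAC phi1.
rewrite /rectangle_orbits; split=> -[n H]; exists n; move: H; rewrite E E' /=.
- by move=> [[j jH]|[j jH]]; [left|right]; exists (1 + j) => //; rewrite intrD addrA.
- by move=> [[j jH]|[j jH]]; [left|right]; exists (j - 1) => //; rewrite intrB; move: jH;
    rewrite addrACA subrr addr0.
Qed.

Lemma measurable_rectangle_orbits e : measurable (rectangle_orbits e : set (mR * mR)).
Proof.
set A : set (mR * mR) := rectangle e.
have mA : measurable A.
  rewrite (_ : A = \bigcup_(j : int) (`[- j%:~R, e - j%:~R[%classic `*` `[1 / 5, 3 / 10]%classic)).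
    by apply: countable_bigcupT_measurable => // j; exact: measurableX.
  apply/seteqP; split=> [z [j h1 h2]|z [j _ [/= h1 h2]]]; exists j => //; last first.
    by move: h1; rewrite in_itv/= => /andP[h3 h4]; apply/andP; split; lra.
  by split; rewrite /= in_itv/=//; move/andP: h1 => [h3 h4]; apply/andP; split; lra.
have mS : measurable_fun [set: mR * mR] (S : mR * mR -> mR * mR).
  apply: measurable_fun_pair.
    exact: measurableT_comp (measurable_addr alpha) measurable_fst.
  by apply: measurable_funB; [exact: measurable_snd|exact: measurableT_comp mphi measurable_fst].
have mS' : measurable_fun [set: mR * mR] (S' : mR * mR -> mR * mR).
  have mf : measurable_fun [set: mR * mR] (fun z : mR * mR => z.1 - alpha : mR).
    exact: measurableT_comp (measurable_addr (- alpha)) measurable_fst.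
  apply: measurable_fun_pair => //.
  by apply: measurable_funD; [exact: measurable_snd|exact: measurableT_comp mphi mf].
have mit (f : mR * mR -> mR * mR) n : measurable_fun setT f -> measurable_fun setT (iter n f).
  move=> mf; elim: n => [|n IH]; first exact: measurable_id.
  exact: (measurableT_comp mf IH).
rewrite (_ : rectangle_orbits e = \bigcup_n ((iter n S @^-1` A) `|` (iter n S' @^-1` A))).
  apply: bigcup_measurable => n _; apply: measurableU.
    by have := mit S n mS measurableT _ mA; rewrite setTI.
  by have := mit S' n mS' measurableT _ mA; rewrite setTI.
by apply/seteqP; split => z [n]; [exists n|exists n].
Qed.

(** The time-one map moves the rectangle off itself: it translates the base by [alpha], and
    the returns to the base after the first one are too low. *)
Lemma rectangle_orbits_time_one e a0 (k : int) x y : alpha = a0 + k%:~R ->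
  e <= a0 -> e <= 1 - a0 -> 0 <= x < e -> 1 / 5 <= y < 3 / 10 -> ~ rectangle_orbits e (x, y + 1).
Proof.
move=> aE e1 e2 /andP[x0 xe] /andP[y1 y2] [n H].
have low m z : (iter m S z).2 <= z.2 - m%:R * (7 / 8).
  elim: m => [|m IH] /=; first by rewrite mul0r subr0.
  by have /andP[h _] := phi_bounds (iter m S z).1; rewrite -natr1; lra.
have high m z : z.2 <= (iter m S' z).2.
  elim: m => //= m IH.
  by have /andP[h _] := phi_bounds ((iter m S' z).1 - alpha); lra.
case: H => -[j j1 /andP[j2 j3]]; last by have := high n (x, y + 1) => /=; lra.
case: n j1 j2 j3 => [|[|n]] /=; first by move=> *; lra.
- move=> /andP[h1 h2] _ _.
  have k1 : 0 < (k + j + 1)%:~R :> R by rewrite !intrD; lra.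
  have k2 : (k + j)%:~R < 0 :> R by rewrite intrD; lra.
  rewrite ltr0z gtz0_ge1 lerDr in k1; rewrite ltrz0 in k2.
  by move: (le_lt_trans k1 k2); rewrite ltxx.
- move=> _ h _; have := low n.+2 (x, y + 1); rewrite /= -[n.+2%:R]natr1 -[n.+1%:R]natr1.
  by have : (0 : R) <= n%:R by []; lra.
Qed.

Lemma special_measure_fin : (mu [set: X] < +oo)%E.
Proof.
rewrite special_measureE preimage_setT setTI.
have m1 : measurable (`[0, 1[%classic : set mR) by [].
have m2 : measurable (`[0, 2[%classic : set mR) by [].
apply: (@le_lt_trans _ _ (lam2 (`[0, 1[%classic `*` `[0, 2[%classic))).
  apply: le_measure; rewrite ?inE//; [exact: measurable_special_domain|exact: measurableX|].
  move=> [x y] [/= h1 /andP[h2 h3]]; split; rewrite /= in_itv//= h2/=.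
  by apply: lt_le_trans h3 _; have /andP[_ h] := phi_bounds x; lra.
have -> : lam2 (`[0, 1[%classic `*` `[0, 2[%classic) = (lam `[0%R, 1%R[%classic * lam `[0%R, 2%R[%classic)%E.
  exact: product_measure1E.
rewrite !lebesgue_measure_itv/= !lte_fin ltr01 ltr0n/=.
by rewrite -!EFinB -EFinM ltry.
Qed.

(** If all eigenvalues are integers, every eigenfunction is invariant under the time-one map;
    but the indicator of a small rectangle is far from all invariant functions. *)
Lemma int_eigenvalues_not_purely_discrete : irrational alpha ->
  (forall t, Defs.eigenvalue alpha phi t -> exists n : int, t = n%:~R) ->
  ~ purely_discrete_spectrum alpha phi.
Proof.
move=> ia int_eig pd.
pose k := Num.floor alpha; pose a0 := alpha - k%:~R.
have aE : alpha = a0 + k%:~R by rewrite subrK.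
have a0_ge0 : 0 <= a0 by rewrite subr_ge0 floor_le.
have a0_lt1 : a0 < 1 by have := floorD1_gt alpha; rewrite -/k intrD /a0; lra.
have a0_gt0 : 0 < a0.
  rewrite lt_neqAle a0_ge0 andbT eq_sym subr_eq0.
  by have := irrational_natmul_neq k ia (ltn0Sn 0); rewrite mul1r.
pose e := Num.min a0 (1 - a0).
have e0 : 0 < e by rewrite lt_min a0_gt0 subr_gt0.
have e1 : e <= a0 by rewrite ge_min lexx.
have e2 : e <= 1 - a0 by rewrite ge_min lexx orbT.
pose E := rectangle_orbits e.
pose g (z : R * R) : R := \1_E z.
have gE z : E z -> g z = 1 by move=> Ez; rewrite /g indicE mem_set.
have gN z : ~ E z -> g z = 0 by move=> Ez; rewrite /g indicE memNset.
have iffE z z' : (E z <-> E z') -> g z = g z'.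
  by move=> H; have [/[dup] Ez /H Ez'|nE] := pselect (E z); [rewrite !gE|rewrite !gN// => /H].
have g1 x y : g (x + 1, y) = g (x, y) by apply: iffE; exact: rectangle_orbits_period.
have ga x y : g (x + alpha, y) = g (x, y + phi x) by apply: iffE; exact: rectangle_orbits_roof.
pose G (u : X) : R[i] := (special_lift g u +i* 0)%C.
have GE x y : G (pr x y) = (g (x, y) +i* 0)%C by rewrite /G special_liftE.
have mG : cmeasurable G.
  split; last exact: measurable_cst.
  apply: (@measurable_special_lift _ alpha phi g) => //.
  by apply: measurable_indic; exact: measurable_rectangle_orbits.
have G1 u : Normc.normc (G u) <= 1.
  have [[x y] ->] := special_pi_repr u; rewrite GE /= expr0n/= addr0 sqrtr_sqr /g indicE.
  by case: (_ \in _); rewrite ?normr1 ?normr0.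
have L2G : L2 G.
  split=> //; have m1 := measurable_normc mG.
  rewrite /L2norm unlock; apply: poweR_lty.
  apply: (@le_lt_trans _ _ (\int[mu]_u 1%E)%E); last by rewrite integral_cst// mul1e special_measure_fin.
  apply: ge0_le_integral => //.
  - by move=> u _; exact: poweR_ge0.
  - apply: (@measurableT_comp _ _ _ _ _ _ (fun x => x `^ 2)%E); first exact: measurable_poweR.
    by apply: measurableT_comp => //; exact/measurable_EFinP.
  - move=> u _; rewrite abse_EFin poweR_EFin ger0_norm ?normc_ge0// powR_mulrn ?normc_ge0// lee_fin.
    by rewrite exprn_ile1 ?normc_ge0.
pose d := Num.sqrt (e / 100).
have d0 : 0 < d by rewrite sqrtr_gt0 divr_gt0.
have [n [t [F [c [HF Hd]]]]] := pd G L2G d d0.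
pose H u := \sum_(i < n) c i * F i u.
have mD : cmeasurable (fun u => G u - H u).
  by apply: cmeasurableB => //; apply: cmeasurable_lincomb => i; have [[] ] := HF i.
have inv : {ae mu, forall u, H (special_flow 1 u) = H u}.
  have : {ae mu, forall u, forall j : nat, forall jn : (j < n)%N,
      F (Ordinal jn) (special_flow 1 u) = F (Ordinal jn) u}.
    apply: ae_all => j; have [jn|nj] : (j < n)%N \/ ~ (j < n)%N by case: (j < n)%N; [left|right].
      2: by apply: aeW => u jn; case: (nj jn).
    have [eig _] := HF (Ordinal jn); have [_ _ /(_ 1) fl] := eig.
    have [m tm] := int_eig _ (ex_intro _ _ eig).
    apply: ae_imp fl => u fl jn'; rewrite (bool_irrelevance jn' jn) fl tm mulr1.
    have -> : 2 * pi * m%:~R = 0 + m%:~R * (2 * pi) :> R by rewrite add0r mulrC.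
    by rewrite /cis cosDn2pi sinDn2pi cos0 sin0 -[(1 +i* 0)%C]/(1 : R[i]) mul1r.
  apply: ae_imp => u Hu; apply: eq_bigr => -[j jn] _; congr (_ * _); exact: Hu.
have mB := L2norm_markov mD d0 Hd; set B := [set u | _] in mB.
have measB : measurable B.
  have := measurable_normc mD measurableT (measurable_itv `[1 / 2, +oo[).
  rewrite setTI => mB'; rewrite (_ : B = (fun u => Normc.normc (G u - H u)) @^-1` `[1 / 2, +oo[)//.
  by apply/seteqP; split => u; rewrite /B /= in_itv/= andbT.
have dom x y : 0 <= x < e -> 1 / 5 <= y < 3 / 10 -> [/\ 0 <= x < 1, 0 <= y < phi x,
     0 <= x + a0 < 1 & 0 <= y + (1 - phi x) < phi (x + a0)].
  move=> /andP[x0 xe] /andP[y1 y2].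
  have := phi_bounds x; have := phi_bounds (x + a0).
  move: (phi (x + a0)) (phi x) => p' p /andP[p1 p2] /andP[p3 p4].
  by clear -a0_ge0 e1 e2 x0 xe y1 y2 p1 p2 p3 p4; split; apply/andP; split; lra.
have : ((e / 20)%:E <= mu B)%E.
  apply: (rectangle_image_measure (a0 := a0) measB e0 dom).
  apply: ae_imp (ae_special_domain inv) => x; apply: ae_imp => y Hxy xe ye.
  have [x01 y0 _ _] := dom x y xe ye; have {}Hxy := Hxy x01 y0.
  rewrite special_flowE in Hxy.
  have shift : pr (x + a0) (y + (1 - phi x)) = pr x (y + 1).
    have pr1 z : forall x', pr (x' + 1) z = pr x' z by move=> x'; exact: special_pi1.
    rewrite -(periodic_int (pr1 _) k) -addrA -aE special_pi_roof; congr (pr _ _).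
    by rewrite -addrA subrK.
  rewrite shift /B /=; apply: contrapT => /not_orP[/negP + /negP].
  rewrite -!ltNge Hxy !GE (gE (x, y)) ?(gN (x, y + 1)).
  - move=> h1 h2.
    have := le_normcD ((1 +i* 0)%C - H (pr x y)) (- ((0 +i* 0)%C - H (pr x y))).
    rewrite normcN (_ : _ + - (_ - _) = (1 +i* 0)%C); last first.
      by rewrite opprB addrA subrK; apply/eqP; rewrite eq_complex /= subr0 oppr0 addr0 !eqxx.
    by rewrite /= expr0n/= expr1n addr0 sqrtr1; lra.
  - exact: (rectangle_orbits_time_one aE).
  - exists 0%N; left; exists 0; rewrite /= ?addr0//.
    by move/andP: ye => [h1 h2]; rewrite h1 ltW.
apply/negP; rewrite -ltNge; apply: le_lt_trans mB _; rewrite lte_fin sqr_sqrtr; last by rewrite divr_ge0// ltW.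
by lra.
Qed.

End time_one.

(** * The construction under each arithmetic hypothesis *)

Section construction.
Context {R : realType}.

(** The weight [w] carries the regularity that is wanted; the last hypothesis says that [alpha] is
    well approximable at the scale of [w]. *)
Lemma mixed_spectrum_ceiling (w : R -> R) (alpha : R) : irrational alpha ->
  (forall x, 0 <= x -> 1 <= w x) -> (forall x y, 0 <= x -> x <= y -> w x <= w y) ->
  (forall (J Q : nat) (e : R), 0 < e -> exists (q : nat) (p : int),
     [/\ (0 < q)%N, (Q <= q)%N & `|q%:R * alpha - p%:~R| * w (2 * pi * J%:R * q%:R) <= e]) ->
  exists (phi : ceiling R) (l : nat -> seq (R * R * R)) (C : R),
    [/\ forall m, mode_weight w (l m) <= C / 2 ^+ m,
        forall x, sums_to (fun m => mode_eval (l m) x) (phi x),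
        cyclic_eigenvalues alpha phi & mixed_spectrum alpha phi].
Proof.
move=> ia w1 wmon small.
have w0 x : 0 <= x -> 0 <= w x by move=> /w1; exact: le_trans.
have [G [q [l [N [p tow]]]]] := tower_exists ia w0 wmon small.
have [phi [phiB mphi phiE]] := ceiling_of_tower tow w1.
have phi_half x : 1 / 2 <= phi x by have /andP[h _] := phiB x; lra.
have to_int t : Defs.eigenvalue alpha phi t -> exists n : int, t = n%:~R.
  apply: eigenvalue_int; first exact: split_returns_of_tower tow w1 _ phiE.
  by move=> x; have /andP[h1 h2] := phiB x; apply/andP; split; lra.
have of_int (n : int) : Defs.eigenvalue alpha phi n%:~R.
  exact: tower_eigenvalue_int tow w1 _ _ phi_half phiE.
(* the constant 1 is one more mode, of frequency 0 *)
pose l1 m := if m is 0 then (1, 0, 0) :: l 0 else l m.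
have l1E m x : mode_eval (l1 m) x = (m == 0)%:R + mode_eval (l m) x.
  case: m => [|m] /=; last by rewrite add0r.
  by rewrite /mode_eval big_cons /= mul0r addr0 cos0 mulr1.
exists phi, l1, (w 0 + 1); split.
- move=> m; have := tower_weight tow m; rewrite tower_geo => lw.
  have m0 : (0 : R) < (2 ^+ m)^-1 by rewrite invr_gt0 exprn_gt0.
  have w00 := w0 0 (lexx 0).
  case: m lw m0 => [|m] /= lw m0; last first.
    by apply: le_trans lw _; apply: ler_wpM2r; [exact: ltW|lra].
  by rewrite /mode_weight big_cons /= normr1 normr0 mul1r expr0 divr1 lerD2l; apply: le_trans lw _; rewrite expr0; lra.
- move=> x; have one : sums_to (fun m => (m == 0)%:R) (1 : R).
    apply: cvg_near_cst; exists 1%N => // n /= n1.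
    rewrite /series/= big_ltn// eqxx big_nat_cond big1 ?addr0// => i /andP[/andP[i1 _] _].
    by rewrite gtn_eqF.
  have := sums_toD one (phiE x); rewrite addrC subrK.
  by rewrite (_ : (fun m => _) = fun m => mode_eval (l1 m) x)//; apply/funext => m; rewrite l1E.
- exists 1 => t; split=> [/to_int[n ->]|[n ->]]; last exact: of_int.
  by exists n.
- split; last exact: int_eigenvalues_not_purely_discrete.
  by exists 1; [exact: oner_neq0|exact: of_int 1].
Qed.

(** Multiplication by [Q + 1] makes the denominator of an approximation large. *)
Lemma dirichlet_large (alpha : R) (Q : nat) (e : R) : 0 < e -> exists (q : nat) (p : int),
  [/\ (0 < q)%N, (Q <= q)%N & `|q%:R * alpha - p%:~R| <= e].
Proof.
move=> e0; have Q0 : (0 : R) < Q.+1%:R by [].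
have [q [p [q0 qp]]] := dirichlet alpha (divr_gt0 e0 Q0).
exists (Q.+1 * q)%N, (Q.+1%:Z * p); split; first by rewrite muln_gt0.
  by apply: leq_trans (leqnSn Q) _; rewrite leq_pmulr.
rewrite natrM intrM -[(Q.+1%:Z)%:~R]/(Q.+1%:R : R) -mulrA -mulrBr normrM normr_nat mulrC.
by rewrite -ler_pdivlMr//; exact: ltW.
Qed.

Section liouville.
Variables (alpha : R).
Hypothesis ia : irrational alpha.

Let d_gt0 q : (0 < q)%N -> 0 < dist_int (q%:R * alpha).
Proof. by move=> q0; apply: dist_int_gt0 => p; exact: irrational_natmul_neq. Qed.

(** If [q / - ln d < 1 / M] then [d < exp (- M q)], and [M] may be taken as large as the
    frequency factor requires. *)
Lemma small_of_exponential :
  inf [set q%:R / - ln (dist_int (q%:R * alpha)) | q in [set q : nat | (0 < q)%N]] = 0 ->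
  forall (J Q : nat) (e : R), 0 < e -> exists (q : nat) (p : int),
    [/\ (0 < q)%N, (Q <= q)%N & `|q%:R * alpha - p%:~R| * expR (2 * (2 * pi * J%:R * q%:R)) <= e].
Proof.
move=> inf0 J Q e e0.
have l_gt0 q : (0 < q)%N -> 0 < - ln (dist_int (q%:R * alpha)).
  by move=> q0; rewrite oppr_gt0 ln_lt0// d_gt0// dist_int_lt1.
pose M := 4 * pi * J%:R + `|ln e| + 1.
have M0 : 0 < M by rewrite ltr_wpDl// addr_ge0// !mulr_ge0// pi_ge0.
have [||q [q0 qQ qv]] := inf_eq0_infinitely_often _ inf0 Q (_ : 0 < M^-1).
- by move=> q q0; rewrite divr_gt0 ?ltr0n// l_gt0.
- by rewrite invr_gt0.
have q0' : (0 : R) < q%:R by rewrite ltr0n.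
have q1 : (1 : R) <= q%:R by rewrite ler1n.
have dM : dist_int (q%:R * alpha) < expR (- (M * q%:R)).
  rewrite -ltr_ln ?posrE ?expR_gt0 ?d_gt0// expRK ltrNr.
  by move: qv; rewrite ltr_pdivrMr ?l_gt0// mulrC ltr_pdivlMr// mulrC.
have [p qp] := dist_int_lt dM.
exists q, p; split=> //.
apply: (@le_trans _ _ (expR (- (M * q%:R)) * expR (2 * (2 * pi * J%:R * q%:R)))).
  by rewrite ler_wpM2r ?expR_ge0//; exact: ltW.
rewrite -expRD -[leRHS]lnK ?posrE// ler_expR.
have -> : - (M * q%:R) + 2 * (2 * pi * J%:R * q%:R) = - ((`|ln e| + 1) * q%:R) by rewrite /M; ring.
have le1 : - ln e <= `|ln e| by rewrite -normrN ler_norm.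
rewrite lerNl; apply: le_trans le1 _; have := normr_ge0 (ln e); nra.
Qed.

Lemma small_of_polynomial (k : nat) :
  inf [set q%:R ^+ k.+1 * dist_int (q%:R * alpha) | q in [set q : nat | (0 < q)%N]] = 0 ->
  forall (J Q : nat) (e : R), 0 < e -> exists (q : nat) (p : int),
    [/\ (0 < q)%N, (Q <= q)%N & `|q%:R * alpha - p%:~R| * (1 + 2 * pi * J%:R * q%:R) ^+ k.+1 <= e].
Proof.
move=> inf0 J Q e e0.
pose A : R := (1 + 2 * pi * J%:R) ^+ k.+1.
have B0 : 0 < 1 + 2 * pi * J%:R :> R by rewrite ltr_wpDr// !mulr_ge0// pi_ge0.
have A0 : 0 < A by rewrite exprn_gt0.
have [||q [q0 qQ qv]] := inf_eq0_infinitely_often _ inf0 Q (_ : 0 < e / A).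
- by move=> q q0; rewrite mulr_gt0 ?d_gt0// exprn_gt0// ltr0n.
- exact: divr_gt0.
have q0' : (0 : R) < q%:R by rewrite ltr0n.
have q1 : (1 : R) <= q%:R by rewrite ler1n.
have qk : (0 : R) < q%:R ^+ k.+1 by rewrite exprn_gt0.
have dM : dist_int (q%:R * alpha) < e / A / q%:R ^+ k.+1 by rewrite ltr_pdivlMr// mulrC.
have [p qp] := dist_int_lt dM.
exists q, p; split=> //.
apply: (@le_trans _ _ (e / A / q%:R ^+ k.+1 * (A * q%:R ^+ k.+1))).
  apply: ler_pM => //; [|exact: ltW|].
    by rewrite exprn_ge0// addr_ge0// !mulr_ge0// pi_ge0.
  rewrite /A -exprMn lerXn2r ?nnegrE//.
  - by rewrite addr_ge0// !mulr_ge0// pi_ge0.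
  - by rewrite mulr_ge0// ltW.
  - by rewrite [leRHS]mulrDl mul1r lerD2r.
by rewrite mulrACA [e / A]mulrC -!mulrA; rewrite le_eqVlt; apply/orP; left; apply/eqP; field; rewrite !gt_eqF.
Qed.

End liouville.
End construction.

Theorem mainTheorem6 (R : realType) (alpha : R) (halpha : irrational alpha) :
  [/\ exists phi : ceiling R,
        cyclic_eigenvalues alpha phi /\ mixed_spectrum alpha phi,
      inf [set q%:R / - ln (dist_int (q%:R * alpha)) | q in [set q : nat | (0 < q)%N]] = 0 ->
      exists phi : ceiling R,
        [/\ real_analytic phi,
            cyclic_eigenvalues alpha phi & mixed_spectrum alpha phi]
    & forall k : nat,
      inf [set q%:R ^+ k.+1 * dist_int (q%:R * alpha) | q in [set q : nat | (0 < q)%N]] = 0 ->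
      exists phi : ceiling R,
        [/\ continuously_differentiable k phi,
            cyclic_eigenvalues alpha phi & mixed_spectrum alpha phi] ].
Proof.
split.
- have [|||phi [l [C [_ _ cyc mix]]]] := mixed_spectrum_ceiling (w := fun=> 1) halpha.
  + by [].
  + by [].
  + move=> J Q e e0; have [q [p [q0 qQ qp]]] := dirichlet_large alpha Q e0.
    by exists q, p; split=> //; rewrite mulr1.
  + by exists phi.
- move=> inf0.
  have [|||phi [l [C [lC phiE cyc mix]]]] :=
      mixed_spectrum_ceiling (w := fun om => expR (2 * om)) halpha.
  + by move=> x x0; rewrite -expR0 ler_expR mulr_ge0.
  + by move=> x y x0 xy; rewrite ler_expR ler_pM2l.
  + exact: small_of_exponential.
  + by exists phi; split=> //; exact: real_analytic_mode_series lC phiE.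
- move=> k inf0.
  have [|||phi [l [C [lC phiE cyc mix]]]] :=
      mixed_spectrum_ceiling (w := fun om => (1 + om) ^+ k.+1) halpha.
  + by move=> x x0; rewrite exprn_ege1// lerDl.
  + by move=> x y x0 xy; rewrite lerXn2r ?nnegrE ?addr_ge0 ?(le_trans x0 xy)// lerD2l.
  + exact: small_of_polynomial.
  + by exists phi; split=> //; exact: continuously_differentiable_mode_series lC phiE.
Qed.
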